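(* Let $\alpha=\alpha_{-3}\approx 3.1479$ be the real root of $t^3-4t^2+3t-1$, let $\beta=\alpha/(\alpha-1)$, and let $$\Xi:=\{u_1\psi(1-\beta)+u_2\psi(1-\beta^2): u_1,u_2\in\mathbb{Z}\}.$$ Then $$\dim_H(\partial\mathcal{F}_\alpha)=\frac{2\log(\mu)}{\log(\beta)}\approx 1.25074,$$ where $\mu\approx 1.27004$ is the dominant root of $t^{10}-t^7-t^3-2t-1$, and the collection $\{x+\mathcal{F}_\alpha: x\in\Xi\}\cup\{x+(\psi(1)-\mathcal{F}_\alpha): x\in\Xi\}$ is a proper tiling of $\mathbb{K}_\alpha=\mathbb{C}$.
   Context: Fix a non-real Galois conjugate $\alpha'$ of $\alpha$ and let $\psi:\mathbb{Q}(\alpha)\to\mathbb{C}$ be the field embedding with $\psi(\alpha)=\alpha'$. Both $\alpha$ and $\beta$ are Pisot units, so $f_L(x)=\psi(\alpha)x$ and $f_R(x)=\psi(\beta)(\psi(1)-x)$ are contractions of $\mathbb{C}$. The tent-tile $\mathcal{F}_\alpha$ is the unique non-empty compact set $\mathcal{F}_\alpha\subset\mathbb{C}$ with $\mathcal{F}_\alpha=f_L(\mathcal{F}_\alpha)\cup f_R(\mathcal{F}_\alpha)$. For a set $F$, $c-F=\{c-y:y\in F\}$. $\dim_H$ denotes Hausdorff dimension and $\partial$ the topological boundary. The dominant root of a polynomial is its root of largest modulus. A collection $\{Y_i:i\in I\}$ of compact subsets of a Euclidean space $\mathbb{E}$ is a (proper) tiling of $\mathbb{E}$ if (1) $\bigcup_{i\in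 I}Y_i=\mathbb{E}$; (2) for each compact $Y\subset\mathbb{E}$ the set $\{i\in I:Y\cap Y_i\neq\emptyset\}$ is finite; (3) for Lebesgue-almost every $x\in\mathbb{E}$ the set $\{i\in I:x\in Y_i\}$ has exactly one element. *)

(* Defs.v *)
From HB Require Import structures.
From mathcomp Require Import all_boot all_order all_algebra all_field.
From mathcomp Require Import complex.
From mathcomp Require Import all_classical all_reals all_analysis.
Import Order.TTheory GRing.Theory Num.Theory.
Import numFieldNormedType.Exports.

Set Implicit Arguments.
Unset Strict Implicit.
Unset Printing Implicit Defensive.

Local Open Scope classical_set_scope.
Local Open Scope ring_scope.

(* The library puts the norm topology on a numFieldType only through R^o;
   transfer it to R[i]. *)
HB.instance Definition _ (R : realType) := PseudoPointedMetric.copy R[i] R[i]^o.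
HB.instance Definition _ (R : realType) := NormedModule.copy R[i] R[i]^o.

Section hausdorff.
Context {R : realType} {T : Type} (d : T -> T -> R).
Local Open Scope ereal_scope.

(* The point 0 makes the diameter of the empty set 0 rather than -oo. *)
Definition diam (A : set T) : \bar R :=
  ereal_sup (0 |` [set (d x y)%:E | x in A & y in A]).

(* The empty set contributes 0 even when s = 0, where 0 `^ 0 = 1. *)
Definition diam_pow (s : R) (A : set T) : \bar R :=
  if A == set0 then 0 else diam A `^ s.

Definition hausdorff_premeasure (s delta : R) (A : set T) : \bar R :=
  ereal_inf [set \sum_(0 <= i <oo) diam_pow s (U i) |
    U in [set U : (set T)^nat |
      A `<=` \bigcup_i U i /\ forall i, diam (U i) <= delta%:E]].

Definition hausdorff_measure (s : R) (A : set T) : \bar R :=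
  ereal_sup [set hausdorff_premeasure s delta A |
    delta in [set delta : R | (0 < delta)%R]].

Definition hausdorff_dim (A : set T) : \bar R :=
  ereal_inf [set s%:E | s in [set s : R |
    (0 <= s)%R /\ hausdorff_measure s A = 0]].

End hausdorff.

Definition boundary {T : topologicalType} (A : set T) : set T :=
  closure A `\` interior A.

Section complex_plane.
Context {R : realType}.

Definition complex_dist (z w : R[i]) : R := complex.Re `|z - w|.

(* "Lebesgue-almost every z in C", through the identification of C with R^2. *)
Definition ae_complex (P : R[i] -> Prop) : Prop :=
  {ae (@lebesgue_measure R \x @lebesgue_measure R)%E,
    forall u, P (Complex u.1 u.2)}.

Definition proper_tiling (I : Type) (D : set I) (Y : I -> set R[i]) : Prop :=
  [/\ forall i, D i -> compact (Y i),
      \bigcup_(i in D) Y i = setT,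
      forall K : set R[i], compact K ->
        finite_set [set i | D i /\ K `&` Y i !=set0]
    & ae_complex (fun z => exists! i, D i /\ Y i z)].

Definition dominant_root (p : {poly R[i]}) (z : R[i]) : Prop :=
  root p z /\ forall w, root p w -> w != z -> `|w| < `|z|.

Definition galois_conjugate (x : R) (z : R[i]) : Prop :=
  exists p : {poly rat}, [/\ p \is monic, irreducible_poly p,
    root (map_poly ratr p) x & root (map_poly ratr p) z].

End complex_plane.

Definition alpha_poly (S : nzRingType) : {poly S} :=
  'X^3 - 'X^2 *+ 4 + 'X *+ 3 - 1.

Definition mu_poly (S : nzRingType) : {poly S} :=
  'X^10 - 'X^7 - 'X^3 - 'X *+ 2 - 1.

(* Q(alpha) as a subfield of R, for alpha a root of alpha_poly;
   subfx_inj is its inclusion in R. *)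
Definition Qalpha (R : realType) (alpha : R) : fieldType :=
  subFExtend (@ratr R) alpha (alpha_poly rat).

Definition Qalpha_gen (R : realType) (alpha : R) : Qalpha alpha :=
  subfx_root (@ratr R) alpha (alpha_poly rat).

Definition Qalpha_inj (R : realType) (alpha : R) : Qalpha alpha -> R :=
  @subfx_inj _ _ (@ratr R) alpha (alpha_poly rat).

Section tent_tile.
Context {R : realType} {K : fieldType} (psi : {rmorphism K -> R[i]}) (a : K).

Definition beta_of : K := a / (a - 1).

Definition tent_left (x : R[i]) : R[i] := psi a * x.
Definition tent_right (x : R[i]) : R[i] := psi beta_of * (psi 1 - x).

Definition is_tent_tile (F : set R[i]) : Prop :=
  [/\ F !=set0, compact F & F = tent_left @` F `|` tent_right @` F].

Definition tent_lattice : set R[i] :=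
  [set z | exists u1 u2 : int,
    z = u1%:~R * psi (1 - beta_of) + u2%:~R * psi (1 - beta_of ^+ 2)].

(* The two families of translates are indexed by a disjoint union, so that a
   coincidence between x + F and y + (psi 1 - F) would count twice. *)
Definition tent_index : set (R[i] + R[i]) :=
  inl @` tent_lattice `|` inr @` tent_lattice.

Definition tent_family (F : set R[i]) (i : R[i] + R[i]) : set R[i] :=
  match i with
  | inl x => [set x + y | y in F]
  | inr x => [set x + y | y in [set psi 1 - y | y in F]]
  end.

End tent_tile.

(* Main.v *)
(* Put b = psi(beta); then b^3 = b^2 + 1, F = b^3 F u b (1 - F), and the pieces of
   F are the sets y + e b^j F with y in Z[b], e = 1 or -1 and j < 3.

   Subdividing the pieces of the tiling and rescaling by b^-n gives a collection
   of pieces that is cut out by a condition on an integer-valued height of y, a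
   window whose width grows like beta^n. Hence these pieces come within a bounded
   distance of every point, and dividing by b^n shows that the tiling covers C.
   As |b|^2 = 1 / beta and beta is real, |y|^2 is an explicit quadratic form in
   the coordinates of y, which gives local finiteness.

   Two meeting pieces of the tiling have one of 21 relative positions. The
   transitions between these positions under subdivision form a graph whose
   adjacency matrix has eigenvalue mu with a positive eigenvector, so that a pair
   of overlapping pieces has about mu^n overlapping pairs of subpieces of size
   beta^(-n/2). As mu < beta, overlaps are null; they contain no open set either,
   since an open set would contain about beta^n subpieces. Together with the
   covering property this identifies the boundary of F with its intersection with
   the other tiles. Counting subpieces bounds the Hausdorff dimension above by
   2 log mu / log beta, and the eigenvector, viewed as a mass distribution on the
   overlaps, bounds it below. *)

(* The maps of F contract by |b|^3 and |b|. Delaying the smaller copy for two steps keeps the pieces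
   of level n comparable to |b|^n and, after division by b^n, of the form y + e b^j F with y in
   Z[b]; this is why few relative positions occur. For fixed y the height at level n is, up to an
   error tending to 0, a constant times beta^n times the real conjugate of y, so the window is a
   cut-and-project condition. Integers leave no endpoints to discuss, and the recurrence of [wd]
   cuts each window exactly into the windows of the possible parents. A piece therefore has one
   parent, and counting a list of descendants counts distinct pieces. The finite checks run on
   binary integers: disjointness is certified by discs around the fixed point of x -> b (1 - x), and
   the eigenvector consists of polynomials in 1 / mu with natural coefficients, so that its
   positivity is visible and mu enters only through its equation. Finiteness of local patterns comes
   from bounding both the complex and the real conjugate of the anchors y. *)
Require Import Defs.
From Stdlib Require Import ZArith.
From mathcomp Require Import all_boot all_order all_algebra all_field.
From mathcomp Require Import complex.
From mathcomp Require Import all_classical all_reals all_analysis.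
From mathcomp Require Import ring lra zify ssrZ.
Import Order.TTheory GRing.Theory Num.Theory.
Import numFieldNormedType.Exports.
Import Normc.

Set Implicit Arguments.
Unset Strict Implicit.
Unset Printing Implicit Defensive.

Local Open Scope classical_set_scope.
Local Open Scope ring_scope.
Local Delimit Scope Z_scope with BZ.
Local Arguments Z.add : simpl never.
Local Arguments Z.sub : simpl never.
Local Arguments Z.mul : simpl never.

(** * The topology of the complex plane *)

Section modulus.
Context {R : realType}.
Implicit Types (z w : R[i]) (A B : set R[i]).

Lemma normc_ge0 z : 0 <= normc z.
Proof. by case: z => x y; exact: sqrtr_ge0. Qed.

Lemma normcB z w : normc (z - w) = normc (w - z).
Proof. by rewrite -opprB (normcN (w - z : Rcomplex R)). Qed.

Lemma ler_normcD z w : normc (z + w) <= normc z + normc w.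
Proof. exact: (le_normcD (z : Rcomplex R) w). Qed.

Lemma ler_distc_add w z z' : normc (z - z') <= normc (z - w) + normc (w - z').
Proof. by rewrite (_ : z - z' = (z - w) + (w - z')) ?ler_normcD//; ring. Qed.

Lemma normcX z n : normc (z ^+ n) = normc z ^+ n.
Proof. by elim: n => [|n ih]; rewrite ?expr0 ?normc1// !exprS normcM ih. Qed.

Lemma normc_eq0 z : (normc z == 0) = (z == 0).
Proof.
by apply/eqP/eqP => [/eq0_normc//|->]; exact: normc0.
Qed.

Lemma normc_sq z : normc z ^+ 2 = complex.Re z ^+ 2 + complex.Im z ^+ 2.
Proof. by case: z => x y /=; rewrite sqr_sqrtr// addr_ge0 ?sqr_ge0. Qed.

Lemma Re_le_normc z : `|complex.Re z| <= normc z.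
Proof.
rewrite -(@ler_pXn2r _ 2)// ?nnegrE ?normc_ge0// real_normK ?num_real//.
by rewrite normc_sq lerDl sqr_ge0.
Qed.

Lemma Im_le_normc z : `|complex.Im z| <= normc z.
Proof.
rewrite -(@ler_pXn2r _ 2)// ?nnegrE ?normc_ge0// real_normK ?num_real//.
by rewrite normc_sq lerDr sqr_ge0.
Qed.

Lemma nbhs_normcP z A :
  nbhs z A <-> exists2 e : R, 0 < e & forall w, normc (w - z) < e -> A w.
Proof.
split=> [/nbhs_ballP[e /= e0 ea]|[e e0 ea]].
  have /andP[/eqP ei er] : (complex.Im e == 0) && (0 < complex.Re e).
    by move: e0; rewrite ltcE.
  exists (complex.Re e) => // w wz; apply: ea.
  rewrite -ball_normE /= /ball_ /= -normrN opprB.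
  by rewrite ltcE /= ei eqxx.
apply/nbhs_ballP; exists (e%:C)%C; first by rewrite /= ltcR.
move=> w; rewrite -ball_normE /= /ball_ /= -normrN opprB => wz; apply: ea.
by move: wz; rewrite ltcE /= => /andP[].
Qed.

Lemma closed_far z A : closed A -> ~ A z ->
  exists2 e : R, 0 < e & forall w, A w -> e <= normc (w - z).
Proof.
rewrite -openC openE => oA nA; have /nbhs_normcP[e e0 ea] := oA _ nA.
by exists e => // w Aw; rewrite leNgt; apply/negP => /ea.
Qed.

Lemma compact_closedc A : compact A -> closed A.
Proof. exact: compact_closed (@norm_hausdorff _ R[i]). Qed.

Lemma open_disc z (e : R) : open [set w : R[i] | normc (w - z) < e].
Proof.
rewrite openE => w /= wz; apply/nbhs_normcP.
exists (e - normc (w - z)); first by rewrite subr_gt0.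
move=> x; rewrite ltrBrDr => xw; apply: le_lt_trans xw.
exact: ler_distc_add.
Qed.

Lemma compact_normc_bounded A : compact A ->
  exists2 M : R, 0 < M & forall z, A z -> normc z <= M.
Proof.
rewrite compact_cover => /(_ nat setT
  (fun n => [set w : R[i] | normc (w - 0) < n%:R])) [].
- by move=> n _; exact: open_disc.
- move=> z Az; exists (Num.truncn (normc z)).+1 => //=.
  by rewrite subr0 truncnS_gt.
move=> D _ AD; exists (\sum_(i <- finmap.enum_fset D) i%:R + 1).
  by rewrite ltr_wpDl// sumr_ge0.
move=> z /AD[n /= nD]; rewrite subr0 => /ltW/le_trans; apply.
rewrite (big_rem n)//= -addrA lerDl addr_ge0// sumr_ge0//.
Qed.

(** A cluster point of points of [A] that come ever closer to [B] cannot have positive distance from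
    the closed set [B]. *)
Lemma compact_meet A B : compact A -> closed B ->
  (forall e : R, 0 < e -> exists x y, [/\ A x, B y & normc (x - y) < e]) ->
  A `&` B !=set0.
Proof.
move=> cA cB AB.
have h (n : nat) : exists xy : R[i] * R[i],
    [/\ A xy.1, B xy.2 & normc (xy.1 - xy.2) < n.+1%:R^-1].
  by have [x [y xy]] := AB n.+1%:R^-1 (ltac:(by rewrite invr_gt0));
    exists (x, y).
have [f fP] := choice h.
have [] := cA ((fst \o f) @ \oo) _; first by exists 0%N => // n _; have [] := fP n.
move=> p [Ap clp]; exists p; split => //.
apply: contrapT => /(closed_far cB)[e e0 eB].
have := clp [set x | exists2 y, B y & normc (x - y) < e / 2]
  [set x | normc (x - p) < e / 2].
case.
- have e20 : 0 < e / 2 by rewrite divr_gt0.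
  apply: filterS (near_infty_natSinv_lt (PosNum e20)) => n /= ne.
  by have [_ By lt] := fP n; exists (f n).2 => //; exact: lt_trans ne.
- by apply/nbhs_normcP; exists (e / 2); rewrite ?divr_gt0.
move=> x [[y By xy] xp]; have := eB _ By.
have := ler_distc_add x y p; rewrite normcB in xy; move: xy xp => /=; lra.
Qed.

End modulus.

(** * Tiles and their subdivision *)

(** Binary integers carry all certified computations; [zr] transports their results to the rings
    where the geometry takes place. *)
Definition zr {K : pzRingType} (z : Z) : K := (int_of_Z z)%:~R.

Section zr.
Context {K : pzRingType}.
Implicit Types x y : Z.

Lemma zrD x y : zr (x + y)%BZ = zr x + zr y :> K.
Proof. by rewrite /zr -intrD; congr (_%:~R); lia. Qed.

Lemma zrN x : zr (- x)%BZ = - zr x :> K.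
Proof. by rewrite /zr -intrN; congr (_%:~R); lia. Qed.

Lemma zrB x y : zr (x - y)%BZ = zr x - zr y :> K.
Proof. by rewrite -Z.add_opp_r zrD zrN. Qed.

Lemma zrM x y : zr (x * y)%BZ = zr x * zr y :> K.
Proof. by rewrite /zr -intrM; congr (_%:~R); lia. Qed.

Lemma zr0 : zr 0%BZ = 0 :> K. Proof. by []. Qed.
Lemma zr1 : zr 1%BZ = 1 :> K. Proof. by []. Qed.

Lemma zr_nat n : zr (Z.of_nat n) = n%:R :> K.
Proof. by rewrite /zr pmulrn; congr (_%:~R); lia. Qed.

Definition zrE := (zrB, zrD, zrN, zrM, zr0, zr1).
End zr.

Lemma ler_zr {K : numDomainType} (x y : Z) :
  (zr x <= zr y :> K) = (x <=? y)%BZ.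
Proof. by rewrite /zr ler_int; lia. Qed.

Lemma ltr_zr {K : numDomainType} (x y : Z) :
  (zr x < zr y :> K) = (x <? y)%BZ.
Proof. by rewrite /zr ltr_int; lia. Qed.


(** * The ring Z[b] in integer coordinates, and the subdivision of tiles *)

Definition Z3 := (Z * Z * Z)%type.

Definition add3 (d e : Z3) : Z3 :=
  let: (d0, d1, d2) := d in let: (e0, e1, e2) := e in
  ((d0 + e0)%BZ, (d1 + e1)%BZ, (d2 + e2)%BZ).

Definition scale3 (k : Z) (d : Z3) : Z3 :=
  let: (d0, d1, d2) := d in ((k * d0)%BZ, (k * d1)%BZ, (k * d2)%BZ).

Definition sub3 (d e : Z3) : Z3 := add3 d (scale3 (-1) e).

(** Multiplication by b in the basis 1, b, b^2. As b (b^2 - b) = 1, b is a unit and [divb] stays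
    integral. *)
Definition mulb (d : Z3) : Z3 :=
  let: (d0, d1, d2) := d in (d2, d0, (d1 + d2)%BZ).

Definition divb (d : Z3) : Z3 :=
  let: (d0, d1, d2) := d in (d1, (d2 - d0)%BZ, d0).

(** At x = b this is the position in the plane, at x = beta the real conjugate; the two together
    embed Z[b] as a discrete set. *)
Definition emb {K : pzRingType} (x : K) (d : Z3) : K :=
  let: (d0, d1, d2) := d in zr d0 + zr d1 * x + zr d2 * x ^+ 2.

Lemma mulbK : cancel mulb divb.
Proof. by move=> [[a b] c] /=; congr (_, _, _); lia. Qed.

Lemma divbK : cancel divb mulb.
Proof. by move=> [[a b] c] /=; congr (_, _, _); lia. Qed.

Section emb.
Context {K : comPzRingType} (x : K).

Lemma emb_add d e : emb x (add3 d e) = emb x d + emb x e.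
Proof. by case: d e => [[? ?] ?] [[? ?] ?] /=; rewrite !zrE; ring. Qed.

Lemma emb_scale k d : emb x (scale3 k d) = zr k * emb x d.
Proof. by case: d => [[? ?] ?] /=; rewrite !zrE; ring. Qed.

Lemma emb_sub d e : emb x (sub3 d e) = emb x d - emb x e.
Proof. by rewrite emb_add emb_scale (zrN 1) zr1 mulN1r. Qed.

Hypothesis x3 : x ^+ 3 = x ^+ 2 + 1.

Lemma emb_mulb d : emb x (mulb d) = x * emb x d.
Proof.
case: d => [[a b] c] /=; rewrite !zrE.
have -> : x * (zr a + zr b * x + zr c * x ^+ 2) =
  zr a * x + zr b * x ^+ 2 + zr c * x ^+ 3 by ring.
by rewrite x3; ring.
Qed.

Lemma emb_divb d : x * emb x (divb d) = emb x d.
Proof. by rewrite -emb_mulb divbK. Qed.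

Lemma emb_iter_mulb k d : emb x (iter k mulb d) = x ^+ k * emb x d.
Proof.
by elim: k => [|k ih] /=; rewrite ?expr0 ?mul1r// emb_mulb ih mulrA exprS.
Qed.
End emb.

(* The tile (y, e, j) stands for the set y + e b^j F with e = 1 or -1. *)
Definition tile := (Z3 * bool * nat)%type.

Definition sg (e : bool) : Z := if e then 1%BZ else (-1)%BZ.

(** From y + e F = (y + e b^3 F) u (y + e b - e b F), divided by b. The copy scaled by b^3 becomes e
    b^2 F and waits, with j = 2 and then j = 1, until it has the size of F again. *)
Definition children (t : tile) : seq tile :=
  let: (y, e, j) := t in
  if j is j'.+1 then [:: (divb y, e, j')]
  else [:: (divb y, e, 2); (add3 (divb y) (sg e, 0%BZ, 0%BZ), ~~ e, 0)]%N.

(* A pair of tiles up to a translation and a sign. *)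
Definition node := (nat * bool * nat * Z3)%type.

Definition rel_pos (tu : tile * tile) : node :=
  let: ((y, e, j), (y', e', j')) := tu in
  (j, e == e', j', scale3 (sg e) (sub3 y' y)).

Definition pairs (t u : tile) : seq (tile * tile) :=
  [seq (c, d) | c <- children t, d <- children u].

Definition node_children (nd : node) : seq node :=
  let: (j, s, j', d) := nd in
  map rel_pos (pairs ((0, 0, 0)%BZ, true, j) (d, s, j')).

(** Subdivision commutes with translations and with the change of sign, so the transitions form a
    graph on relative positions alone. *)
Lemma rel_pos_pairs t u :
  map rel_pos (pairs t u) = node_children (rel_pos (t, u)).
Proof.
case: t u => [[[[a b] c] e] j] [[[[a' b'] c'] e'] j'].
case: j => [|j]; case: j' => [|j']; case: e; case: e';
  rewrite /pairs /rel_pos [LHS]/= [RHS]/=; repeat (congr cons);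
  congr (_, _); congr (_, _, _); lia.
Qed.

(** * Iterated substitutions: uniqueness of descendants and eigenvectors *)

Section levels.
Context {T : eqType} (ch : T -> seq T).

Definition level (n : nat) (s : seq T) : seq T :=
  iter n (fun s => flatten (map ch s)) s.

Lemma levelSr n s : level n.+1 s = level n (flatten (map ch s)).
Proof. by rewrite /level iterSr. Qed.

Lemma levelD m n s : level (m + n) s = level m (level n s).
Proof. exact: iterD. Qed.

Lemma level_cat n s1 s2 : level n (s1 ++ s2) = level n s1 ++ level n s2.
Proof. by elim: n => //= n ->; rewrite map_cat flatten_cat. Qed.

Lemma mem_level n s x :
  (x \in level n s) = has (fun y => x \in level n [:: y]) s.
Proof.
elim: s => [|y s ih]; first by rewrite (_ : level n [::] = [::])//; elim: n => //= n ->.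
by rewrite -cat1s level_cat mem_cat ih has_cat /= orbF.
Qed.

Lemma mem_levelD m n s x : reflect
  (exists2 y, y \in level n s & x \in level m [:: y]) (x \in level (m + n) s).
Proof. by rewrite levelD mem_level; exact: hasP. Qed.

Lemma level_ind (P : nat -> T -> Prop) n k s :
  (forall n x y, P n x -> y \in ch x -> P n.+1 y) ->
  (forall x, x \in s -> P k x) -> forall x, x \in level n s -> P (k + n)%N x.
Proof.
move=> PS; elim: n k s => [|n ih] k s Ps x; first by rewrite addn0; exact: Ps.
rewrite levelSr -addSnnS; apply: ih => {}x /flatten_mapP[y ys].
exact/PS/Ps.
Qed.

(** Lists of children of different elements are disjoint as soon as a child determines its parent;
    [P n] is the invariant of level n under which it does. *)
Lemma level_uniq (P : nat -> T -> Prop) n s :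
  (forall n x y, P n x -> y \in ch x -> P n.+1 y) ->
  (forall x, uniq (ch x)) ->
  (forall n x x' y, P n x -> P n x' -> y \in ch x -> y \in ch x' -> x = x') ->
  (forall x, x \in s -> P 0%N x) -> uniq s -> uniq (level n s).
Proof.
move=> PS uch Pinj Ps us.
have : (forall x, x \in level n s -> P n x) /\ uniq (level n s).
  split=> //; first exact: (@level_ind P n 0 s).
  elim: n => //= n; have : forall x, x \in level n s -> P n x.
    exact: (@level_ind P n 0 s).
  elim: (level n s) => //= x l ihl Pl /andP[xl ul].
  rewrite cat_uniq uch ihl ?andbT//=; last by move=> y yl; apply: Pl; rewrite inE yl orbT.
  apply/hasPn => y /flatten_mapP[z zl yz] /=; apply/negP => yx.
  move: xl; rewrite (Pinj n x z y)// ?zl//; first by apply: Pl; rewrite inE eqxx.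
  by apply: Pl; rewrite inE zl orbT.
by case.
Qed.

(** Here [w] is an eigenvector of the substitution matrix for the eigenvalue [m]. *)
Lemma level_weight {K : comNzRingType} (P : pred T) (w : T -> K) (m : K) n s :
  (forall x y, P x -> y \in ch x -> P y) ->
  (forall x, P x -> \sum_(y <- ch x) w y = m * w x) -> all P s ->
  \sum_(y <- level n s) w y = m ^+ n * \sum_(x <- s) w x.
Proof.
move=> Pch chw /allP Ps; elim: n => [|n ih]; first by rewrite mul1r.
have Pl x : x \in level n s -> P x.
  by apply: (@level_ind (fun _ => P) n 0) => // _; exact: Pch.
rewrite exprS -mulrA -ih /= big_flatten big_map/= mulr_sumr.
by rewrite big_seq [RHS]big_seq; apply: eq_bigr => x /Pl/chw.
Qed.
End levels.

(* wd (n + 2) is the sum of the coordinates of b^n in the basis 1, b, b^2. *)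
Fixpoint wd (n : nat) : Z :=
  match n with
  | 0 | 1 => 0%BZ
  | 2 => 1%BZ
  | S ((S (S m)) as k) => (wd k + wd m)%BZ
  end%N.

Lemma wdS n : wd n.+3 = (wd n.+2 + wd n)%BZ. Proof. by []. Qed.

Local Arguments wd : simpl never.

Lemma wd_ge0 n : (0 <= wd n)%BZ.
Proof.
suff: (0 <= wd n /\ 0 <= wd n.+1 /\ 0 <= wd n.+2)%BZ by case.
by elim: n => [|n [? [? ?]]]; [rewrite /wd; lia|rewrite wdS; lia].
Qed.

Lemma wd_leS n : (wd n <= wd n.+1)%BZ.
Proof.
by case: n => [|[|n]]; [rewrite /wd; lia|rewrite /wd; lia|];
  rewrite wdS; have := @wd_ge0 n; lia.
Qed.

Lemma wd_le m n : (m <= n)%N -> (wd m <= wd n)%BZ.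
Proof.
move=> /subnK <-; elim: (n - m)%N => [|k]; rewrite ?add0n ?addSn; first by lia.
by have := @wd_leS (k + m); lia.
Qed.

(* The sum of the coordinates of b^n y. *)
Definition height (n : nat) (y : Z3) : Z :=
  let: (y0, y1, y2) := y in
  (wd n.+2 * y0 + wd n.+3 * y1 + wd n.+4 * y2)%BZ.

Lemma heightS n y : height n.+1 y = height n (mulb y).
Proof. by case: y => [[a b] c] /=; rewrite (wdS n.+2); lia. Qed.

Lemma heightD n y z : height n (add3 y z) = (height n y + height n z)%BZ.
Proof. by case: y z => [[? ?] ?] [[? ?] ?] /=; lia. Qed.

Lemma height_scale n k y : height n (scale3 k y) = (k * height n y)%BZ.
Proof. by case: y => [[? ?] ?] /=; lia. Qed.

(** As [wd 0] and [wd 1] vanish and [wd 2] is 1, level 0 leaves only delay 0, with height 0 for the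
    sign + and height 1 for the sign -: the tiles x + F and x + (1 - F) of the tiling. The indices
    2, 0, 1 make the width invariant when a tile passes from delay 0 to 2 and from 2 to 1. *)
Definition window (n : nat) (t : tile) : bool :=
  let: (y, e, j) := t in
  let w := wd (n + nth 0 [:: 2; 0; 1] j) in
  (j < 3)%N && if e then (- w <? height n y)%BZ && (height n y <=? 0)%BZ
  else (0 <? height n y)%BZ && (height n y <=? w)%BZ.

Lemma window_children n t c : window n t -> c \in children t -> window n.+1 c.
Proof.
case: t => [[y e] [|[|[|j]]]] //=.
- have h1 : height n.+1 (sg e, 0%BZ, 0%BZ) = (sg e * wd n.+3)%BZ by rewrite /=; lia.
  rewrite !inE => w /orP[]/eqP -> /=; last first.
    rewrite heightD heightS divbK h1; move: w; rewrite !addn2.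
    by have := wdS n; have := @wd_ge0 n; case: e {h1} => /=; lia.
  by move: w; rewrite heightS divbK addn1 addn2.
- rewrite inE addn0 => w /eqP -> /=.
  move: w; rewrite heightS divbK addn2.
  by have := @wd_le n n.+3 (ltac:(lia)); case: e => /=; lia.
- by rewrite inE addn1 => w /eqP -> /=; rewrite heightS divbK addn0.
Qed.

(** By [wdS], the window of delay 0 at level n + 1 splits into a part of width [wd n], whose tiles
    come from delay 1, and a part of width [wd n.+2], whose tiles are reflected children of tiles of
    delay 0 and opposite sign. *)
Lemma window_parent n c : window n.+1 c ->
  exists2 t, window n t & c \in children t.
Proof.
case: c => [[y e] [|[|[|j]]]] //= w.
- have h1 : height n (mulb (sg e, 0%BZ, 0%BZ)) = (sg e * wd n.+3)%BZ.
    by rewrite -heightS /=; lia.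
  have wle := wdS n.
  case: (boolP (window n (mulb y, e, 1%N))) => [w1|w1].
    by exists (mulb y, e, 1%N) => //=; rewrite mulbK inE.
  exists (mulb (add3 y (sg e, 0%BZ, 0%BZ)), ~~ e, 0%N) => /=; last first.
    rewrite mulbK !inE; apply/orP; right; apply/eqP.
    congr (_, _, _); last by rewrite negbK.
    by case: y {w w1 h1} => [[a b] c] /=; congr (_, _, _); case: e => /=; lia.
  rewrite -heightS heightD heightS [height n.+1 _]heightS h1.
  move: w w1; rewrite /= addn0 !addn2 -heightS.
  by case: e {h1} => /=; lia.
- exists (mulb y, e, 2) => /=; last by rewrite mulbK inE.
  by rewrite -heightS addn1; move: w; rewrite addn0.
- exists (mulb y, e, 0%N) => /=; last by rewrite mulbK !inE eqxx.
  by rewrite -heightS addn2; move: w; rewrite addn1.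
Qed.

Lemma children_uniq t : uniq (children t).
Proof. by case: t => [[y e] [|j]] //=; rewrite inE !xpair_eqE andbF. Qed.

(** The two parts of the window are disjoint, so the parent can be written as a function of the
    child: the test for a parent of delay 1 decides between the two candidates. *)
Lemma children_inj n t u c : window n t -> window n u ->
  c \in children t -> c \in children u -> t = u.
Proof.
move=> wt wu ct cu.
suff parent v : window n v -> c \in children v -> v =
    let: (y, e, j) := c in if j is 0 then
      if window n (mulb y, e, 1%N) then (mulb y, e, 1%N)
      else (mulb (add3 y (sg e, 0%BZ, 0%BZ)), ~~ e, 0%N)
    else (mulb y, e, (j.+1 %% 3)%N).
  by rewrite (parent _ wt ct) (parent _ wu cu).
case: v => [[y e] [|[|[|j]]]] //= wv; rewrite !inE.
- case/orP => /eqP ->; first by rewrite divbK.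
  have h1 : height n (mulb (sg e, 0%BZ, 0%BZ)) = (sg e * wd n.+3)%BZ.
    by rewrite -heightS /=; lia.
  have -> : mulb (add3 (add3 (divb y) (sg e, 0%BZ, 0%BZ)) (sg (~~ e), 0%BZ, 0%BZ))
    = y.
    rewrite -[RHS]divbK; congr mulb; case: (divb y) => [[a b] c'] /=.
    by congr (_, _, _); case: e {wv h1} => /=; lia.
  rewrite negbK -heightS heightD [height n.+1 (divb y)]heightS divbK.
  rewrite [height n.+1 _]heightS h1.
  move: wv; rewrite addn0 addn2; have := wdS n.
  by case: e {h1} => /= w3 w; case: ifP => //; lia.
- by move=> /eqP -> /=; rewrite divbK wv.
- by move=> /eqP -> /=; rewrite divbK.
Qed.

(* [normsq d] is the triple (A, B, C) with |emb b d|^2 = A + B beta + C beta^2. *)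
Definition normsq (d : Z3) : Z3 :=
  let: (x, y, z) := d in
  ((x * x - z * z + x * y + x * z - y * z)%BZ,
   (z * z - y * y - x * y - y * z)%BZ, (y * y - x * z + y * z)%BZ).

Definition beta_lo : Z := 14655712.
Definition beta_hi : Z := 14655713.
Definition beta_den : Z := 10000000.

(* Three times the centre b / (1 + b) of a disc containing F. *)
Definition centre3 : Z3 := (1, 2, -1)%BZ.

(* Certifies that the discs of two tiles in relative position nd are disjoint. *)
Definition far (nd : node) : bool :=
  let: (j, s, j', d) := nd in
  let: (A, B, C) := normsq (sub3 (add3 (scale3 3 d)
    (scale3 (sg s) (iter j' mulb centre3))) (iter j mulb centre3)) in
  (50 * beta_den * beta_den <? A * beta_den * beta_den
    + B * beta_den * (if 0 <=? B then beta_lo else beta_hi)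
    + C * (if 0 <=? C then beta_lo * beta_lo else beta_hi * beta_hi))%BZ.

(** Meeting tiles have meeting children, so a position all of whose lines of descent reach a far
    position cannot be one of meeting tiles. *)
Fixpoint dead (fuel : nat) (nd : node) : bool :=
  if far nd then true
  else if fuel is fuel'.+1 then all (dead fuel') (node_children nd) else false.

Definition z3 (x y z : Z) : Z3 := (x, y, z).

(* The boundary graph: the relative positions of intersecting tiles met when
   subdividing the tiling, with coefficients (in powers of x = 1 / mu) of an
   eigenvector of the adjacency matrix for the eigenvalue mu. *)
Definition boundary_graph : seq (node * seq nat) :=
 [::
  ((0, false, 0, z3 0 1 0), [:: 1; 0; 0; 1]);
  ((0, false, 0, z3 0 2 (-1)), [:: 0; 1; 0; 0; 1]);
  ((0, false, 0, z3 1 0 0), [:: 0; 0; 0; 0; 0; 0; 1; 0; 2; 1]);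
  ((0, false, 0, z3 1 1 (-1)), [:: 0; 0; 0; 1; 0; 2; 1]);
  ((0, false, 0, z3 1 2 (-1)), [:: 0; 0; 1; 0; 0; 1]);
  ((0, false, 1, z3 (-1) 1 0), [:: 0; 0; 0; 1]);
  ((0, false, 2, z3 0 1 0), [:: 0; 1]);
  ((0, true, 0, z3 0 (-1) 1), [:: 0; 0; 1]);
  ((0, true, 0, z3 0 1 (-1)), [:: 0; 0; 1]);
  ((0, true, 1, z3 0 0 0), [:: 1]);
  ((0, true, 2, z3 0 0 0), [:: 0; 0; 1]);
  ((0, true, 2, z3 0 2 (-1)), [:: 0; 0; 0; 0; 1]);
  ((1, false, 0, z3 (-1) 1 0), [:: 0; 0; 0; 1]);
  ((1, false, 1, z3 (-1) 1 0), [:: 0; 0; 0; 0; 1; 0; 2; 1]);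
  ((1, true, 0, z3 0 0 0), [:: 1]);
  ((1, true, 2, z3 0 0 0), [:: 0; 1]);
  ((2, false, 0, z3 0 1 0), [:: 0; 1]);
  ((2, false, 2, z3 0 (-1) 1), [:: 0; 0; 0; 0; 0; 1; 0; 2; 1]);
  ((2, true, 0, z3 0 (-2) 1), [:: 0; 0; 0; 0; 1]);
  ((2, true, 0, z3 0 0 0), [:: 0; 0; 1]);
  ((2, true, 1, z3 0 0 0), [:: 0; 1])].

Definition boundary_nodes : seq node := unzip1 boundary_graph.

(** * Finite checks on the boundary graph *)

Definition node_poly (nd : node) : seq nat :=
  nth [::] (unzip2 boundary_graph) (index nd boundary_nodes).

(** A subdivision either stays in the graph or gives disjoint tiles; twelve further subdivisions are
    enough for every certificate. *)
Lemma boundary_nodes_closed nd c : nd \in boundary_nodes ->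
  c \in node_children nd -> c \notin boundary_nodes -> dead 12 c.
Proof.
move=> ndS cnd cS.
have : all (fun nd => all (fun c => if c \in boundary_nodes then true else dead 12 c)
  (node_children nd)) boundary_nodes by vm_cast_no_check (erefl true).
by move=> /allP/(_ _ ndS)/allP/(_ _ cnd); rewrite (negbTE cS).
Qed.

Definition zrange (k : nat) : seq Z :=
  [seq (Z.of_nat i - Z.of_nat k)%BZ | i <- iota 0 (k + k).+1].

Lemma mem_zrange (k : nat) (x : Z) :
  (- Z.of_nat k <= x)%BZ -> (x <= Z.of_nat k)%BZ -> x \in zrange k.
Proof.
move=> x1 x2; apply/mapP; exists (Z.to_nat (x + Z.of_nat k)); last by lia.
by rewrite mem_iota; lia.
Qed.

(* nd is the relative position of two distinct tiles of the tiling. *)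
Lemma initial_nodes (s : bool) (d1 d2 : Z) :
  let nd := (0%N, s, 0%N, ((if s then 0 else 1) - d1 - d2, d1, d2)%BZ) in
  d1 \in (zrange 14) -> d2 \in (zrange 14) ->
  s && (d1 == 0%BZ) && (d2 == 0%BZ) = false ->
  nd \notin boundary_nodes -> dead 12 nd.
Proof.
move=> nd i1 i2 nz nS.
have sb : s \in [:: true; false] by case: (s).
have : all (fun s : bool => all (fun d1 => all (fun d2 =>
    let nd := (0%N, s, 0%N, ((if s then 0 else 1) - d1 - d2, d1, d2)%BZ) in
    if s && (d1 == 0%BZ) && (d2 == 0%BZ) then true
    else if nd \in boundary_nodes then true else dead 12 nd)
  (zrange 14)) (zrange 14)) [:: true; false].
  by vm_cast_no_check (erefl true).
move=> /allP/(_ _ sb)/allP/(_ _ i1)/allP/(_ _ i2); rewrite nz; cbv zeta.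
by rewrite -/nd (negbTE nS).
Qed.

Fixpoint poly_add (p q : seq nat) : seq nat :=
  match p, q with
  | [::], _ => q
  | _, [::] => p
  | a :: p', b :: q' => (a + b)%N :: poly_add p' q'
  end.

(** The leading 0 multiplies by x = 1 / mu: the eigenvector equation is tested in the form w = x *
    (sum of w over the children). *)
Definition node_step (nd : node) : seq nat := 0%N ::
  foldr poly_add [::]
    [seq node_poly c | c <- node_children nd & c \in boundary_nodes].

(** The polynomial x^3 + x^7 + 2 x^9 + x^10, which is 1 at x = 1 / mu: the equation of mu divided by
    mu^10. *)
Definition mu_rel : seq nat := [:: 0; 0; 0; 1; 0; 0; 0; 1; 0; 2; 1]%N.

(** The eigenvector equation holds as an identity of polynomials, or after a single use of [mu_rel]
    = 1; adding to both sides avoids negative coefficients. *)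
Lemma node_poly_step nd : nd \in boundary_nodes ->
  node_step nd = node_poly nd \/
  poly_add (node_step nd) [:: 1%N] = poly_add (node_poly nd) mu_rel.
Proof.
move=> ndS.
have : all (fun nd => (node_step nd == node_poly nd) ||
    (poly_add (node_step nd) [:: 1%N] == poly_add (node_poly nd) mu_rel))
  boundary_nodes by vm_cast_no_check (erefl true).
by move=> /allP/(_ _ ndS)/orP[]/eqP; [left|right].
Qed.

Lemma node_poly_pos nd : nd \in boundary_nodes -> has (leq 1) (node_poly nd).
Proof.
move=> ndS.
have : all (fun nd => has (leq 1) (node_poly nd)) boundary_nodes.
  by vm_cast_no_check (erefl true).
by move=> /allP/(_ _ ndS).
Qed.

Lemma boundary_nodes_delay nd : nd \in boundary_nodes ->
  (nd.1.1.1 <= 2)%N && (nd.1.2 <= 2)%N.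
Proof.
move=> ndS.
have : all (fun nd : node => (nd.1.1.1 <= 2)%N && (nd.1.2 <= 2)%N) boundary_nodes.
  by vm_cast_no_check (erefl true).
by move=> /allP/(_ _ ndS).
Qed.

(** Every node thus starts an infinite path, which will force the corresponding tiles to meet. *)
Lemma boundary_nodes_progress nd : nd \in boundary_nodes ->
  has (mem boundary_nodes) (node_children nd).
Proof.
move=> ndS.
have : all (fun nd => has (mem boundary_nodes) (node_children nd)) boundary_nodes.
  by vm_cast_no_check (erefl true).
by move=> /allP/(_ _ ndS).
Qed.

(** * The number beta and its conjugate b *)

Section constants.
Context {R : realType} (beta : R) (b : R[i]).
Hypothesis beta3 : beta ^+ 3 = beta ^+ 2 + 1.
Hypothesis b3 : b ^+ 3 = b ^+ 2 + 1.
Hypothesis b_nonreal : complex.Im b != 0.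

Lemma beta_gt1 : 1 < beta.
Proof using beta3.
rewrite ltNge; apply/negP => b1.
have : beta ^+ 2 * (beta - 1) = 1 by ring: beta3.
have : beta ^+ 2 * (beta - 1) <= 0 by rewrite mulr_ge0_le0 ?sqr_ge0// subr_le0.
by move=> h e; rewrite e ler10 in h.
Qed.

(** With X = [beta_den] * beta the equation reads X^2 (X - [beta_den]) = [beta_den]^3, whose left
    side increases beyond [beta_den]; both bounds are then tested on integers. *)
Lemma beta_bounds :
  (zr beta_lo < zr beta_den * beta) && (zr beta_den * beta < zr beta_hi).
Proof using beta3.
have b1 := beta_gt1; have den0 : 0 < zr beta_den :> R by rewrite -zr0 ltr_zr.
set X := zr beta_den * beta.
have eX : X ^+ 2 * (X - zr beta_den) = zr (beta_den * beta_den * beta_den)%BZ.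
  by rewrite !zrM /X; move: (zr beta_den) => d; ring: beta3.
have X1 : zr beta_den < X by rewrite /X ltr_pMr.
have X0 : 0 < X := lt_trans den0 X1.
have mono (k : Z) : 0 < zr k :> R ->
    (zr k <= X -> (k * k * (k - beta_den) <=? beta_den * beta_den * beta_den)%BZ)
    /\ (X <= zr k -> (beta_den * beta_den * beta_den <=? k * k * (k - beta_den))%BZ).
  move=> k0; split=> kX; rewrite -(@ler_zr R) -eX !zrM zrB -expr2.
    have [kd|kd] := leP (zr k) (zr beta_den : R).
      apply: (@le_trans _ _ 0).
        by rewrite mulr_ge0_le0 ?sqr_ge0// subr_le0.
      by apply: mulr_ge0; rewrite ?sqr_ge0 ?subr_ge0 ?(ltW X1).
    apply: ler_pM; rewrite ?sqr_ge0 ?subr_ge0 ?(ltW kd) ?lerD2r//.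
    by rewrite ler_pXn2r ?nnegrE ?(ltW k0) ?(ltW X0).
  apply: ler_pM; rewrite ?sqr_ge0 ?subr_ge0 ?(ltW X1) ?lerD2r//.
  by rewrite ler_pXn2r ?nnegrE ?(ltW k0) ?(ltW X0).
apply/andP; split; rewrite ltNge; apply/negP.
  by have [_ h] := mono beta_lo (ltac:(by rewrite -zr0 ltr_zr)) => /h; vm_compute.
by have [h _] := mono beta_hi (ltac:(by rewrite -zr0 ltr_zr)) => /h; vm_compute.
Qed.

Lemma beta_approx : 1465 / 1000 < beta < 1466 / 1000.
Proof using beta3.
have b1 := beta_gt1.
have e : beta ^+ 2 * (beta - 1) = 1 by ring: beta3.
by apply/andP; split; rewrite ltNge; apply/negP => h; nra.
Qed.

(** Eliminating Im b shows that 1 - 2 Re b is a real root of the cubic, and beta is the only one.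
    This is the relation that the roots have sum 1. *)
Lemma b_coords : complex.Re b = (1 - beta) / 2 /\
  complex.Im b ^+ 2 = beta ^+ 2 - beta - ((1 - beta) / 2) ^+ 2.
Proof using beta3 b3 b_nonreal.
move: b3 b_nonreal; case: b => x v; rewrite !exprS expr0 => /eqP.
rewrite eq_complex /= => /andP[/eqP hr /eqP hi] v0.
have v2 : v ^+ 2 = 3 * x ^+ 2 - 2 * x.
  by apply: (mulfI v0); lra.
have v2x : x * v ^+ 2 = 3 * x ^+ 3 - 2 * x ^+ 2 by rewrite v2; ring.
have hx : (1 - 2 * x) ^+ 3 = (1 - 2 * x) ^+ 2 + 1 by lra.
have b1 := beta_gt1.
have : (1 - 2 * x - beta) * ((1 - 2 * x) ^+ 2 + (beta - 1) * (1 - 2 * x) + beta * (beta - 1)) = 0.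
  rewrite (_ : _ * _ = ((1 - 2 * x) ^+ 3 - (1 - 2 * x) ^+ 2) - (beta ^+ 3 - beta ^+ 2)).
    by rewrite hx beta3; ring.
  by ring.
move=> /eqP; rewrite mulf_eq0 => /orP[/eqP e|/eqP e]; last first.
  (* The completed square equals the discriminant (beta - 1)(-3 beta - 1) of the quadratic cofactor,
     which is negative. *)
  have : 0 <= (2 * (1 - 2 * x) + (beta - 1)) ^+ 2 by exact: sqr_ge0.
  have -> : (2 * (1 - 2 * x) + (beta - 1)) ^+ 2 = (beta - 1) * (- 3 * beta - 1).
    by lra.
  by move=> h; exfalso; nra.
have ex : x = (1 - beta) / 2 by lra.
by split=> /=; [lra|move: v2; rewrite ex; lra].
Qed.
End constants.

Lemma exprn_small {R : realType} (q e : R) : 0 <= q -> q < 1 -> 0 < e ->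
  exists n, q ^+ n < e.
Proof.
move=> q0 q1 e0; have /cvgrPdist_lt/(_ _ e0)[n _ nP] : GRing.exp q @ \oo --> 0.
  by apply: cvg_expr; rewrite ger0_norm.
exists n; have := nP n (leqnn n); rewrite sub0r normrN ger0_norm//.
by rewrite exprn_ge0.
Qed.

Section geometry.
Context {R : realType} (beta : R) (b : R[i]).
Hypothesis beta3 : beta ^+ 3 = beta ^+ 2 + 1.
Hypothesis b3 : b ^+ 3 = b ^+ 2 + 1.
Hypothesis b_nonreal : complex.Im b != 0.

Let nb : R := normc b.

(** The product of the three roots beta, b and the conjugate of b is 1. *)
Lemma normc_b2 : nb ^+ 2 * beta = 1.
Proof using beta3 b3 b_nonreal.
have [r i] := b_coords beta3 b3 b_nonreal.
rewrite /nb normc_sq i r; transitivity (beta ^+ 3 - beta ^+ 2); first by field.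
by rewrite beta3; ring.
Qed.

Lemma normc_b_bounds : 1 / 2 < nb < 827 / 1000.
Proof using beta3 b3 b_nonreal.
have /andP[h1 h2] := beta_approx beta3; have := normc_b2.
have : 0 <= nb := normc_ge0 b.
move=> n0 e.
have sq_le (p q : R) : 0 <= p -> 0 <= q -> p <= q -> p ^+ 2 * beta <= q ^+ 2 * beta.
  by move=> p0 q0 pq; rewrite ler_wpM2r ?lerXn2r//; lra.
apply/andP; split; rewrite ltNge; apply/negP => /sq_le; rewrite e.
  by move=> /(_ n0 (ltac:(lra))); lra.
by move=> /(_ (ltac:(lra)) n0); lra.
Qed.

Lemma zr_complex (k : Z) : zr k = Complex (zr k) 0 :> R[i].
Proof. by rewrite /zr -(rmorph_int (@real_complex R)). Qed.

Lemma complex_mulE (x y x' y' : R) : Complex x y * Complex x' y' =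
  Complex (x * x' - y * y') (x * y' + y * x') :> R[i].
Proof. by []. Qed.

Lemma complex_addE (x y x' y' : R) :
  Complex x y + Complex x' y' = Complex (x + x') (y + y') :> R[i].
Proof. by []. Qed.

Lemma emb_complex (u v : R) d : emb (Complex u v : R[i]) d =
  let: (x, y, z) := d in
  Complex (zr x + zr y * u + zr z * (u ^+ 2 - v ^+ 2))
          (zr y * v + zr z * (2 * u * v)).
Proof.
case: d => [[x y] z]; rewrite /emb !zr_complex expr2 !complex_mulE !complex_addE.
by congr Complex; ring.
Qed.

(** Both 2 Re b = 1 - beta and |b|^2 = beta^2 - beta lie in Z[beta], hence so does the squared
    modulus of any element of Z[b]. *)
Lemma emb_normsq d : let: (A, B, C) := normsq d in
  normc (emb b d) ^+ 2 = zr A + zr B * beta + zr C * beta ^+ 2.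
Proof using beta3 b3 b_nonreal.
have [r i] := b_coords beta3 b3 b_nonreal.
have eb : b = Complex ((1 - beta) / 2) (complex.Im b).
  by rewrite -r; case: (b).
rewrite eb; set v := complex.Im b; have {}i : v ^+ 2 = _ := i.
rewrite emb_complex normc_sq; case: d => [[x y] z]; rewrite /normsq /= !zrE.
have b4 : beta ^+ 4 = beta ^+ 2 + beta + 1 by ring: beta3.
set u := (1 - beta) / 2; rewrite -/u in i.
have -> : (zr x + zr y * u + zr z * (u ^+ 2 - v ^+ 2)) ^+ 2 +
   (zr y * v + zr z * (2 * u * v)) ^+ 2 =
  zr x ^+ 2 + zr y ^+ 2 * (u ^+ 2 + v ^+ 2) + zr z ^+ 2 * (u ^+ 2 + v ^+ 2) ^+ 2
  + 2 * zr x * zr y * u + 2 * zr x * zr z * (u ^+ 2 - v ^+ 2)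
  + 2 * zr y * zr z * u * (u ^+ 2 + v ^+ 2) by ring.
have -> : u ^+ 2 + v ^+ 2 = beta ^+ 2 - beta by rewrite i; ring.
have -> : (beta ^+ 2 - beta) ^+ 2 = beta - 1 by ring: beta3 b4.
have -> : u ^+ 2 - v ^+ 2 = (1 - beta ^+ 2) / 2 by rewrite i /u; field.
have -> : 2 * zr y * zr z * u * (beta ^+ 2 - beta)
  = zr y * zr z * (2 * u * (beta ^+ 2 - beta)) by ring.
have -> : 2 * u = 1 - beta by rewrite /u; field.
have -> : (1 - beta) * (beta ^+ 2 - beta) = beta ^+ 2 - beta - 1 by ring: beta3.
by rewrite /u; field.
Qed.

Definition disc_centre : R[i] := emb b centre3 / 3.
End geometry.

Lemma quadratic_lower {K : realFieldType} (x : K) (lo hi den k A B C : Z) :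
  0 < zr lo :> K -> 0 < zr den :> K ->
  zr lo < zr den * x -> zr den * x < zr hi ->
  (k * den * den <? A * den * den + B * den * (if 0 <=? B then lo else hi)
    + C * (if 0 <=? C then lo * lo else hi * hi))%BZ ->
  zr k < zr A + zr B * x + zr C * x ^+ 2.
Proof.
move=> lo0 den0 lox hix; rewrite -(@ltr_zr K) !zrD !zrM => lt.
have x0 : 0 < zr den * x := lt_trans lo0 lox.
have hi0 := lt_trans x0 hix.
have hB : zr B * zr den * zr (if (0 <=? B)%BZ then lo else hi) <=
    zr B * zr den * (zr den * x).
  case: ifP => B0.
    apply: ler_wpM2l (ltW lox); apply: mulr_ge0 (ltW den0).
    by rewrite -(@zr0 K) ler_zr.
  apply: ler_wnM2l (ltW hix); apply: mulr_le0_ge0 (ltW den0).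
  by rewrite -(@zr0 K) ler_zr; lia.
have hC : zr C * zr (if (0 <=? C)%BZ then lo * lo else hi * hi)%BZ <=
    zr C * (zr den * x) ^+ 2.
  case: ifP => C0; rewrite zrM -expr2.
    apply: ler_wpM2l; first by rewrite -(@zr0 K) ler_zr.
    by apply: lerXn2r; rewrite ?nnegrE ?(ltW lo0) ?(ltW x0) ?(ltW lox).
  apply: ler_wnM2l; first by rewrite -(@zr0 K) ler_zr; lia.
  by apply: lerXn2r; rewrite ?nnegrE ?(ltW hi0) ?(ltW x0) ?(ltW hix).
rewrite -(ltr_pM2r (mulr_gt0 den0 den0)).
by move: (zr A) (zr B) (zr C) (zr k) (zr den) lt hB hC => *; lra.
Qed.

Section tiles.
Context {R : realType} (beta : R) (b : R[i]) (F : set R[i]).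
Hypothesis beta3 : beta ^+ 3 = beta ^+ 2 + 1.
Hypothesis b3 : b ^+ 3 = b ^+ 2 + 1.
Hypothesis b_nonreal : complex.Im b != 0.
Hypothesis F_compact : compact F.
Hypothesis F_eq : forall z, F z <->
  (exists2 x, F x & z = b ^+ 3 * x) \/ (exists2 x, F x & z = b * (1 - x)).

Let nb : R := normc b.
Let c := disc_centre b.
Let nbP := normc_b_bounds beta3 b3 b_nonreal.

Lemma nb_ge0 : 0 <= nb. Proof using. exact: normc_ge0. Qed.
Lemma nb_lt1 : nb < 1.
Proof using beta3 b3 b_nonreal. by move/andP: nbP => [_]; rewrite -/nb; lra. Qed.
Lemma nb_gt0 : 0 < nb.
Proof using beta3 b3 b_nonreal. by move/andP: nbP => [+ _]; rewrite -/nb; lra. Qed.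

Lemma expnb_le1 j : nb ^+ j <= 1.
Proof using beta3 b3 b_nonreal. by rewrite exprn_ile1 ?nb_ge0// ltW// nb_lt1. Qed.

Lemma b_neq0 : b != 0.
Proof using beta3 b3 b_nonreal.
by rewrite -normc_eq0 -/nb gt_eqF// nb_gt0.
Qed.

Lemma three_neq0 : (3 : R[i]) != 0. Proof using. by rewrite pnatr_eq0. Qed.

Lemma centre3E : emb b centre3 = 1 + 2 * b - b ^+ 2.
Proof using. by rewrite /= (zrN 1) zr1 (zr_nat 2); ring. Qed.

(** The centre is the fixed point b / (1 + b) of the right map. Since 1 + b has norm 3, three times
    the centre lies in Z[b]. *)
Lemma centre_fix : b * (1 - c) = c.
Proof using b3.
rewrite /c /disc_centre centre3E; apply: (mulIf three_neq0).
rewrite -mulrA mulrBl divfK ?three_neq0//.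
by ring: b3.
Qed.

(** Multiplication by b^3 moves the centre by b^3 c - c = c b^2 and shrinks radii by |b|^3. The
    inequality says that the disc of radius 47/40 about c is mapped into itself. *)
Lemma normc_centre_b2 : normc (c * b ^+ 2) <= 47 / 40 * (1 - nb ^+ 3).
Proof using beta3 b3 b_nonreal.
have : normc (emb b centre3) ^+ 2 = 3 - 3 * beta + 3 * beta ^+ 2.
  have -> := emb_normsq beta3 b3 b_nonreal centre3.
  by rewrite -(zr_nat 3) -mulNr -zrN.
have nb2 := normc_b2 beta3 b3 b_nonreal; rewrite -/nb in nb2.
have /andP[be1 be2] := beta_approx beta3.
have /andP[n1 n2] := nbP; rewrite -/nb in n1 n2.
rewrite normcM normcX -/nb /c /disc_centre normcM normcV.
have -> : normc (3 : R[i]) = 3.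
  by rewrite -[3 in LHS](zr_nat 3) zr_complex /= expr0n addr0 sqrtr_sqr (zr_nat 3) normr_nat.
set P := normc _ => P2; have P0 : 0 <= P := normc_ge0 _.
have P1 : P <= 281 / 125.
  rewrite leNgt; apply/negP => h; have : (281 / 125) ^+ 2 <= P ^+ 2.
    by rewrite lerXn2r ?nnegrE ?ltW//; lra.
  by rewrite P2; nra.
have n2' : nb ^+ 2 <= 200 / 293.
  rewrite leNgt; apply/negP => h.
  have : 200 / 293 * beta < nb ^+ 2 * beta by rewrite ltr_pM2r//; lra.
  by rewrite nb2; lra.
have n3 : nb ^+ 3 <= 827 / 1000 * (200 / 293).
  by rewrite exprS; apply: ler_pM; [exact: nb_ge0|exact: sqr_ge0|exact: ltW|].
apply: (@le_trans _ _ (281 / 125 / 3 * (200 / 293))); last by lra.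
by apply: ler_pM; rewrite ?sqr_ge0 ?divr_ge0// ler_pM2r ?invr_gt0.
Qed.

(** Both maps send the disc into itself, and if F exceeds it by at most K then F exceeds it by at
    most |b| K. Iterating from any bound of F removes the excess. *)
Lemma F_disc x : F x -> normc (x - c) <= 47 / 40.
Proof using beta3 b3 b_nonreal F_compact F_eq.
have [M M0 FM] := compact_normc_bounded F_compact.
have step K y : 0 <= K -> (forall x, F x -> normc (x - c) <= 47 / 40 + K) ->
    F y -> normc (y - c) <= 47 / 40 + nb * K.
  move=> K0 FK /F_eq[[z Fz ->]|[z Fz ->]].
    have -> : b ^+ 3 * z - c = b ^+ 3 * (z - c) + c * b ^+ 2.
      by rewrite b3; ring.
    apply: le_trans (ler_normcD _ _) _; rewrite normcM normcX -/nb.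
    have h := normc_centre_b2.
    have : nb ^+ 3 * normc (z - c) <= nb ^+ 3 * (47 / 40 + K).
      by rewrite ler_wpM2l ?exprn_ge0 ?nb_ge0 ?FK.
    have : nb ^+ 3 * K <= nb * K.
      by rewrite ler_wpM2r// exprS ler_piMr ?nb_ge0 ?expnb_le1.
    by lra.
  have -> : b * (1 - z) - c = - (b * (z - c)).
    by rewrite -{1}centre_fix; ring.
  rewrite (normcN (_ : Rcomplex R)) normcM -/nb.
  apply: (@le_trans _ _ (nb * (47 / 40 + K))).
    by rewrite ler_wpM2l ?nb_ge0 ?FK.
  have := nb_lt1; lra.
have iter n y : F y -> normc (y - c) <= 47 / 40 + nb ^+ n * (M + normc c).
  elim: n y => [|n ih] y Fy.
    rewrite expr0 mul1r; apply: le_trans (ler_normcD _ _) _.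
    rewrite (normcN (c : Rcomplex R)); have := FM _ Fy; lra.
  rewrite exprS -mulrA; apply: step => //.
  apply: mulr_ge0; first by rewrite exprn_ge0 ?nb_ge0.
  by rewrite addr_ge0 ?normc_ge0// ltW.
move=> Fx; rewrite leNgt; apply/negP => lt.
have Mc : 0 < M + normc c by rewrite ltr_pwDl ?normc_ge0.
have [n] := @exprn_small _ nb ((normc (x - c) - 47 / 40) / (M + normc c))
  nb_ge0 nb_lt1 (ltac:(by rewrite divr_gt0 ?subr_gt0)).
by rewrite ltr_pdivlMr//; have := iter n x Fx; lra.
Qed.

Lemma normc_sg e : normc (zr (sg e) : R[i]) = 1.
Proof using.
by case: e; rewrite /sg ?(zrN 1) zr1 ?(normcN (1 : Rcomplex R)) normc1.
Qed.

Definition sem (t : tile) : set R[i] := let: (y, e, j) := t in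
  [set z | exists2 x, F x & z = emb b y + zr (sg e) * b ^+ j * x].

Lemma sem_children t z : sem t z <->
  exists2 d, d \in children t & exists2 w, sem d w & z = b * w.
Proof using b3 F_eq.
case: t => [[y e] [|j]].
  rewrite [sem _]/=; split=> [[x /F_eq[[w Fw ->]|[w Fw ->]] ->]|[d]].
  - exists (divb y, e, 2)%N; first by rewrite inE eqxx.
    eexists; first by exists w.
    by rewrite -(emb_divb b3 y) /=; ring.
  - exists (add3 (divb y) (sg e, 0%BZ, 0%BZ), ~~ e, 0%N); first by rewrite !inE eqxx orbT.
    eexists; first by exists w.
    by rewrite emb_add -(emb_divb b3 y) /= zr0; case: e; rewrite /= ?(zrN 1) zr1; ring.
  rewrite !inE => /orP[]/eqP -> [w] [x Fx ->] ->.
    exists (b ^+ 3 * x); first by apply/F_eq; left; exists x.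
    by rewrite -(emb_divb b3 y) /=; ring.
  exists (b * (1 - x)); first by apply/F_eq; right; exists x.
  by rewrite emb_add -(emb_divb b3 y) /= zr0; case: e; rewrite /= ?(zrN 1) zr1; ring.
rewrite [children _]/=; split=> [[x Fx ->]|[d]].
  exists (divb y, e, j); first by rewrite inE eqxx.
  eexists; first by exists x.
  by rewrite -(emb_divb b3 y) exprS; ring.
rewrite inE => /eqP -> [w] [x Fx ->] ->; exists x => //.
by rewrite -(emb_divb b3 y) exprS; ring.
Qed.

Lemma sem_level n t z : sem t z <->
  exists2 d, d \in level children n [:: t] & exists2 w, sem d w & z = b ^+ n * w.
Proof using b3 F_eq.
elim: n z => [|n ih] z.
  split=> [tz|[d]]; first by exists t; [rewrite inE|exists z; rewrite ?expr0 ?mul1r].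
  by rewrite inE => /eqP -> [w tw ->]; rewrite expr0 mul1r.
split=> [/ih[d dn [w /sem_children[d' d'd [w' dw' ->]] ->]]|[d dn [w dw ->]]].
  exists d'; last by exists w' => //; rewrite exprSr mulrA.
  by apply/(@mem_levelD _ _ 1); exists d => //=; rewrite cats0.
have /(@mem_levelD _ _ 1)[d' d'n] := dn.
rewrite /= cats0 => dd'; apply/ih; exists d' => //.
exists (b * w); last by rewrite exprSr mulrA.
by apply/sem_children; exists d => //; exists w.
Qed.

Definition meet (t u : tile) : Prop := exists2 z, sem t z & sem u z.

Definition meet_node (nd : node) : Prop :=
  let: (j, s, j', d) := nd in meet ((0, 0, 0)%BZ, true, j) (d, s, j').

Lemma meet_rel t u : meet t u <-> meet_node (rel_pos (t, u)).
Proof using.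
case: t u => [[y e] j] [[y' e'] j'] /=.
have sgK (a : bool) : zr (sg a) * zr (sg a) = 1 :> R[i].
  by case: a; rewrite /= ?(zrN 1) zr1; ring.
have sgM : zr (sg (e == e')) = zr (sg e) * zr (sg e') :> R[i].
  by case: e e' => -[]; rewrite /= ?(zrN 1) zr1; ring.
set s := (zr (sg e) : R[i]); set s' := (zr (sg e') : R[i]); have ss : s * s = 1 := sgK e.
split=> -[z [x Fx zx] [x' Fx' zx']].
  have key : b ^+ j * x = s * (emb b y' + s' * b ^+ j' * x' - emb b y).
    rewrite -[LHS]mul1r -ss -mulrA; congr (_ * _).
    by rewrite -zx' zx -/s; ring.
  exists (b ^+ j * x); first by exists x => //=; rewrite !zr0 zr1; ring.
  exists x' => //; rewrite emb_scale emb_sub sgM key -/s -/s'; ring.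
exists (emb b y + s * z); first by exists x => //; rewrite zx /= !zr0 zr1; ring.
exists x' => //; rewrite zx' emb_scale emb_sub sgM -/s -/s'.
have -> : emb b y + s * (s * (emb b y' - emb b y) + s * s' * b ^+ j' * x') =
  emb b y + s * s * (emb b y' - emb b y) + s * s * (s' * b ^+ j' * x') by ring.
by rewrite ss; ring.
Qed.

Lemma meet_children t u : meet t u ->
  exists2 p, p \in pairs t u & meet p.1 p.2.
Proof using b3 b_nonreal beta3 F_eq.
move=> [z /sem_children[d dt [w dw zw]] /sem_children[d' du [w' dw' zw']]].
exists (d, d'); first by apply/allpairsP; exists (d, d').
exists w => //=; rewrite (_ : w = w')//.
by apply: (mulfI b_neq0); rewrite -zw -zw'.
Qed.

Lemma sem_disc y e j z : sem (y, e, j) z ->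
  normc (z - (emb b y + zr (sg e) * b ^+ j * c)) <= 47 / 40.
Proof using beta3 b3 b_nonreal F_compact F_eq.
move=> [x Fx ->].
rewrite (_ : _ - _ = zr (sg e) * b ^+ j * (x - c)); last by ring.
rewrite !normcM normcX -/nb.
rewrite normc_sg mul1r; apply: le_trans (F_disc Fx).
by rewrite ler_piMl ?normc_ge0 ?expnb_le1.
Qed.

(** Meeting tiles have disc centres at distance at most 2 * 47/40. In tripled coordinates the square
    of this bound is 49.7025, just below the 50 of [far]. *)
Lemma far_disjoint nd : far nd -> ~ meet_node nd.
Proof using beta3 b3 b_nonreal F_compact F_eq.
case: nd => [[[j s] j'] d] /= far_nd [z /sem_disc zc /sem_disc zc'].
move: far_nd; set D := sub3 _ _.
have nD : normc (emb b D) <= 3 * (47 / 40 + 47 / 40).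
  have -> : emb b D = 3 * ((z - (emb b (0, 0, 0)%BZ + zr (sg true) * b ^+ j * c))
      - (z - (emb b d + zr (sg s) * b ^+ j' * c))).
    rewrite /D emb_sub emb_add !emb_scale !emb_iter_mulb// (zr_nat 3).
    rewrite -[emb b centre3](divfK three_neq0) -/(disc_centre b) -/c.
    by rewrite /= !zr0 zr1; ring.
  rewrite normcM.
  have -> : normc (3 : R[i]) = 3.
    by rewrite -[3 in LHS](zr_nat 3) zr_complex /= expr0n addr0 sqrtr_sqr (zr_nat 3) normr_nat.
  rewrite ler_pM2l//; apply: le_trans (ler_normcD _ _) _.
  by rewrite (normcN (_ : Rcomplex R)) lerD.
have := emb_normsq beta3 b3 b_nonreal D.
case: (normsq D) => [[A B] C] eD.
have /andP[lo hi] := beta_bounds beta3.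
have lo0 : 0 < zr beta_lo :> R by rewrite -zr0 ltr_zr.
have den0 : 0 < zr beta_den :> R by rewrite -zr0 ltr_zr.
move=> /(quadratic_lower lo0 den0 lo hi); rewrite -eD (zr_nat 50) ltNge.
move=> {lo hi lo0 den0} /negP; apply; apply: (@le_trans _ _ ((3 * (47 / 40 + 47 / 40)) ^+ 2)).
  by rewrite lerXn2r ?nnegrE ?normc_ge0//; lra.
by lra.
Qed.

Lemma dead_disjoint n nd : dead n nd -> ~ meet_node nd.
Proof using beta3 b3 b_nonreal F_compact F_eq.
elim: n nd => [|n ih] nd /=; case: ifP => [/far_disjoint//|_] // /allP dch.
case: nd dch => [[[j s] j'] d] dch /meet_children[[t u] tu /meet_rel mtu].
by apply: ih mtu; apply: dch; apply: map_f.
Qed.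

Lemma boundary_node_child t u p : rel_pos (t, u) \in boundary_nodes ->
  p \in pairs t u -> meet p.1 p.2 -> rel_pos p \in boundary_nodes.
Proof using beta3 b3 b_nonreal F_compact F_eq.
case: p => t' u' tuS ptu /meet_rel mp; apply: contraT => npS; exfalso.
apply: dead_disjoint mp; apply: boundary_nodes_closed tuS _ npS.
by rewrite -rel_pos_pairs map_f.
Qed.
End tiles.

(** * Covering and local finiteness *)

Lemma zr_intK {K : pzRingType} (m : int) : zr (Z_of_int m) = m%:~R :> K.
Proof. by rewrite /zr Z_of_intK. Qed.

Lemma height_iter n k y : height n (iter k mulb y) = height (n + k) y.
Proof.
by elim: k n => [|k ih] n /=; rewrite ?addn0// -heightS ih addSnnS.
Qed.

Lemma zr_bound {K : realDomainType} (k : nat) (x : Z) :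
  `|zr x : K| <= k%:R -> x \in zrange k.
Proof.
rewrite -(zr_nat k) ler_norml -zrN !ler_zr => /andP[h1 h2].
by apply: mem_zrange; lia.
Qed.

Lemma wd_unbounded (M : Z) : exists k, (M < wd k)%BZ.
Proof.
have h k : (Z.of_nat k <= wd k.+4)%BZ.
  elim: k => [|k ih]; first exact: wd_ge0.
  by rewrite wdS; have w2 : wd 2 = 1%BZ by []; have := @wd_le 2 k.+2 isT; lia.
exists (Z.to_nat M).+1.+4; have := h (Z.to_nat M).+1; lia.
Qed.

Section covering.
Context {R : realType} (beta : R) (b : R[i]) (F : set R[i]).
Hypothesis beta3 : beta ^+ 3 = beta ^+ 2 + 1.
Hypothesis b3 : b ^+ 3 = b ^+ 2 + 1.
Hypothesis b_nonreal : complex.Im b != 0.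
Hypothesis F_compact : compact F.
Hypothesis F_nonempty : F !=set0.
Hypothesis F_eq : forall z, F z <->
  (exists2 x, F x & z = b ^+ 3 * x) \/ (exists2 x, F x & z = b * (1 - x)).

Let nb : R := normc b.
Let nb0 : 0 <= nb := nb_ge0 b.
Let nb1 : nb < 1 := nb_lt1 beta3 b3 b_nonreal.
Notation sem := (sem b F).

Lemma sem_compact t : compact (sem t).
Proof using F_compact beta3 b3 b_nonreal.
case: t => [[y e] j].
have -> : sem (y, e, j) = (fun x => emb b y + zr (sg e) * b ^+ j * x) @` F.
  by apply/seteqP; split=> z /= [x Fx]; [move=> ->|move=> <-]; exists x.
apply: continuous_compact => //; apply: continuous_subspaceT => x.
move=> A /nbhs_normcP[r r0 rA]; apply/nbhs_normcP; exists r => // w wx.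
apply: rA; rewrite (_ : _ - _ = zr (sg e) * b ^+ j * (w - x)); last by ring.
rewrite !normcM normcX normc_sg mul1r; apply: le_lt_trans wx.
by rewrite ler_piMl ?normc_ge0// (expnb_le1 beta3 b3 b_nonreal).
Qed.

Lemma window_union n t w : window n t -> sem t w ->
  exists2 t0, window 0 t0 & sem t0 (b ^+ n * w).
Proof using b3 F_eq.
elim: n t w => [|n ih] t w; first by exists t; rewrite ?expr0 ?mul1r.
move=> /window_parent[u un tu] tw; rewrite exprSr -mulrA.
by apply: ih un _; apply/(sem_children b3 F_eq); exists t => //; exists w.
Qed.

(** Greedy expansion of N in the numeration system with base sequence [wd]: b^i has height
    [wd (n + i).+2], each i < k is used at most once, and the sum of the chosen b^i is bounded by a
    geometric series. *)
Lemma digits n k N : (0 <= N)%BZ -> (N < wd (n + k).+2)%BZ ->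
  exists e, [/\ (0 <= N - height n e)%BZ, (N - height n e < wd n.+2)%BZ
    & normc (emb b e) <= (1 - nb ^+ k) / (1 - nb)].
Proof using beta3 b3 b_nonreal.
elim: k N => [|k ih] N N0.
  rewrite addn0 => Nn; exists (0, 0, 0)%BZ.
  have -> : height n (0, 0, 0)%BZ = 0%BZ by rewrite /=; lia.
  rewrite Z.sub_0_r; split=> //=.
  by rewrite !zr0 expr0 subrr !mul0r !addr0 normc0.
have nbk : nb ^+ k <= 1 := expnb_le1 beta3 b3 b_nonreal k.
have den : 0 < 1 - nb by rewrite subr_gt0.
have step : (1 - nb ^+ k.+1) / (1 - nb) = (1 - nb ^+ k) / (1 - nb) + nb ^+ k.
  by rewrite exprS; move: (nb ^+ k) => q; field; exact: lt0r_neq0.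
rewrite addnS wdS => Nk.
have [lt|ge] := Z_lt_le_dec N (wd (n + k).+2).
  have [e [e1 e2 e3]] := ih N N0 lt; exists e; split => //.
  by rewrite step; apply: le_trans e3 _; rewrite lerDl exprn_ge0.
have le : (wd (n + k) <= wd (n + k).+2)%BZ by apply: wd_le; lia.
have [e [e1 e2 e3]] := ih (N - wd (n + k).+2)%BZ (ltac:(lia)) (ltac:(lia)).
have hk : height n (iter k mulb (1, 0, 0)%BZ) = wd (n + k).+2.
  by rewrite height_iter /=; lia.
exists (add3 e (iter k mulb (1, 0, 0)%BZ)); split.
- by rewrite heightD hk; lia.
- by rewrite heightD hk; lia.
rewrite emb_add (emb_iter_mulb b3) step; apply: le_trans (ler_normcD _ _) _.
apply: lerD => //; rewrite normcM normcX -/nb.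
by rewrite /= zr1 !zr0 !mul0r !addr0 normc1 mulr1.
Qed.

Lemma digits_bound n k N : (0 <= N)%BZ -> (N < wd (n + k).+2)%BZ ->
  exists e, [/\ (0 <= N - height n e)%BZ, (N - height n e < wd n.+2)%BZ
    & normc (emb b e) <= (1 - nb)^-1].
Proof using beta3 b3 b_nonreal.
move=> N0 /(digits N0)[e [e1 e2 e3]]; exists e; split => //.
apply: le_trans e3 _; rewrite ler_piMl ?invr_ge0 ?subr_ge0 ?ltW//.
by rewrite ltrBlDr ltrDl exprn_gt0 ?(nb_gt0 beta3 b3 b_nonreal).
Qed.

Lemma lattice_approx z : exists y, normc (z - emb b y) <= 2.
Proof using beta3 b3 b_nonreal.
pose q : R := complex.Im z / complex.Im b.
pose y1 := Num.floor q.
pose p : R := complex.Re (z - q%:C%C * b).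
pose y0 := Num.floor p.
exists (Z_of_int y0, Z_of_int y1, 0%BZ).
rewrite /= !zr_intK zr0 mul0r addr0.
have frac (x : R) : 0 <= x - (Num.floor x)%:~R <= 1.
  rewrite subr_ge0 floor_le/=; have := floorD1_gt x; rewrite intrD.
  by move=> /ltW; rewrite lerBlDl.
have intC (m : int) : m%:~R = (m%:~R : R)%:C%C :> R[i].
  by rewrite (rmorph_int (@real_complex R)).
have ez : z - q%:C%C * b = p%:C%C.
  apply/eqP; rewrite eq_complex /= eqxx /=; apply/eqP.
  rewrite /q; case: (z) b_nonreal => x y; case: (b) => u v /= v0.
  by rewrite mul0r addr0 divfK ?subrr.
have -> : z - (y0%:~R + y1%:~R * b) =
    (p - y0%:~R)%:C%C + (q - y1%:~R)%:C%C * b.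
  by rewrite !rmorphB /= -ez !intC; ring.
apply: le_trans (ler_normcD _ _) _; rewrite normcM -/nb.
have nC (x : R) : 0 <= x -> normc (x%:C%C : R[i]) = x.
  by move=> x0; rewrite /= expr0n addr0 sqrtr_sqr ger0_norm.
have /andP[p0 p1] := frac p; have /andP[q0 q1] := frac q.
rewrite !nC// (_ : 2 = 1 + 1)//; apply: lerD => //.
by rewrite mulr_ile1// ltW.
Qed.

(** A point of Z[b] near z is moved into the window by a greedy expansion of minus its height. If
    the height is positive, a large power of b is subtracted beforehand, a displacement of modulus
    at most 1. *)
Lemma window_dense n z : exists y,
  window n (y, true, 0%N) /\ normc (z - emb b y) <= 3 + (1 - nb)^-1.
Proof using beta3 b3 b_nonreal.
have [y yz] := lattice_approx z.
suff [e e1 e2] : exists2 e, window n (add3 y e, true, 0%N) &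
    normc (emb b e) <= 1 + (1 - nb)^-1.
  exists (add3 y e); split=> //; rewrite emb_add opprD addrA.
  apply: le_trans (ler_normcD _ _) _; rewrite (normcN (_ : Rcomplex R)); lra.
have i0 : 0 <= (1 - nb)^-1 by rewrite invr_ge0 subr_ge0 ltW.
have [hy|hy] := Z_lt_le_dec 0 (height n y).
  have [k kP] := wd_unbounded (height n y).
  have kP' : (height n y <= wd (n + k).+2)%BZ.
    by have := @wd_le k (n + k).+2 (ltac:(lia)); lia.
  pose f := iter k mulb (1, 0, 0)%BZ.
  have hf : height n f = wd (n + k).+2 by rewrite /f height_iter /=; lia.
  have [e [e1 e2 e3]] := @digits_bound n k (wd (n + k).+2 - height n y)
    (ltac:(lia)) (ltac:(lia)).
  exists (add3 (scale3 (-1) f) e).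
    rewrite /window /= addn2 !heightD height_scale hf; lia.
  rewrite emb_add emb_scale (zrN 1) zr1 mulN1r.
  apply: le_trans (ler_normcD _ _) _; rewrite (normcN (_ : Rcomplex R)).
  apply: lerD => //; rewrite (emb_iter_mulb b3) normcM normcX -/nb.
  rewrite /= zr1 !zr0 !mul0r !addr0 normc1 mulr1.
  exact: expnb_le1 beta3 b3 b_nonreal k.
have [k kP] := wd_unbounded (- height n y).
have kP' := @wd_le k (n + k).+2 (ltac:(lia)).
have [e [e1 e2 e3]] := @digits_bound n k (- height n y)
    (ltac:(lia)) (ltac:(lia)).
exists e; last by apply: le_trans e3 _; lra.
by rewrite /window /= addn2 heightD; lia.
Qed.

Lemma tiles_dense z (r : R) : 0 < r ->
  exists t x, [/\ window 0 t, sem t x & normc (x - z) < r].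
Proof using beta3 b3 b_nonreal F_eq F_compact F_nonempty.
move=> r0; have [x0 Fx0] := F_nonempty.
pose C := 3 + (1 - nb)^-1 + normc x0.
have C0 : 0 < C.
  by rewrite /C addrAC ltr_wpDr ?invr_ge0 ?subr_ge0 ?ltW// ltr_wpDr ?normc_ge0.
(* The bound C does not depend on the level, so multiplication by b^n makes the error smaller than
   r. *)
have [n] := exprn_small nb0 nb1 (divr_gt0 r0 C0); rewrite ltr_pdivlMr// => nr.
have bn0 : b ^+ n != 0 by rewrite expf_neq0// (b_neq0 beta3 b3 b_nonreal).
have [y [wy yz]] := window_dense n (z / b ^+ n).
have sx : sem (y, true, 0%N) (emb b y + x0).
  by exists x0 => //; rewrite /= zr1; ring.
have [t wt tx] := window_union wy sx.
exists t, (b ^+ n * (emb b y + x0)); split => //; apply: le_lt_trans nr.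
have -> : b ^+ n * (emb b y + x0) - z =
    b ^+ n * (x0 - (z / b ^+ n - emb b y)) by field.
rewrite normcM normcX -/nb ler_wpM2l ?exprn_ge0//.
apply: le_trans (ler_normcD _ _) _; rewrite (normcN (_ : Rcomplex R)) /C; lra.
Qed.
End covering.

(** * Local finiteness of the tiling *)

Lemma height0 y0 y1 y2 : height 0 (y0, y1, y2) = (y0 + y1 + y2)%BZ.
Proof.
rewrite /height; have e2 : wd 2 = 1%BZ by []; have e3 : wd 3 = 1%BZ by [].
by have e4 : wd 4 = 1%BZ by []; rewrite e2 e3 e4; lia.
Qed.

Lemma window0 t : window 0 t ->
  exists y1 y2 e, t = ((if e then 0 else 1) - y1 - y2, y1, y2, e, 0%N)%BZ.
Proof.
case: t => [[[[y0 y1] y2] e] [|[|[|j]]]]; rewrite /window height0 //.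
- rewrite (_ : wd _ = 1%BZ)// => h; exists y1, y2, e; congr (_, _, _, _, _).
  by case: e h; lia.
- by rewrite (_ : wd _ = 0%BZ)//; case: e; lia.
- by rewrite (_ : wd _ = 0%BZ)//; case: e; lia.
Qed.

Definition initial_tiles (k : nat) : seq tile :=
  [seq ((if e then 0 else 1) - y.1 - y.2, y.1, y.2, e, 0%N)%BZ |
     y <- [seq (y1, y2) | y1 <- zrange k, y2 <- zrange k], e <- [:: true; false]].

Lemma mem_initial_tiles k y1 y2 e : y1 \in zrange k -> y2 \in zrange k ->
  ((if e then 0 else 1) - y1 - y2, y1, y2, e, 0%N)%BZ \in initial_tiles k.
Proof.
move=> h1 h2; apply/allpairsP; exists ((y1, y2), e); split => //.
  by apply/allpairsP; exists (y1, y2).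
by case: e.
Qed.

Section local_finiteness.
Context {R : realType} (beta : R) (b : R[i]) (F : set R[i]).
Hypothesis beta3 : beta ^+ 3 = beta ^+ 2 + 1.
Hypothesis b3 : b ^+ 3 = b ^+ 2 + 1.
Hypothesis b_nonreal : complex.Im b != 0.
Hypothesis F_compact : compact F.
Hypothesis F_nonempty : F !=set0.
Hypothesis F_eq : forall z, F z <->
  (exists2 x, F x & z = b ^+ 3 * x) \/ (exists2 x, F x & z = b * (1 - x)).

Let nb : R := normc b.
Let c := disc_centre b.
Notation sem := (sem b F).
Notation meet := (meet b F).

(** On the lattice, with z = y2 and w = y1 + y2, the squared modulus is beta^2 w^2 + beta z^2 - w z,
    at least (9/10)^2 (w^2 + z^2). The bound doubles because y1 = w - z. *)
Lemma lattice_coords (y1 y2 : Z) (k : nat) :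
  normc (emb b (- y1 - y2, y1, y2)%BZ) <= (9 / 10) * k%:R ->
  y1 \in zrange (k + k) /\ y2 \in zrange (k + k).
Proof using beta3 b3 b_nonreal.
have := emb_normsq beta3 b3 b_nonreal (- y1 - y2, y1, y2)%BZ.
set N := normc _; have N0 : 0 <= N := normc_ge0 _; move: N0; move: N => N N0 eN NC.
have /andP[be1 be2] := beta_approx beta3.
pose z : R := zr y2; pose w : R := zr y1 + zr y2.
have qN : N ^+ 2 = beta ^+ 2 * w ^+ 2 + beta * z ^+ 2 - w * z.
  by rewrite eN /= !zrE /w /z; ring.
have C2 : N ^+ 2 <= (9 / 10 * k%:R) ^+ 2 by rewrite lerXn2r ?nnegrE//; nra.
have sq : (9 / 10) ^+ 2 * (w ^+ 2 + z ^+ 2) <= N ^+ 2.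
  have w0 : 0 <= w ^+ 2 := sqr_ge0 _; have z0 : 0 <= z ^+ 2 := sqr_ge0 _.
  have wz : 0 <= (w - z) ^+ 2 := sqr_ge0 _.
  have b2 : 2 <= beta ^+ 2 by nra.
  have : 2 * w ^+ 2 <= beta ^+ 2 * w ^+ 2 by rewrite ler_wpM2r.
  have : 146 / 100 * z ^+ 2 <= beta * z ^+ 2 by rewrite ler_wpM2r//; lra.
  by rewrite qN; lra.
have k0 : 0 <= (k%:R : R) by [].
have small (x : R) : x ^+ 2 <= w ^+ 2 + z ^+ 2 -> `|x| <= k%:R.
  move=> xw; rewrite -(@ler_pXn2r _ 2)// ?nnegrE// real_normK ?num_real//.
  by rewrite exprMn in C2; lra.
have zk : `|z| <= k%:R by apply: small; rewrite lerDr sqr_ge0.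
have wk : `|w| <= k%:R by apply: small; rewrite lerDl sqr_ge0.
split; apply: (@zr_bound R); rewrite natrD.
  have -> : zr y1 = w - z by rewrite /w /z addrK.
  by apply: le_trans (ler_normB _ _) _; rewrite lerD.
by apply: (le_trans zk); rewrite lerDl.
Qed.

Lemma normc_centre : normc c <= 1.
Proof using beta3 b3 b_nonreal.
have h := normc_centre_b2 beta3 b3 b_nonreal.
have /andP[n1 n2] := normc_b_bounds beta3 b3 b_nonreal; rewrite -/nb in n1 n2.
have b2 := normc_b2 beta3 b3 b_nonreal; rewrite -/nb in b2 h.
have /andP[be1 be2] := beta_approx beta3.
have q2 : 68 / 100 <= nb ^+ 2.
  rewrite leNgt; apply/negP => lt.
  have : nb ^+ 2 * beta < 68 / 100 * beta by rewrite ltr_pM2r//; lra.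
  by rewrite b2; lra.
have q3 : 68 / 100 * (82 / 100) <= nb ^+ 3.
  have q1 : 82 / 100 <= nb by rewrite leNgt; apply/negP => lt; nra.
  by rewrite exprSr; apply: ler_pM => //; lra.
move: h; rewrite normcM normcX -/nb -/c => h; rewrite leNgt; apply/negP => c1.
have : 1 * nb ^+ 2 < normc c * nb ^+ 2 by rewrite ltr_pM2r//; lra.
by lra.
Qed.

Lemma anchor_near y e j x : sem (y, e, j) x ->
  normc (emb b y) <= normc x + 47 / 40 + 1.
Proof using beta3 b3 b_nonreal F_compact F_eq.
move=> /(sem_disc beta3 b3 b_nonreal F_compact F_eq); rewrite -/c => h.
have -> : emb b y = x + - (x - (emb b y + zr (sg e) * b ^+ j * c))
  + - (zr (sg e) * b ^+ j * c) by ring.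
have tri (u v : R[i]) : normc (u + - v) <= normc u + normc v.
  by apply: le_trans (ler_normcD _ _) _; rewrite (normcN (_ : Rcomplex R)).
apply: le_trans (tri _ _) _; apply: lerD.
  by apply: le_trans (tri _ _) _; rewrite lerD.
rewrite (normcM _ c) (normcM (zr (sg e))) normc_sg mul1r normcX.
apply: mulr_ile1; [exact: exprn_ge0 (normc_ge0 b)|exact: normc_ge0| |].
  exact: expnb_le1 beta3 b3 b_nonreal j.
exact: normc_centre.
Qed.

(** The 4 covers 47/40 + 1 from [anchor_near] and the 1 by which the anchor of a tile of sign -
    differs from a lattice point. *)
Lemma anchor_coords (M : R) (k : nat) y1 y2 e x :
  sem ((if e then 0 else 1) - y1 - y2, y1, y2, e, 0%N)%BZ x ->
  normc x <= M -> M + 4 <= (9 / 10) * k%:R ->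
  y1 \in zrange (k + k) /\ y2 \in zrange (k + k).
Proof using beta3 b3 b_nonreal F_compact F_eq.
move=> /anchor_near h xM Mk; apply: lattice_coords; apply: le_trans Mk.
have -> : (- y1 - y2, y1, y2)%BZ = add3 ((if e then 0 else 1) - y1 - y2, y1, y2)%BZ
    (scale3 (-1) (if e then 0 else 1, 0, 0))%BZ.
  by rewrite /=; congr (_, _, _); case: (e); lia.
rewrite emb_add; apply: le_trans (ler_normcD _ _) _.
have : normc (emb b (scale3 (-1) (if e then 0 else 1, 0, 0)%BZ)) <= 1.
  rewrite emb_scale normcM (normc_sg false) mul1r.
  by case: (e); rewrite /= ?zr1 !zr0 !mul0r !addr0 ?normc0 ?normc1.
by lra.
Qed.

Lemma initial_tiles_near (M : R) : exists k, forall t x,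
  window 0 t -> sem t x -> normc x <= M -> t \in initial_tiles k.
Proof using beta3 b3 b_nonreal F_compact F_eq.
pose k := (Num.truncn (2 * (`|M| + 4))).+1.
exists (k + k)%N => _ x /window0[y1 [y2 [e ->]]] tx xM.
have [h1 h2] : y1 \in zrange (k + k) /\ y2 \in zrange (k + k).
  apply: anchor_coords tx xM _; have := truncnS_gt (2 * (`|M| + 4)); rewrite -/k.
  have := ler_norm M; have := normr_ge0 M; lra.
exact: mem_initial_tiles.
Qed.

Lemma initial_meet t u : window 0 t -> window 0 u -> t != u -> meet t u ->
  rel_pos (t, u) \in boundary_nodes.
Proof using beta3 b3 b_nonreal F_compact F_eq.
move=> /window0[y1 [y2 [e ->]]] /window0[y1' [y2' [e' ->]]] tu mtu.
set d1 := (sg e * (y1' - y1))%BZ; set d2 := (sg e * (y2' - y2))%BZ.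
have rE : rel_pos (((if e then 0 else 1) - y1 - y2, y1, y2, e, 0%N)%BZ,
    ((if e' then 0 else 1) - y1' - y2', y1', y2', e', 0%N)%BZ) =
  (0%N, e == e', 0%N, ((if e == e' then 0 else 1) - d1 - d2, d1, d2)%BZ).
  rewrite /= /d1 /d2; congr (_, _, _, _); congr (_, _, _);
  by case: (e) (e') => -[] /=; lia.
have := mtu => /(meet_rel b F); rewrite rE => -[x x1 x2].
have xM : normc x <= 47 / 40 + 1.
  have := sem_disc beta3 b3 b_nonreal F_compact F_eq x1; rewrite -/c.
  rewrite expr0 /= zr1 !zr0 !mul0r !addr0 add0r !mul1r => h.
  have := ler_normcD (x - c) c; rewrite subrK; have := normc_centre; lra.
have [h1 h2] : d1 \in zrange 14 /\ d2 \in zrange 14.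
  (* The choice 7 works because 47/40 + 1 + 4 <= 9/10 * 7; it yields the range 14 = 7 + 7 of
     [initial_nodes]. *)
  by apply: (@anchor_coords (47 / 40 + 1) 7 d1 d2 (e == e') x) => //; lra.
apply: contraT => nS; exfalso; apply: (dead_disjoint beta3 b3 b_nonreal F_compact F_eq)
  (initial_nodes h1 h2 _ nS) _; last by exists x.
apply/negbTE; apply: contra tu => /andP[/andP[/eqP ee /eqP d10] /eqP d20].
move: d10 d20; rewrite /d1 /d2 -ee => d10 d20.
have -> : y1' = y1 by case: (e) d10 => /=; lia.
have -> : y2' = y2 by case: (e) d20 => /=; lia.
by [].
Qed.
End local_finiteness.

(** * From density to covering *)

Section covering2.
Context {R : realType} (beta : R) (b : R[i]) (F : set R[i]).
Hypothesis beta3 : beta ^+ 3 = beta ^+ 2 + 1.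
Hypothesis b3 : b ^+ 3 = b ^+ 2 + 1.
Hypothesis b_nonreal : complex.Im b != 0.
Hypothesis F_compact : compact F.
Hypothesis F_nonempty : F !=set0.
Hypothesis F_eq : forall z, F z <->
  (exists2 x, F x & z = b ^+ 3 * x) \/ (exists2 x, F x & z = b * (1 - x)).
Notation sem := (sem b F).

(** Only finitely many tiles come within distance 1 of z, and each of them that misses z stays at a
    positive distance. The predicate [P] later excludes one tile. *)
Lemma tiles_closed_union (P : tile -> Prop) z :
  (forall r : R, 0 < r ->
    exists t x, [/\ P t, window 0 t, sem t x & normc (x - z) < r]) ->
  exists t, [/\ P t, window 0 t & sem t z].
Proof using beta3 b3 b_nonreal F_compact F_eq.
move=> zP; apply: contrapT => nz.
have [k kP] := initial_tiles_near beta3 b3 b_nonreal F_compact F_eq (normc z + 1).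
suff [r r0 rP] : exists2 r : R, 0 < r & forall t x, t \in initial_tiles k ->
    P t -> window 0 t -> sem t x -> r <= normc (x - z).
  have [|t [x [Pt wt tx]]] := zP (Num.min r 1); first by rewrite lt_min r0 ltr01.
  rewrite lt_min => /andP[xr x1].
  have tk : t \in initial_tiles k.
    by apply: kP wt tx _; have := ler_normcD (x - z) z; rewrite subrK; lra.
  by have := rP t x tk Pt wt tx; rewrite leNgt xr.
elim: (initial_tiles k) => [|t l [r r0 rl]]; first by exists 1.
have [s s0 st] : exists2 s : R, 0 < s &
    forall x, P t -> window 0 t -> sem t x -> s <= normc (x - z).
  have [[Pt wt]|h] := pselect (P t /\ window 0 t); last first.
    by exists 1 => // x Pt wt; case: h.
  have cl : closed (sem t).
    by apply: compact_closedc; exact: (@sem_compact R beta b F beta3 b3 b_nonreal F_compact t).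
  have [s s0 sP] := closed_far cl (fun tz => nz (ex_intro _ t (And3 Pt wt tz))).
  by exists s => // x _ _; exact: sP.
exists (Num.min r s) => [|u x]; first by rewrite lt_min r0.
rewrite inE ge_min => /predU1P[->|ul] Pu wu ux; first by rewrite st ?orbT.
by rewrite (rl u x).
Qed.

Lemma tiles_cover z : exists2 t, window 0 t & sem t z.
Proof using beta3 b3 b_nonreal F_compact F_eq F_nonempty.
have [t [_ wt tz]] := @tiles_closed_union (fun=> True) z
  (fun r r0 => let: ex_intro t (ex_intro x (And3 wt tx xz)) :=
    tiles_dense beta3 b3 b_nonreal F_compact F_nonempty F_eq z r0 in
    ex_intro _ t (ex_intro _ x (And4 I wt tx xz))).
by exists t.
Qed.
End covering2.

(** * Descendants of a boundary pair and their weights *)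

Definition boundary_pairs (p : tile * tile) : seq (tile * tile) :=
  [seq q <- pairs p.1 p.2 | rel_pos q \in boundary_nodes].

Lemma boundary_pairs_uniq p : uniq (boundary_pairs p).
Proof.
apply/filter_uniq/allpairs_uniq => [||[? ?] [? ?] //]; exact: children_uniq.
Qed.

Lemma boundary_pairs_children p q : q \in boundary_pairs p ->
  [/\ q.1 \in children p.1, q.2 \in children p.2 & rel_pos q \in boundary_nodes].
Proof. by rewrite mem_filter => /andP[qS /allpairsP[[c d] [/= cp dp qE]]]; subst q. Qed.

Lemma boundary_level_uniq n p : window 0 p.1 -> window 0 p.2 ->
  uniq (level boundary_pairs n [:: p]).
Proof.
move=> w1 w2; apply: (@level_uniq _ _
  (fun n q => window n q.1 && window n q.2)) => //.
- move=> {}n x y /andP[x1 x2] /boundary_pairs_children[y1 y2 _].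
  by apply/andP; split; [exact: window_children x1 y1|exact: window_children x2 y2].
- exact: boundary_pairs_uniq.
- move=> {}n [t u] [t' u'] y /= /andP[wt wu] /andP[wt' wu'].
  move=> /boundary_pairs_children[/= y1 y2 _] /boundary_pairs_children[/= y1' y2' _].
  by rewrite (children_inj wt wt' y1 y1') (children_inj wu wu' y2 y2').
- by move=> x; rewrite inE => /eqP ->; rewrite w1 w2.
Qed.

Lemma boundary_level_tiles n p q : q \in level boundary_pairs n [:: p] ->
  q.1 \in level children n [:: p.1] /\ q.2 \in level children n [:: p.2].
Proof.
move: q; apply: (@level_ind _ _ (fun n q =>
    q.1 \in level children n [:: p.1] /\ q.2 \in level children n [:: p.2]) n 0).
  move=> {}n x y [x1 x2] /boundary_pairs_children[y1 y2 _].
  by split; apply/(@mem_levelD _ _ 1); [exists x.1|exists x.2] => //=; rewrite cats0.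
by move=> x; rewrite inE => /eqP ->; rewrite !inE.
Qed.

Lemma boundary_level_nodes n p q : rel_pos p \in boundary_nodes ->
  q \in level boundary_pairs n [:: p] -> rel_pos q \in boundary_nodes.
Proof.
move=> pS; move: q.
apply: (@level_ind _ _ (fun _ q => rel_pos q \in boundary_nodes) n 0).
  by move=> {}n x y _ /boundary_pairs_children[].
by move=> x; rewrite inE => /eqP ->.
Qed.

Lemma boundary_level_nonempty n p : rel_pos p \in boundary_nodes ->
  exists q, q \in level boundary_pairs n [:: p].
Proof.
move=> pS; elim: n => [|n [q qn]]; first by exists p; rewrite inE.
have /boundary_nodes_progress := boundary_level_nodes pS qn.
case: q qn => t u qn; rewrite -rel_pos_pairs has_map => /hasP[r rp rS].
exists r; apply/(@mem_levelD _ _ 1); exists (t, u) => //=.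
rewrite cats0 mem_filter rp andbT; exact: rS.
Qed.

Definition peval {K : pzRingType} (x : K) (p : seq nat) : K :=
  foldr (fun a v => a%:R + x * v) 0 p.

Lemma peval_add {K : comPzRingType} (x : K) p q :
  peval x (poly_add p q) = peval x p + peval x q.
Proof.
elim: p q => [|a p ih] [|a' q] /=; rewrite ?add0r ?addr0//.
by rewrite ih natrD; ring.
Qed.

Section weights.
Context {R : realType} (mu : R).
Hypothesis mu0 : 0 < mu.
Hypothesis mu10 : mu ^+ 10 = mu ^+ 7 + mu ^+ 3 + 2 * mu + 1.

Definition weight (p : tile * tile) : R := peval mu^-1 (node_poly (rel_pos p)).

Lemma peval_mu_rel : peval mu^-1 mu_rel = 1.
Proof using mu0 mu10.
have m0 : mu != 0 by rewrite gt_eqF.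
pose x := mu^-1; have mx : mu * x = 1 by rewrite mulfV.
have mxn k : mu ^+ k * x ^+ k = 1 by rewrite -exprMn mx expr1n.
transitivity (x ^+ 3 + x ^+ 7 + 2 * x ^+ 9 + x ^+ 10).
  by rewrite /peval /= -/x; ring.
have e k l : x ^+ k = mu ^+ l * x ^+ (k + l).
  by rewrite addnC exprD mulrA mxn mul1r.
rewrite (e 3 7) (e 7 3) (e 9 1) -[RHS](mxn 10%N) mu10.
by rewrite !addnE /= expr1; move: (x ^+ 10) => y; ring.
Qed.

Lemma weight_boundary_pairs p : rel_pos p \in boundary_nodes ->
  \sum_(q <- boundary_pairs p) weight q = mu * weight p.
Proof using mu0 mu10.
move=> pS; have m0 : mu != 0 by rewrite gt_eqF.
have step : peval mu^-1 (node_step (rel_pos p)) =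
    mu^-1 * \sum_(q <- boundary_pairs p) weight q.
  rewrite /node_step /= add0r; congr (_ * _).
  case: p {pS} => t u; rewrite -rel_pos_pairs big_filter.
  elim: (pairs t u) => [|q l ih]; first by rewrite big_nil.
  rewrite big_cons /=; case: ifP => qS /=; last by rewrite -ih.
  by rewrite peval_add ih.
suff e : peval mu^-1 (node_step (rel_pos p)) = weight p.
  by rewrite -e step mulVKf.
have [->//|] := node_poly_step pS.
move=> /(congr1 (peval mu^-1)); rewrite !peval_add peval_mu_rel /= mulr0 addr0.
by move/addIr.
Qed.

Lemma peval_ge0 x p : 0 <= x -> 0 <= peval x p :> R.
Proof using. by move=> x0; elim: p => //= a p ih; rewrite addr_ge0// mulr_ge0. Qed.

Lemma weight_gt0 p : rel_pos p \in boundary_nodes -> 0 < weight p.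
Proof using mu0.
move=> /node_poly_pos; rewrite /weight; have x0 : 0 < mu^-1 by rewrite invr_gt0.
elim: (node_poly _) => //= a l ih /orP[a0|/ih l0].
  by rewrite ltr_pwDl ?ltr0n// mulr_ge0 ?peval_ge0 ?ltW.
by rewrite ltr_wpDl// mulr_gt0.
Qed.

Lemma positive_bounds {T : eqType} (f : T -> R) (l : seq T) :
  exists m M : R, 0 < m /\
    forall x, x \in l -> 0 < f x -> m <= f x <= M.
Proof using.
elim: l => [|y l [m [M [m0 mM]]]]; first by exists 1, 1.
have [y0|y0] := ltP 0 (f y); last first.
  exists m, M; split=> // x; rewrite inE => /predU1P[->|/mM//].
  by rewrite ltNge y0.
exists (Num.min m (f y)), (Num.max M (f y)); split=> [|x]; first by rewrite lt_min m0.
rewrite inE ge_min le_max => /predU1P[-> _|xl /(mM _ xl)/andP[-> ->]//].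
by rewrite !lexx !orbT.
Qed.

Lemma weight_bounds : exists wmin wmax : R, 0 < wmin /\
  forall p, rel_pos p \in boundary_nodes -> wmin <= weight p <= wmax.
Proof using mu0.
have [m [M [m0 mM]]] :=
  positive_bounds (fun nd => peval mu^-1 (node_poly nd)) boundary_nodes.
by exists m, M; split=> // p pS; apply: (mM (rel_pos p)) => //; exact: weight_gt0.
Qed.

Lemma boundary_level_weight n p : rel_pos p \in boundary_nodes ->
  \sum_(q <- level boundary_pairs n [:: p]) weight q = mu ^+ n * weight p.
Proof using mu0 mu10.
move=> pS; rewrite (@level_weight _ _ _ [pred q | rel_pos q \in boundary_nodes] weight mu).
- by rewrite big_seq1.
- by move=> x y _ /boundary_pairs_children[].
- exact: weight_boundary_pairs.
- by rewrite /= pS.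
Qed.

(** The total weight of level n is mu^n times the weight of p, and all weights lie between two
    positive constants. *)
Lemma boundary_level_size : exists2 C : R, 0 < C & forall n p,
  rel_pos p \in boundary_nodes ->
  (size (level boundary_pairs n [:: p]))%:R <= C * mu ^+ n.
Proof using mu0 mu10.
have [m [M [m0 mM]]] := weight_bounds.
exists (`|M| / m + 1); first by rewrite ltr_wpDl// divr_ge0// ltW.
move=> n p pS; have mn0 : 0 < mu ^+ n by rewrite exprn_gt0.
apply: (@le_trans _ _ (`|M| / m * mu ^+ n)); last by rewrite ler_pM2r// lerDl.
rewrite mulrAC ler_pdivlMr//.
apply: (@le_trans _ _ (\sum_(q <- level boundary_pairs n [:: p]) weight q)).
  rewrite -sum1_size natr_sum mulr_suml big_seq [leRHS]big_seq.
  apply: ler_sum => q qn; rewrite mul1r.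
  by have /andP[] := mM _ (boundary_level_nodes pS qn).
rewrite boundary_level_weight// mulrC ler_pM2r//.
by have /andP[_ h] := mM _ pS; apply: le_trans h (ler_norm _).
Qed.
End weights.

(** * Overlaps of tiles *)

Section boundary_levels.
Context {R : realType} (beta : R) (b : R[i]) (F : set R[i]).
Hypothesis beta3 : beta ^+ 3 = beta ^+ 2 + 1.
Hypothesis b3 : b ^+ 3 = b ^+ 2 + 1.
Hypothesis b_nonreal : complex.Im b != 0.
Hypothesis F_compact : compact F.
Hypothesis F_nonempty : F !=set0.
Hypothesis F_eq : forall z, F z <->
  (exists2 x, F x & z = b ^+ 3 * x) \/ (exists2 x, F x & z = b * (1 - x)).
Let nb : R := normc b.
Let nb0 : 0 <= nb := nb_ge0 b.
Let nb1 : nb < 1 := nb_lt1 beta3 b3 b_nonreal.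
Notation sem := (sem b F).
Notation meet := (meet b F).

Lemma boundary_level_meet n p t u : rel_pos p \in boundary_nodes ->
  t \in level children n [:: p.1] -> u \in level children n [:: p.2] ->
  meet t u -> (t, u) \in level boundary_pairs n [:: p].
Proof using beta3 b3 b_nonreal F_compact F_eq.
move=> pS; elim: n t u => [|n ih] t u.
  by rewrite !inE => /eqP -> /eqP -> _; case: p {pS}.
move=> /(@mem_levelD _ _ 1)[t1 t1n] + /(@mem_levelD _ _ 1)[u1 u1n].
rewrite /= !cats0 => tt1 uu1 mtu.
have qn : (t1, u1) \in level boundary_pairs n [:: p].
  apply: ih => //; case: mtu => z tz uz.
  by exists (b * z); apply/(sem_children b3 F_eq); [exists t|exists u] => //; exists z.
apply/(@mem_levelD _ _ 1); exists (t1, u1) => //=; rewrite cats0.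
have ptu : (t, u) \in pairs t1 u1 by apply/allpairsP; exists (t, u).
rewrite mem_filter ptu andbT.
exact: (boundary_node_child beta3 b3 b_nonreal F_compact F_eq)
  (boundary_level_nodes pS qn) ptu mtu.
Qed.

Lemma boundary_level_cover n p z : rel_pos p \in boundary_nodes ->
  sem p.1 z -> sem p.2 z ->
  exists2 q, q \in level boundary_pairs n [:: p] &
    exists w, [/\ sem q.1 w, sem q.2 w & z = b ^+ n * w].
Proof using beta3 b3 b_nonreal F_compact F_eq.
move=> pS /(sem_level b3 F_eq n)[t tn [w tw zw]].
move=> /(sem_level b3 F_eq n)[u un [w' uw' zw']].
have ww : w = w'.
  apply: (mulfI (expf_neq0 n (b_neq0 beta3 b3 b_nonreal))).
  by rewrite -zw -zw'.
rewrite -ww in uw'; exists (t, u); last by exists w.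
by apply: boundary_level_meet => //; exists w.
Qed.

Lemma boundary_nodes_bounded : exists2 K : R, 0 <= K &
  forall nd, nd \in boundary_nodes -> normc (emb b nd.2) <= K.
Proof using.
exists (\sum_(nd <- boundary_nodes) normc (emb b nd.2)).
  by apply: sumr_ge0 => nd _; exact: normc_ge0.
move: boundary_nodes => l nd ndl; rewrite (big_rem nd)//= lerDl.
by apply: sumr_ge0 => ? _; exact: normc_ge0.
Qed.

Lemma boundary_anchors_near : exists2 K : R, 0 <= K &
  forall p, rel_pos p \in boundary_nodes ->
  normc (emb b p.1.1.1 - emb b p.2.1.1) <= K.
Proof using.
have [K K0 KP] := boundary_nodes_bounded; exists K => // -[t u] /KP.
case: t u => [[y e] j] [[y' e'] j'] /=.
by rewrite emb_scale emb_sub normcM normc_sg mul1r normcB.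
Qed.

Lemma sem_anchor t x : sem t x -> normc (x - emb b t.1.1) <= 47 / 40 + 1.
Proof using beta3 b3 b_nonreal F_compact F_eq.
case: t => [[y e] j] tx.
case: tx => x0 Fx0 ->; rewrite addrAC subrr add0r /=.
rewrite (normcM _ x0) (normcM (zr (sg e))) normc_sg mul1r normcX.
have c1 := normc_centre beta3 b3 b_nonreal.
have h := F_disc beta3 b3 b_nonreal F_compact F_eq Fx0.
have := ler_normcD (x0 - disc_centre b) (disc_centre b); rewrite subrK => h'.
have : normc b ^+ j * normc x0 <= normc x0.
  by rewrite ler_piMl ?normc_ge0// (expnb_le1 beta3 b3 b_nonreal).
by lra.
Qed.

(** A path in the graph gives, for every n, subpieces of the two tiles at distance at most a
    constant times |b|^n, so the two compact sets meet. *)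
Lemma boundary_meet p : rel_pos p \in boundary_nodes -> meet p.1 p.2.
Proof using beta3 b3 b_nonreal F_compact F_eq F_nonempty.
move=> pS; have [K K0 KP] := boundary_anchors_near.
have cl : closed (sem p.2).
  by apply: compact_closedc; exact: (@sem_compact R beta b F beta3 b3 b_nonreal F_compact).
have co : compact (sem p.1).
  exact: (@sem_compact R beta b F beta3 b3 b_nonreal F_compact).
have [|z [z1 z2]] := compact_meet co cl; last by exists z.
move=> r r0; have C0 : 0 < K + 6 by lra.
have [n] := exprn_small nb0 nb1 (divr_gt0 r0 C0); rewrite ltr_pdivlMr// => nr.
have [q qn] := boundary_level_nonempty n pS.
have [q1 q2] := boundary_level_tiles qn.
have ne t : exists x, sem t x.
  have [x Fx] := F_nonempty; case: t => [[y e] j].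
  by exists (emb b y + zr (sg e) * b ^+ j * x); exists x.
have [x qx] := ne q.1; have [y qy] := ne q.2.
exists (b ^+ n * x), (b ^+ n * y); split.
- by apply/(sem_level b3 F_eq n); exists q.1 => //; exists x.
- by apply/(sem_level b3 F_eq n); exists q.2 => //; exists y.
rewrite -mulrBr normcM normcX -/nb; apply: le_lt_trans nr.
apply: ler_wpM2l; first exact: exprn_ge0.
have h1 := sem_anchor qx; have h2 := sem_anchor qy.
have h3 := KP _ (boundary_level_nodes pS qn).
have t1 := ler_distc_add (emb b q.1.1.1) x y.
have t2 := ler_distc_add (emb b q.2.1.1) (emb b q.1.1.1) y.
apply: (@le_trans _ _ ((47 / 40 + 1) + (K + (47 / 40 + 1)))); last by lra.
apply: le_trans t1 _; apply: lerD h1 _; apply: le_trans t2 _; apply: lerD h3 _.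
by rewrite normcB.
Qed.

(** The real and complex conjugates determine the three coordinates by a linear system with nonzero
    determinant, so bounds on the conjugates bound the coordinates. *)
Lemma box (C1 C2 : R) : exists k : nat, forall d,
  `|emb beta d| <= C1 -> normc (emb b d) <= C2 ->
  d \in [seq (xy, z) | xy <- [seq (x, y) | x <- zrange k, y <- zrange k], z <- zrange k].
Proof using beta3 b3 b_nonreal.
have [hr hi] := b_coords beta3 b3 b_nonreal.
pose u := (1 - beta) / 2; pose v := complex.Im b.
have eb : b = Complex u v by rewrite /u /v -hr; case: (b).
have v0 : v != 0 := b_nonreal.
(* D = |beta - b|^2 is the coefficient of the last coordinate once the other two are eliminated from
   the real conjugate and the two parts of the complex one. *)
pose D := (beta - u) ^+ 2 + v ^+ 2.
have D0 : 0 < D by rewrite ltr_wpDl ?sqr_ge0// exprn_even_gt0.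
pose Y2 := (C1 + C2 + C2 / `|v| * `|beta - u|) / D.
pose Y1 := C2 / `|v| + 2 * `|u| * Y2.
pose Y0 := C1 + Y1 * `|beta| + Y2 * beta ^+ 2.
pose k := (Num.truncn (Num.max Y0 (Num.max Y1 Y2))).+1.
exists k => -[[x y] z] h1 h2.
have vb : 0 < `|v| by rewrite normr_gt0.
have h3 := le_trans (Im_le_normc _) h2.
have h4 := le_trans (Re_le_normc _) h2.
rewrite eb emb_complex /= in h3 h4.
set X : R := zr x in h1 h3 h4; set Y : R := zr y in h1 h3 h4.
set Z : R := zr z in h1 h3 h4; rewrite /= -/X -/Y -/Z in h1.
have W : `|Y + 2 * u * Z| <= C2 / `|v|.
  by rewrite ler_pdivlMr// -normrM (_ : _ * v = Y * v + Z * (2 * u * v)); [|ring].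
have zD : `|Z| <= Y2.
  rewrite /Y2 ler_pdivlMr// -{1}(gtr0_norm D0) -normrM.
  have -> : Z * D = (X + Y * beta + Z * beta ^+ 2)
     - (X + Y * u + Z * (u ^+ 2 - v ^+ 2)) - (Y + 2 * u * Z) * (beta - u).
    by rewrite /D; ring.
  apply: le_trans (ler_normB _ _) _; apply: lerD.
    by apply: le_trans (ler_normB _ _) _; exact: lerD.
  by rewrite normrM ler_wpM2r.
have yD : `|Y| <= Y1.
  have -> : Y = (Y + 2 * u * Z) - 2 * u * Z by ring.
  apply: le_trans (ler_normB _ _) _; apply: lerD => //.
  by rewrite !normrM normr_nat ler_wpM2l// mulr_ge0.
have xD : `|X| <= Y0.
  have -> : X = (X + Y * beta + Z * beta ^+ 2) - Y * beta - Z * beta ^+ 2 by ring.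
  apply: le_trans (ler_normB _ _) _; apply: lerD.
    apply: le_trans (ler_normB _ _) _; apply: lerD => //.
    by rewrite normrM ler_wpM2r.
  by rewrite normrM normrX real_normK ?num_real// ler_wpM2r ?sqr_ge0.
have kP (s : R) : s <= Num.max Y0 (Num.max Y1 Y2) -> s <= k%:R.
  by move=> /le_trans; apply; apply: ltW; exact: truncnS_gt.
apply/allpairsP; exists ((x, y), z); split => //.
  apply/allpairsP; exists (x, y); split => //; apply: (@zr_bound R); apply: kP.
    by rewrite le_max xD.
  by rewrite !le_max yD orbT.
by apply: (@zr_bound R); apply: kP; rewrite !le_max zD !orbT.
Qed.
End boundary_levels.

(** * Number and real conjugates of subpieces *)

Section growth.
Context {R : realType} (beta : R).
Hypothesis beta3 : beta ^+ 3 = beta ^+ 2 + 1.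

(** The weight of delay j is beta^-j, the factor |b^j|^2 by which b^j scales areas; beta - 1 =
    beta^-2 by the cubic equation. *)
Let tile_weight (t : tile) : R := nth 0 [:: 1; beta^-1; beta - 1] t.2.

Lemma size_level_children n t : (t.2 < 3)%N ->
  2 / 5 * beta ^+ n <= (size (level children n [:: t]))%:R.
Proof using beta3.
move=> t3; have b1 := beta_gt1 beta3.
have b0 : beta != 0 by rewrite gt_eqF// (lt_trans ltr01).
have e1 : beta * (beta - 1) = beta^-1.
  by apply: (mulfI b0); rewrite mulfV//; ring: beta3.
have stable (x y : tile) : (x.2 < 3)%N -> y \in children x -> (y.2 < 3)%N.
  by case: x => [[y' e] [|[|[|j]]]] //= _;
    rewrite !inE; try case/orP; move=> /eqP ->.
have sum (x : tile) : (x.2 < 3)%N ->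
    \sum_(y <- children x) tile_weight y = beta * tile_weight x.
  case: x => [[y e] [|[|[|j]]]] //= _; rewrite !big_cons big_nil /tile_weight /=.
  - by rewrite addr0 subrK mulr1.
  - by rewrite addr0 mulfV.
  - by rewrite addr0 e1.
have e := @level_weight _ children _ [pred t : tile | t.2 < 3]%N tile_weight
  beta n [:: t] stable sum (ltac:(by rewrite /= t3)).
rewrite big_seq1 in e.
have /andP[be1 be2] := beta_approx beta3.
have i1 : 2 / 5 <= beta^-1.
  by rewrite -[beta^-1]mul1r ler_pdivlMr ?(lt_trans ltr01)//; lra.
have i2 : beta^-1 <= 1 by rewrite invf_le1 ?(lt_trans ltr01)// ltW.
have tw : 2 / 5 <= tile_weight t.
  by rewrite /tile_weight; case: t t3 e => [[y e'] [|[|[|j]]]] //= _ _; lra.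
have tw1 x : tile_weight x <= 1.
  by rewrite /tile_weight; case: x => [[y e'] [|[|[|j]]]] //=; rewrite ?nth_nil//; lra.
apply: (@le_trans _ _ (beta ^+ n * tile_weight t)).
  by rewrite mulrC ler_wpM2l// exprn_ge0// ltW// (lt_trans ltr01).
rewrite -e -sum1_size natr_sum; exact: ler_sum.
Qed.

(** Division by beta brings 4 below 3, and the reflected child adds at most 1: beta expands while b
    contracts, so the real conjugates stay bounded under subdivision. *)
Lemma emb_beta_level n t u : `|emb beta t.1.1| <= 4 ->
  u \in level children n [:: t] -> `|emb beta u.1.1| <= 4.
Proof using beta3.
move=> t4; move: u.
apply: (@level_ind _ _ (fun _ u => `|emb beta u.1.1| <= 4) n 0); last first.
  by move=> x; rewrite inE => /eqP ->.
have /andP[be1 be2] := beta_approx beta3.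
have div y : `|emb beta y| <= 4 -> `|emb beta (divb y)| <= 3.
  rewrite -(emb_divb beta3 y) normrM ger0_norm; last by lra.
  by move: (`|_|) (normr_ge0 (emb beta (divb y))) => a a0; nra.
move=> {}n [[y e] [|j]] x /= /div y3; rewrite !inE; last first.
  by move=> /eqP -> /=; lra.
move=> /orP[]/eqP -> /=; first by lra.
rewrite emb_add; apply: le_trans (ler_normD _ _) _.
have : `|emb beta (sg e, 0%BZ, 0%BZ)| <= 1.
  by case: e; rewrite /= ?(zrN 1) zr1 !zr0 !mul0r !addr0 ?normrN normr1.
by lra.
Qed.
End growth.

Section neighbours.
Context {R : realType} (beta : R) (b : R[i]) (F : set R[i]).
Hypothesis beta3 : beta ^+ 3 = beta ^+ 2 + 1.
Hypothesis b3 : b ^+ 3 = b ^+ 2 + 1.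
Hypothesis b_nonreal : complex.Im b != 0.
Hypothesis F_compact : compact F.
Hypothesis F_nonempty : F !=set0.
Hypothesis F_eq : forall z, F z <->
  (exists2 x, F x & z = b ^+ 3 * x) \/ (exists2 x, F x & z = b * (1 - x)).
Let nb : R := normc b.
Let nb0 : 0 <= nb := nb_ge0 b.
Let nb1 : nb < 1 := nb_lt1 beta3 b3 b_nonreal.
Notation sem := (sem b F).
Notation meet := (meet b F).

Lemma window_delay n t : window n t -> (t.2 < 3)%N.
Proof. by case: t => [[y e] j] /= /andP[]. Qed.

Lemma window_level n k t u : window k t -> u \in level children n [:: t] ->
  window (k + n) u.
Proof.
move=> wt; move: u; apply: (@level_ind _ _ (fun n u => window n u) n k).
  by move=> {}n x y; exact: window_children.
by move=> x; rewrite inE => /eqP ->.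
Qed.

Lemma level_children_uniq n k t : window k t -> uniq (level children n [:: t]).
Proof.
move=> wt; apply: (@level_uniq _ _ (fun n u => window (k + n) u)) => //.
- by move=> {}n x y; rewrite addnS; exact: window_children.
- exact: children_uniq.
- by move=> {}n x x' y; exact: children_inj.
- by move=> x; rewrite inE addn0 => /eqP ->.
Qed.

(** The points outside t that approach z lie in other tiles of the tiling, and the union of those
    tiles is closed. *)
Lemma boundary_overlap t z : window 0 t -> sem t z ->
  (forall r : R, 0 < r -> exists2 w, normc (w - z) < r & ~ sem t w) ->
  exists u, [/\ u != t, window 0 u & sem u z].
Proof using beta3 b3 b_nonreal F_compact F_eq F_nonempty.
move=> wt tz zr; apply: (tiles_closed_union beta3 b3 b_nonreal F_compact F_eq).
move=> r r0; have [w wz tw] := zr r r0.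
have [u wu uw] := tiles_cover beta3 b3 b_nonreal F_compact F_nonempty F_eq w.
exists u, w; split => //; apply/eqP => ut; apply: tw; by rewrite -ut.
Qed.

Lemma neighbours_finite t : window 0 t -> exists l : seq tile,
  (forall u, u \in l -> rel_pos (t, u) \in boundary_nodes) /\
  forall u, window 0 u -> u != t -> meet t u -> u \in l.
Proof using beta3 b3 b_nonreal F_compact F_eq.
move=> wt; have [M M0 MP] := compact_normc_bounded
  (@sem_compact R beta b F beta3 b3 b_nonreal F_compact t).
have [k kP] := initial_tiles_near beta3 b3 b_nonreal F_compact F_eq M.
exists [seq u <- initial_tiles k | rel_pos (t, u) \in boundary_nodes]; split.
  by move=> u; rewrite mem_filter => /andP[].
move=> u wu ut tu; rewrite mem_filter; apply/andP; split.
  by apply: (@initial_meet R beta b F) => //; rewrite eq_sym.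
by case: tu => z tz uz; apply: kP wu uz (MP z tz).
Qed.

(** Relative to one anchor, all others have bounded complex conjugate, by nearness, and real
    conjugate at most 8, by [emb_beta_level]. They therefore fall in one fixed finite set, whatever
    the level. *)
Lemma boundary_level_local (M : R) : exists B : nat, forall n p z l,
  `|emb beta p.1.1.1| <= 4 -> `|emb beta p.2.1.1| <= 4 ->
  rel_pos p \in boundary_nodes -> uniq l ->
  {subset l <= level boundary_pairs n [:: p]} ->
  (forall q, q \in l -> normc (emb b q.1.1.1 - z) <= M) ->
  (size l <= B)%N.
Proof using beta3 b3 b_nonreal.
have [K K0 KP] := boundary_anchors_near b.
have [bx kP] : exists bx : seq Z3, forall d,
    `|emb beta d| <= 8 -> normc (emb b d) <= M + M + K -> d \in bx.
  by have [k kP] := box beta3 b3 b_nonreal 8 (M + M + K); eexists; exact: kP.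
pose tl : seq tile :=
  [seq (de, j) | de <- [seq (d, e) | d <- bx, e <- [:: true; false]], j <- iota 0 3].
pose B := [seq (t, u) | t <- tl, u <- tl].
exists (size B) => n p z l p1 p2 pS ul lp lM.
case: l => [//|q0 l'] in ul lp lM *.
set l := q0 :: l' in ul lp lM *; have q0l : q0 \in l by rewrite inE eqxx.
pose y0 := q0.1.1.1.
pose shift (t : tile) : tile := (sub3 t.1.1 y0, t.1.2, t.2).
have shift_inj : injective shift.
  move=> [[y e] j] [[y' e'] j'] [ey -> ->]; congr (_, _, _).
  move: ey; case: (y) (y') (y0) => [[? ?] ?] [[? ?] ?] [[? ?] ?] /= [? ? ?].
  by congr (_, _, _); lia.
have B4 q : q \in l -> `|emb beta q.1.1.1| <= 4 /\ `|emb beta q.2.1.1| <= 4.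
  move=> /lp/boundary_level_tiles[q1 q2].
  by split; [exact: (emb_beta_level beta3 p1 q1)|exact: (emb_beta_level beta3 p2 q2)].
have near q : q \in l -> normc (emb b q.1.1.1 - emb b y0) <= M + M.
  move=> ql; apply: le_trans (ler_distc_add z _ _) _; apply: lerD; first exact: lM.
  by rewrite normcB; exact: lM.
have ql_box q : q \in l -> sub3 q.1.1.1 y0 \in bx /\ sub3 q.2.1.1 y0 \in bx.
  move=> ql; have [h1 h2] := B4 _ ql; have [h0 _] := B4 _ q0l.
  have hK := KP _ (boundary_level_nodes pS (lp _ ql)).
  have hn := near _ ql.
  split; apply: kP; rewrite emb_sub.
  - by apply: le_trans (ler_normB _ _) _; rewrite (_ : 8 = 4 + 4); [exact: lerD|ring].
  - by apply: le_trans hn _; rewrite lerDl.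
  - by apply: le_trans (ler_normB _ _) _; rewrite (_ : 8 = 4 + 4); [exact: lerD|ring].
  - apply: le_trans (ler_distc_add (emb b q.1.1.1) _ _) _; rewrite addrC.
    by apply: lerD => //; rewrite normcB.
have sub : {subset [seq (shift q.1, shift q.2) | q <- l] <= B}.
  move=> _ /mapP[q ql ->]; have [h1 h2] := ql_box _ ql.
  have /andP[] := boundary_nodes_delay (boundary_level_nodes pS (lp _ ql)).
  case: q {ql} h1 h2 => [[[y e] j] [[y' e'] j']] /= h1 h2 j2 j2'.
  apply/allpairsP; exists (shift (y, e, j), shift (y', e', j')); split => //.
    apply/allpairsP; exists ((sub3 y y0, e), j); split => //.
      by apply/allpairsP; exists (sub3 y y0, e); split => //; case: (e).
    by rewrite mem_iota.
  apply/allpairsP; exists ((sub3 y' y0, e'), j'); split => //.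
    by apply/allpairsP; exists (sub3 y' y0, e'); split => //; case: (e').
  by rewrite mem_iota.
rewrite -(size_map (fun q => (shift q.1, shift q.2)) l).
apply: uniq_leq_size sub; rewrite map_inj_uniq// => -[t u] [t' u'] /=.
move=> e; have /= /shift_inj -> := congr1 fst e.
by have /= /shift_inj -> := congr1 snd e.
Qed.
Variable mu : R.
Hypothesis mu0 : 0 < mu.
Hypothesis mu10 : mu ^+ 10 = mu ^+ 7 + mu ^+ 3 + 2 * mu + 1.
Hypothesis mu_beta : mu < beta.

(* Otherwise a small piece of u lies in t, and the number beta^m of its
   subpieces of level m exceeds the number mu^m of boundary pairs. *)
Lemma overlap_not_interior t u z (r : R) :
  window 0 t -> window 0 u -> t != u -> sem t z -> sem u z -> 0 < r ->
  exists2 w, normc (w - z) < r & ~ sem t w.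
Proof using beta3 b3 b_nonreal F_compact F_eq F_nonempty mu0 mu10 mu_beta.
move=> wt wu tu tz uz r0; apply: contrapT => nw.
have rt w : normc (w - z) < r -> sem t w.
  by move=> wz; apply: contrapT => tw; apply: nw; exists w.
have tuS : rel_pos (t, u) \in boundary_nodes.
  by apply: (@initial_meet R beta b F) => //; exists z.
(* A piece of level n has diameter at most 2 (47/40 + 1) |b|^n < 6 |b|^n, so the piece of u that
   contains z lies within r of z. *)
have [n] := exprn_small nb0 nb1 (divr_gt0 r0 (ltr0n R 6)).
rewrite ltr_pdivlMr// => nr.
have [d dn [w dw zw]] := (sem_level b3 F_eq n u z).1 uz.
have dt m d' : d' \in level children m [:: d] ->
    exists2 q, q \in level boundary_pairs (m + n) [:: (t, u)] & q.2 = d'.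
  move=> d'm; have d'mn : d' \in level children (m + n) [:: u].
    by apply/mem_levelD; exists d.
  have [x0 Fx0] := F_nonempty.
  have [x d'x] : exists x, sem d' x.
    by case: d' {d'm d'mn} => [[y e] j];
      exists (emb b y + zr (sg e) * b ^+ j * x0); exists x0.
  have dx : sem d (b ^+ m * x).
    by apply/(sem_level b3 F_eq m); exists d' => //; exists x.
  have : sem t (b ^+ (m + n) * x).
    apply: rt; rewrite addnC exprD -mulrA zw -mulrBr normcM normcX -/nb.
    apply: le_lt_trans nr; apply: ler_wpM2l; first exact: exprn_ge0.
    have h1 := sem_anchor beta3 b3 b_nonreal F_compact F_eq dx.
    have h2 := sem_anchor beta3 b3 b_nonreal F_compact F_eq dw.
    apply: le_trans (ler_distc_add (emb b d.1.1) _ _) _.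
    by rewrite (normcB (emb b d.1.1)); lra.
  move=> /(sem_level b3 F_eq (m + n))[t' t'n [x' t'x' /(mulfI _)]].
  rewrite expf_neq0 ?(b_neq0 beta3 b3 b_nonreal)// => /(_ isT) xx.
  exists (t', d') => //.
  apply: (@boundary_level_meet R beta b F) => //.
  by exists x => //; rewrite xx.
have wd' : window n d by exact: window_level wu dn.
have [C C0 CP] := boundary_level_size mu0 mu10.
have le m : 2 / 5 * beta ^+ m <= C * mu ^+ n * mu ^+ m.
  apply: le_trans (size_level_children beta3 m (window_delay wd')) _.
  rewrite -mulrA -exprD addnC; apply: le_trans (CP (m + n)%N _ tuS).
  rewrite ler_nat -(size_map snd (level boundary_pairs _ _)).
  apply: uniq_leq_size.
    exact: level_children_uniq wd'.
  by move=> d' /dt[q qn <-]; exact: map_f.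
have be0 : 0 < beta := lt_trans mu0 mu_beta.
have K0 : 0 < C * mu ^+ n by rewrite mulr_gt0// exprn_gt0.
have [m] := @exprn_small _ (mu / beta) (2 / 5 / (C * mu ^+ n))
  (divr_ge0 (ltW mu0) (ltW be0)) (ltac:(by rewrite ltr_pdivrMr// mul1r))
  (ltac:(by rewrite divr_gt0// divr_gt0)).
rewrite ltr_pdivlMr// expr_div_n mulrAC ltr_pdivrMr ?exprn_gt0//.
by rewrite ltNge (mulrC (mu ^+ m)) le.
Qed.
End neighbours.

(** * Null sets of the plane *)

Section planar_measure.
Context {R : realType}.
Local Notation leb2 := (@lebesgue_measure R \x @lebesgue_measure R)%E.

Definition square (c : R[i]) (r : R) : set (R * R) :=
  `[complex.Re c - r, complex.Re c + r]%classic `*`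
  `[complex.Im c - r, complex.Im c + r]%classic.

Lemma square_measurable c r : measurable (square c r).
Proof. by apply: measurableX; exact: measurable_itv. Qed.

Lemma square_measure c r : 0 <= r -> leb2 (square c r) = ((2 * r) ^+ 2)%:E.
Proof.
move=> r0; rewrite product_measure1E; [|exact: measurable_itv..].
have side (x : R) : lebesgue_measure `[x - r, x + r]%classic = (2 * r)%:E.
  rewrite lebesgue_measure_itv /= lte_fin.
  case: ltP => [_|h]; first by rewrite -EFinB; congr EFin; ring.
  by congr EFin; lra.
transitivity ((2 * r)%:E * (2 * r)%:E)%E; first by congr mule; exact: side.
by rewrite -EFinM expr2.
Qed.

Lemma disc_square (c : R[i]) r x y : normc (Complex x y - c) <= r -> square c r (x, y).
Proof.
move=> h; have h1 := le_trans (Re_le_normc _) h.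
have h2 := le_trans (Im_le_normc _) h.
move: h1 h2; case: c {h} => u v /=; rewrite !ler_norml => /andP[a1 a2] /andP[a3 a4].
by split; rewrite /= in_itv /=; apply/andP; split; lra.
Qed.

Lemma squares_measure (l : seq R[i]) r : 0 <= r ->
  (leb2 (\big[setU/set0]_(c <- l) square c r) <= ((size l)%:R * (2 * r) ^+ 2)%:E)%E.
Proof.
move=> r0; elim: l => [|c l ih]; first by rewrite big_nil measure0 mul0r.
rewrite big_cons; apply: (@le_trans _ _
    (leb2 (square c r) + leb2 (\big[setU/set0]_(c <- l) square c r))%E).
  apply: measureU2; first exact: square_measurable.
  by apply: bigsetU_measurable => ? _; exact: square_measurable.
apply: le_trans (leeD2l _ ih) _.
have -> : (size (c :: l))%:R = 1 + (size l)%:R :> R by rewrite /= mulrS.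
by rewrite square_measure// -EFinD lee_fin [leRHS]mulrDl mul1r.
Qed.

Lemma planar_negligible (A : set R[i]) :
  (forall e : R, 0 < e -> exists (l : seq R[i]) (r : R),
    [/\ 0 <= r, (size l)%:R * (2 * r) ^+ 2 <= e &
        forall z, A z -> exists2 c, c \in l & normc (z - c) <= r]) ->
  leb2.-negligible [set u | A (Complex u.1 u.2)].
Proof.
move=> hA.
have h (n : nat) : exists lr : seq R[i] * R,
    [/\ 0 <= lr.2, (size lr.1)%:R * (2 * lr.2) ^+ 2 <= n.+1%:R^-1 &
        forall z, A z -> exists2 c, c \in lr.1 & normc (z - c) <= lr.2].
  by have [l [r lr]] := hA n.+1%:R^-1 (ltac:(by rewrite invr_gt0)); exists (l, r).
have [f fP] := choice h.
pose U n := \big[setU/set0]_(c <- (f n).1) square c (f n).2.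
have mU n : measurable (U n).
  by apply: bigsetU_measurable => ? _; exact: square_measurable.
exists (\bigcap_n U n); split.
- exact: bigcapT_measurable.
- apply/eqP; rewrite eq_le measure_ge0 andbT; apply/lee_addgt0Pr => e e0.
  rewrite add0e; have [n _ nP] := near_infty_natSinv_lt (PosNum e0).
  apply: (@le_trans _ _ (leb2 (U n))).
    apply: le_measure; [rewrite inE; exact: bigcapT_measurable|
      rewrite inE; exact: mU|by move=> x /(_ n I)].
  have [r0 le _] := fP n; apply: le_trans (squares_measure _ r0) _.
  by rewrite lee_fin; apply: le_trans le _; apply: ltW; exact: (nP n (leqnn n)).
- move=> [x y] /= Axy n _; have [_ _ /(_ _ Axy)[c cl cr]] := fP n.
  rewrite /U -bigcup_seq; exists c => //; exact: disc_square.
Qed.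
End planar_measure.

Section overlaps.
Context {R : realType} (beta : R) (b : R[i]) (F : set R[i]) (mu : R).
Hypothesis beta3 : beta ^+ 3 = beta ^+ 2 + 1.
Hypothesis b3 : b ^+ 3 = b ^+ 2 + 1.
Hypothesis b_nonreal : complex.Im b != 0.
Hypothesis F_compact : compact F.
Hypothesis F_nonempty : F !=set0.
Hypothesis F_eq : forall z, F z <->
  (exists2 x, F x & z = b ^+ 3 * x) \/ (exists2 x, F x & z = b * (1 - x)).
Hypothesis mu0 : 0 < mu.
Hypothesis mu10 : mu ^+ 10 = mu ^+ 7 + mu ^+ 3 + 2 * mu + 1.
Hypothesis mu_beta : mu < beta.
Let nb : R := normc b.
Notation sem := (sem b F).
Notation meet := (meet b F).

Lemma overlap_cover : exists2 C : R, 0 < C & forall n p,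
  rel_pos p \in boundary_nodes -> exists2 l : seq R[i],
    (size l)%:R <= C * mu ^+ n &
    forall z, sem p.1 z -> sem p.2 z ->
      exists2 c, c \in l & normc (z - c) <= 3 * nb ^+ n.
Proof using beta3 b3 b_nonreal F_compact F_eq mu0 mu10.
have [C C0 CP] := boundary_level_size mu0 mu10; exists C => // n p pS.
exists [seq b ^+ n * emb b q.1.1.1 | q <- level boundary_pairs n [:: p]].
  by rewrite size_map; exact: CP.
move=> z z1 z2.
have [q qn [w [w1 _ ->]]] := boundary_level_cover beta3 b3 b_nonreal F_compact F_eq n pS z1 z2.
exists (b ^+ n * emb b q.1.1.1); first by apply/mapP; exists q.
rewrite -mulrBr normcM normcX -/nb mulrC ler_wpM2r ?exprn_ge0 ?normc_ge0//.
by apply: le_trans (sem_anchor beta3 b3 b_nonreal F_compact F_eq w1) _; lra.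
Qed.

Lemma overlap_negligible t u : window 0 t -> window 0 u -> t != u ->
  (@lebesgue_measure R \x @lebesgue_measure R)%E.-negligible
    [set v | sem t (Complex v.1 v.2) /\ sem u (Complex v.1 v.2)].
Proof using beta3 b3 b_nonreal F_compact F_eq mu0 mu10 mu_beta.
move=> wt wu tu; apply: (@planar_negligible _ [set z | sem t z /\ sem u z]).
move=> e e0.
have [mtu|nm] := pselect (meet t u); last first.
  exists [::], 0; split => //=; first by rewrite mul0r ltW.
  by move=> z [tz uz]; case: nm; exists z.
have pS : rel_pos (t, u) \in boundary_nodes by apply: (@initial_meet R beta b F).
have [C C0 CP] := overlap_cover.
have be0 : 0 < beta := lt_trans mu0 mu_beta.
(* C mu^n squares of side 6 |b|^n have total area 36 C (mu / beta)^n, since |b|^2 = 1 / beta. *)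
have K0 : 0 < 36 * C by rewrite mulr_gt0.
have [n] := @exprn_small _ (mu / beta) (e / (36 * C))
  (divr_ge0 (ltW mu0) (ltW be0)) (ltac:(by rewrite ltr_pdivrMr// mul1r))
  (ltac:(by rewrite divr_gt0)).
rewrite ltr_pdivlMr// => ne; have [l sl lP] := CP n _ pS.
exists l, (3 * nb ^+ n); split.
- by rewrite mulr_ge0// exprn_ge0// normc_ge0.
- apply: le_trans (ltW ne).
  have -> : (2 * (3 * nb ^+ n)) ^+ 2 = 36 * (nb ^+ 2) ^+ n.
    by rewrite -exprM mulnC exprM; ring.
  have -> : (mu / beta) ^+ n * (36 * C) = C * mu ^+ n * (36 * (beta^-1) ^+ n).
    by rewrite exprMn; ring.
  have nb2 := normc_b2 beta3 b3 b_nonreal; rewrite -/nb in nb2.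
  have -> : nb ^+ 2 = beta^-1.
    by rewrite -[LHS](mulfK (lt0r_neq0 be0)) nb2 mul1r.
  by rewrite ler_wpM2r// mulr_ge0// exprn_ge0// invr_ge0 ltW.
- by move=> z [tz uz]; exact: lP.
Qed.
End overlaps.

(** * Hausdorff dimension *)

Section hausdorff_bounds.
Context {R : realType}.
Implicit Types (A U : set R[i]) (s : R).
Local Notation dist := (@complex_dist R).
Local Open Scope ereal_scope.

Lemma diam_ge0 A : 0 <= diam dist A.
Proof. by apply: ereal_sup_ubound; left. Qed.

Lemma diam_ge A x y : A x -> A y -> (normc (x - y)%R)%:E <= diam dist A.
Proof. by move=> Ax Ay; apply: ereal_sup_ubound; right; exists x => //; exists y. Qed.

Lemma diam_le A (r : R) : (0 <= r)%R ->
  (forall x y, A x -> A y -> (normc (x - y) <= r)%R) -> diam dist A <= r%:E.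
Proof.
move=> r0 Ar; apply: ge_ereal_sup => _ [->|[x Ax [y Ay <-]]].
  by rewrite lee_fin.
by rewrite lee_fin; exact: Ar.
Qed.

Lemma diam_pow_ge0 s A : 0 <= diam_pow dist s A.
Proof. by rewrite /diam_pow; case: ifP => // _; exact: poweR_ge0. Qed.

Lemma diam_fin A (r : R) : diam dist A <= r%:E ->
  exists2 a : R, (0 <= a <= r)%R & diam dist A = a%:E.
Proof.
have := diam_ge0 A; case: (diam dist A) => [a||]//=.
by rewrite !lee_fin => a0 ar; exists a => //; rewrite a0.
Qed.

Lemma diam_pow_le s A (r : R) : (0 < s)%R -> diam dist A <= r%:E ->
  diam_pow dist s A <= (r `^ s)%:E.
Proof.
move=> s0 /diam_fin[a /andP[a0 ar] da]; rewrite /diam_pow; case: ifP => _.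
  by rewrite lee_fin powR_ge0.
rewrite da poweR_EFin lee_fin; apply: ge0_ler_powR => //; rewrite ?nnegrE//.
- exact: ltW.
- exact: le_trans ar.
Qed.

Lemma diam_pow_anti s s' A : (0 <= s)%R -> (s <= s')%R -> (0 < s')%R ->
  diam dist A <= 1 -> diam_pow dist s' A <= diam_pow dist s A.
Proof.
move=> s0 ss s'0 /diam_fin[a /andP[a0 a1] da]; rewrite /diam_pow; case: ifP => // _.
rewrite da !poweR_EFin lee_fin.
have [a_gt0|] := ltP 0%R a; last first.
  move=> a0'; have -> : a = 0%R by apply/eqP; rewrite eq_le a0'.
  by rewrite powR0 ?powR_ge0// gt_eqF.
have := @ger_powR _ a.
rewrite a_gt0 a1 => /(_ isT); exact.
Qed.

Lemma premeasure_ge0 s delta A : 0 <= hausdorff_premeasure dist s delta A.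
Proof.
apply: le_ereal_inf_tmp => _ [U _ <-]; apply: nneseries_ge0 => n _ _.
exact: diam_pow_ge0.
Qed.

Lemma hausdorff_measure0 s A : (0 < s)%R ->
  (forall e delta : R, (0 < e)%R -> (0 < delta)%R ->
    exists (l : seq R[i]) (r : R), [/\ (0 <= r)%R, (2 * r <= delta)%R,
      ((size l)%:R * (2 * r) `^ s <= e)%R &
      forall z, A z -> exists2 c, c \in l & (normc (z - c) <= r)%R]) ->
  hausdorff_measure dist s A = 0.
Proof.
move=> s0 hA; apply/eqP; rewrite eq_le; apply/andP; split; last first.
  apply: le_trans (premeasure_ge0 s 1 A) _; apply: ereal_sup_ubound.
  by exists 1%R => //=; exact: ltr01.
apply: ge_ereal_sup => _ [delta /= d0 <-]; apply/lee_addgt0Pr => e e0.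
rewrite add0e; have [l [r [r0 rd le lA]]] := hA e delta e0 d0.
pose U i : set R[i] := if (i < size l)%N
  then [set z | (normc (z - nth 0%R l i) <= r)%R] else set0.
have dU i : diam dist (U i) <= (2 * r)%:E.
  rewrite /U; case: ifP => _; apply: diam_le => //; rewrite ?mulr_ge0//.
  move=> x y /= xr yr; apply: le_trans (ler_distc_add (nth 0%R l i) _ _) _.
  by rewrite (normcB _ y) mulr_natl mulr2n lerD.
apply: (@le_trans _ _ (\sum_(0 <= i <oo) diam_pow dist s (U i))).
  apply: ereal_inf_lbound; exists U => //; split=> [z /lA[c cl zc]|i].
    exists (index c l) => //; rewrite /U index_mem cl /=.
    by rewrite nth_index.
  by apply: le_trans (dU i) _; rewrite lee_fin.
rewrite (@nneseries_split _ _ 0 (size l)); last by move=> k _; exact: diam_pow_ge0.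
rewrite [X in _ + X]eseries0 ?adde0; last first.
  move=> i; rewrite add0n => li _.
  by rewrite /U ltnNge li /= /diam_pow eqxx.
rewrite add0n big_mkord; apply: (@le_trans _ _ (\sum_(i < size l) ((2 * r) `^ s)%:E)).
  by apply: lee_sum => i _; exact: diam_pow_le.
by rewrite sumEFin lee_fin sumr_const card_ord -[leLHS]mulr_natl.
Qed.

(** For s' < s a set of diameter at most 1 contributes at least as much with exponent s' as with s,
    so positivity of the premeasure at the single scale 1 rules out every smaller exponent. *)
Lemma hausdorff_dim_eq s A : (0 < s)%R ->
  (forall s', (s < s')%R -> hausdorff_measure dist s' A = 0) ->
  (exists2 c : R, (0 < c)%R & c%:E <= hausdorff_premeasure dist s 1 A) ->
  hausdorff_dim dist A = s%:E.
Proof.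
move=> s0 up [c c0 lo]; apply/eqP; rewrite eq_le; apply/andP; split.
  apply/lee_addgt0Pr => e e0; apply: ereal_inf_lbound.
  exists (s + e)%R => //; split; first by rewrite addr_ge0// ltW.
  by apply: up; rewrite ltrDl.
apply: le_ereal_inf_tmp => _ [s' [s'0 h0] <-]; rewrite lee_fin leNgt.
apply/negP => ss.
have : c%:E <= hausdorff_measure dist s' A.
  apply: (le_trans lo).
  apply: (@le_trans _ _ (hausdorff_premeasure dist s' 1 A)); last first.
    by apply: ereal_sup_ubound; exists 1%R => //=; exact: ltr01.
  apply: le_ereal_inf_tmp => _ [U [AU dU] <-].
  apply: (@le_trans _ _ (\sum_(0 <= i <oo) diam_pow dist s (U i))).
    by apply: ereal_inf_lbound; exists U.
  apply: lee_nneseries => [i _ _|i _]; first exact: diam_pow_ge0.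
  by apply: diam_pow_anti => //; exact: ltW.
by rewrite h0 lee_fin leNgt c0.
Qed.

(* Each U_i is replaced by a slightly larger open set V_i; e bounds the total
   increase. *)
Lemma premeasure_open_cover s (K A : set R[i]) (c : R) : (0 < s)%R -> (0 < c)%R ->
  K `<=` A -> compact K ->
  (forall (n : nat) (V : nat -> set R[i]) (t : nat -> R),
     (forall i, (0 < t i < 1)%R) ->
     (forall i x y, V i x -> V i y -> (normc (x - y) <= t i)%R) ->
     K `<=` [set z | exists2 i, (i < n)%N & V i z] ->
     (c <= \sum_(i < n) t i `^ s)%R) ->
  (Num.min c 1 / 2)%:E <= hausdorff_premeasure dist s 1 A.
Proof.
move=> s0 c0 KA cK hV; apply: le_ereal_inf_tmp => _ [U [AU dU] <-].
set S := \sum_(0 <= i <oo) _; rewrite leNgt; apply/negP => lt.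
have fin i : exists2 a : R, (0 <= a <= 1)%R & diam dist (U i) = a%:E := diam_fin (dU i).
have [a aP da] : exists2 a : nat -> R, (forall i, 0 <= a i <= 1)%R &
    forall i, diam dist (U i) = (a i)%:E.
  have [f fP] := choice (fun i => let: ex_intro2 a h1 h2 := fin i in
    ex_intro (fun a : R => (0 <= a <= 1)%R /\ diam dist (U i) = a%:E) a (conj h1 h2)).
  by exists f => i; have [] := fP i.
pose D i : R := if U i == set0 then 0%R else (a i `^ s)%R.
have DE i : diam_pow dist s (U i) = (D i)%:E.
  by rewrite /diam_pow /D; case: ifP => // _; rewrite da poweR_EFin.
have D0 i : (0 <= D i)%R by rewrite /D; case: ifP => // _; exact: powR_ge0.
have sumD n : (\sum_(i < n) D i < Num.min c 1 / 2)%R.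
  rewrite -lte_fin -sumEFin; apply: le_lt_trans lt.
  under eq_bigr do rewrite -DE.
  rewrite -(big_mkord xpredT (fun i => diam_pow dist s (U i))).
  by apply: nneseries_lim_ge => i _ _; exact: diam_pow_ge0.
(* The enlarged sums stay below 2 e = min(c, 1): the bound c contradicts the hypothesis on finite
   covers, the bound 1 keeps every t i below 1. *)
set e : R := (Num.min c 1 / 2)%R in sumD lt.
have e0 : (0 < e)%R by rewrite divr_gt0// lt_min c0 ltr01.
have e1 : (e * 2 <= 1)%R by rewrite /e divfK// ge_min lexx orbT.
have ec : (e * 2 <= c)%R by rewrite /e divfK// ge_min lexx.
pose E i : R := (D i + e * 2^-1 ^+ i.+1)%R.
have sumE n : (\sum_(i < n) E i = \sum_(i < n) D i + e * (1 - 2^-1 ^+ n))%R.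
  rewrite big_split /=; congr (_ + _)%R.
  elim: n => [|n ih]; first by rewrite big_ord0 expr0 subrr mulr0.
  by rewrite big_ord_recr /= ih exprS; field.
have half n : (0 < 2^-1 ^+ n :> R)%R by rewrite exprn_gt0// invr_gt0.
have E0 i : (0 < E i)%R by rewrite ltr_wpDl// mulr_gt0.
have sumE1 n : (\sum_(i < n) E i < e * 2)%R.
  rewrite sumE mulr_natr mulr2n; apply: ltr_leD => //.
  by rewrite ler_piMr ?(ltW e0)// lerBlDr lerDl ltW.
have E1 i : (E i < 1)%R.
  apply: lt_le_trans e1; apply: le_lt_trans (sumE1 i.+1).
  by rewrite big_ord_recr /= lerDr sumr_ge0// => ? _; exact: ltW.
pose t i : R := (E i `^ s^-1)%R.
have tE i : (t i `^ s = E i)%R.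
  by rewrite /t -powRrM mulVf ?gt_eqF// powRr1// ltW.
have t0 i : (0 < t i)%R by rewrite /t powR_gt0.
have t1 i : (t i < 1)%R.
  apply: (@lt_le_trans _ _ (1 `^ s^-1)%R); last by rewrite powR1.
  rewrite /t; apply: gt0_ltr_powR => //.
  - by rewrite invr_gt0.
  - by rewrite nnegrE ltW.
  - by rewrite nnegrE.
(* Half the gap on either side keeps the diameter of the neighbourhood at most t i. The gap is
   positive because t i is defined by t i ^ s = E i > D i. *)
pose rho i : R := ((t i - a i) / 2)%R.
have rho0 i : U i !=set0 -> (0 < rho i)%R.
  move=> /set0P Ui; rewrite divr_gt0// subr_gt0 ltNge; apply/negP => ta.
  have /andP[a0 _] := aP i.
  have : (t i `^ s <= a i `^ s)%R.
    by apply: ge0_ler_powR => //; rewrite ?nnegrE ?(ltW s0) ?(ltW (t0 i)).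
  rewrite tE /E /D (negbTE Ui) leNgt => /negP; apply.
  by rewrite ltrDl mulr_gt0.
pose V i : set R[i] := [set z | exists2 u, U i u & (normc (z - u) < rho i)%R].
have oV i : setT i -> open (V i).
  move=> _; have -> : V i = \bigcup_(u in U i) [set z | (normc (z - u) < rho i)%R] by [].
  by apply: bigcup_open => u _; exact: open_disc.
have KV : K `<=` cover setT V.
  move=> z /KA/AU[i _ Uz]; exists i => //; exists z => //.
  by rewrite subrr normc0 rho0//; exists z.
have := cK; rewrite compact_cover => /(_ nat setT V oV KV)[I _ KI].
pose n := (\max_(i <- finmap.enum_fset I) i).+1.
have : (c <= \sum_(i < n) t i `^ s)%R.
  apply: (hV n V t) => [i|i x y|z].
  - by rewrite t0 t1.
  - move=> [u Uu xu] [w Uw yw].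
    have : (normc (u - w) <= a i)%R by rewrite -lee_fin -da; exact: diam_ge.
    have h1 := ler_distc_add u x y; have h2 := ler_distc_add w u y.
    rewrite (normcB w y) in h2; move: xu yw; rewrite /rho => xu yw uw.
    by lra.
  - move=> /KI[i /= iI Vz]; exists i => //; rewrite /n ltnS.
    exact: leq_bigmax_seq.
by under eq_bigr do rewrite tE; have := sumE1 n; lra.
Qed.
End hausdorff_bounds.

Lemma level_flatten {T : eqType} (ch : T -> seq T) n s :
  level ch n s = flatten [seq level ch n [:: x] | x <- s].
Proof.
elim: s => [|x s ih]; last by rewrite -cat1s level_cat ih.
by elim: n => //= n ->.
Qed.

(** * The mass distribution on an overlap of two tiles *)

Section mass_distribution.
Context {R : realType} (beta : R) (b : R[i]) (F : set R[i]) (mu : R).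
Hypothesis beta3 : beta ^+ 3 = beta ^+ 2 + 1.
Hypothesis b3 : b ^+ 3 = b ^+ 2 + 1.
Hypothesis b_nonreal : complex.Im b != 0.
Hypothesis F_compact : compact F.
Hypothesis F_nonempty : F !=set0.
Hypothesis F_eq : forall z, F z <->
  (exists2 x, F x & z = b ^+ 3 * x) \/ (exists2 x, F x & z = b * (1 - x)).
Hypothesis mu0 : 0 < mu.
Hypothesis mu10 : mu ^+ 10 = mu ^+ 7 + mu ^+ 3 + 2 * mu + 1.
Let nb : R := normc b.
Notation sem := (sem b F).
Variable p : tile * tile.
Hypothesis pS : rel_pos p \in boundary_nodes.
Hypotheses (w1 : window 0 p.1) (w2 : window 0 p.2).
Hypotheses (p1 : `|emb beta p.1.1.1| <= 4) (p2 : `|emb beta p.2.1.1| <= 4).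

Let reach (n : nat) (V : set R[i]) (q : tile * tile) : bool :=
  `[< exists w, [/\ sem q.1 w, sem q.2 w & V (b ^+ n * w)] >].

Lemma reach_ancestor k m V q q' : q \in level boundary_pairs k [:: q'] ->
  reach (k + m) V q -> reach m V q'.
Proof using b3 F_eq.
move=> /boundary_level_tiles[q1 q2] /asboolP[w [h1 h2 h3]]; apply/asboolP.
exists (b ^+ k * w); split.
- by apply/(sem_level b3 F_eq k); exists q.1 => //; exists w.
- by apply/(sem_level b3 F_eq k); exists q.2 => //; exists w.
- by rewrite mulrA -exprD addnC.
Qed.

(** Divided by b^m, the set V has diameter at most 1, so the anchors of the pairs that reach it lie
    within 47/40 + 1 + 1 < 4 of one point, and [boundary_level_local] applies. *)
Lemma reach_count : exists B : nat, forall m V,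
  (forall x y, V x -> V y -> normc (x - y) <= nb ^+ m) ->
  (size [seq q <- level boundary_pairs m [:: p] | reach m V q] <= B)%N.
Proof using beta3 b3 b_nonreal F_compact F_eq pS w1 w2 p1 p2.
have [B BP] := boundary_level_local beta3 b3 b_nonreal 4; exists B => m V hV.
set l := [seq q <- _ | _].
case E : l => [//|q0 l']; have : q0 \in l by rewrite E inE eqxx.
rewrite mem_filter => /andP[/asboolP[w0 [_ _ Vw0]] _]; rewrite -E.
apply: (BP m p w0 l p1 p2 pS).
- by apply: filter_uniq; exact: boundary_level_uniq.
- by move=> q; rewrite mem_filter => /andP[].
move=> q; rewrite mem_filter => /andP[/asboolP[w [qw _ Vw]] _].
have h1 := sem_anchor beta3 b3 b_nonreal F_compact F_eq qw.
have nbm : 0 < nb ^+ m by rewrite exprn_gt0// (nb_gt0 beta3 b3 b_nonreal).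
have h2 : normc (w - w0) <= 1.
  by have := hV _ _ Vw Vw0; rewrite -mulrBr normcM normcX -/nb ger_pMr.
have := ler_distc_add w (emb b q.1.1.1) w0; rewrite (normcB (emb b q.1.1.1) w).
by move: h1 h2; lra.
Qed.

(** A pair of level N reaching V descends from one of the boundedly many pairs of level m reaching
    V, each of which carries weight at most [wmax] * mu^(N - m) at level N. *)
Lemma reach_weight : exists2 C : R, 0 < C & forall m N V, (m <= N)%N ->
  (forall x y, V x -> V y -> normc (x - y) <= nb ^+ m) ->
  \sum_(q <- level boundary_pairs N [:: p] | reach N V q) weight mu q
    <= C * mu ^+ (N - m).
Proof using beta3 b3 b_nonreal F_compact F_eq mu0 mu10 pS w1 w2 p1 p2.
have [B BP] := reach_count; have [wmin [wmax [wmin0 wP]]] := weight_bounds mu0.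
have wmax0 : 0 < wmax.
  by have /andP[h1 h2] := wP _ pS; apply: lt_le_trans wmin0 (le_trans h1 h2).
exists (B.+1%:R * wmax); first by rewrite mulr_gt0.
move=> m N V mN hV; have muk0 : 0 <= mu ^+ (N - m) by rewrite exprn_ge0 ?ltW.
rewrite -[in level _ N _](subnK mN) levelD level_flatten big_flatten big_map.
set L := level boundary_pairs m [:: p].
apply: (@le_trans _ _ (\sum_(q <- L | reach m V q) mu ^+ (N - m) * wmax)).
  rewrite [leRHS]big_mkcond big_seq [leRHS]big_seq; apply: ler_sum => q' q'm.
  have q'S := boundary_level_nodes pS q'm.
  have wpos q : q \in level boundary_pairs (N - m) [:: q'] -> 0 <= weight mu q.
    by move=> ql; apply/ltW/weight_gt0 => //; exact: boundary_level_nodes q'S ql.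
  case: ifP => rq'.
    apply: (@le_trans _ _ (\sum_(q <- level boundary_pairs (N - m) [:: q']) weight mu q)).
      rewrite big_mkcond big_seq [leRHS]big_seq; apply: ler_sum => q ql.
      by case: ifP => // _; exact: wpos.
    rewrite boundary_level_weight// ler_wpM2l//.
    by have /andP[] := wP _ q'S.
  rewrite big_seq_cond big1// => q /andP[ql rq].
  by rewrite (reach_ancestor ql) ?subnK// in rq'.
rewrite -big_filter big_const_seq count_predT iter_addr_0 -[leLHS]mulr_natl.
rewrite -mulrA (mulrC wmax); apply: ler_wpM2r; first by rewrite mulr_ge0// ltW.
by rewrite ler_nat leqW// BP.
Qed.

(** The total mass mu^N [weight mu p] is shared among the covering sets: by [boundary_meet] every
    pair of level N contains a point of the overlap, which some V i covers. *)
Lemma mass_bound : exists2 c : R, 0 < c &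
  forall (n : nat) (V : nat -> set R[i]) (k : nat -> nat),
  (forall i x y, V i x -> V i y -> normc (x - y) <= nb ^+ k i) ->
  sem p.1 `&` sem p.2 `<=` [set z | exists2 i, (i < n)%N & V i z] ->
  c <= \sum_(i < n) mu^-1 ^+ k i.
Proof using beta3 b3 b_nonreal F_compact F_eq F_nonempty mu0 mu10 pS w1 w2 p1 p2.
have [C C0 CP] := reach_weight.
have wp := weight_gt0 mu0 pS.
exists (weight mu p / C); first by rewrite divr_gt0.
(* Any level above all k i would do; the sum is a convenient one. *)
move=> n V k hV KV; pose N := (\sum_(i < n) k i)%N.
have kN (i : 'I_n) : (k i <= N)%N by rewrite /N (bigD1 i)//= leq_addr.
have muN : 0 < mu ^+ N by rewrite exprn_gt0.
rewrite ler_pdivrMr// mulrC mulr_sumr -(ler_pM2l muN) -boundary_level_weight//.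
apply: (@le_trans _ _ (\sum_(i < n)
    \sum_(q <- level boundary_pairs N [:: p] | reach N (V i) q) weight mu q)).
  under [leRHS]eq_bigr do rewrite big_mkcond.
  rewrite exchange_big /= big_seq [leRHS]big_seq; apply: ler_sum => q qN.
  have qS := boundary_level_nodes pS qN.
  have [w hw1 hw2] := boundary_meet beta3 b3 b_nonreal F_compact F_nonempty F_eq qS.
  have [q1 q2] := boundary_level_tiles qN.
  have [|i iN Vi] := KV (b ^+ N * w).
    by split; apply/(sem_level b3 F_eq N); [exists q.1|exists q.2] => //; exists w.
  have rq : reach N (V i) q by apply/asboolP; exists w.
  rewrite (bigD1 (Ordinal iN))//= rq lerDl sumr_ge0// => j _.
  by case: ifP => _; [exact: ltW (weight_gt0 mu0 qS)|exact: lexx].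
rewrite mulr_sumr; apply: ler_sum => i _.
apply: le_trans (CP (k i) N (V i) (kN i) (hV i)) _.
have e : mu ^+ N * mu^-1 ^+ k i = mu ^+ (N - k i).
  rewrite -[in mu ^+ N](subnK (kN i)) exprD -mulrA -exprMn mulfV ?gt_eqF//.
  by rewrite expr1n mulr1.
by rewrite mulrCA e.
Qed.
End mass_distribution.

(** * The dimension of the boundary *)

Section dimension.
Context {R : realType} (beta : R) (b : R[i]) (F : set R[i]) (mu : R).
Hypothesis beta3 : beta ^+ 3 = beta ^+ 2 + 1.
Hypothesis b3 : b ^+ 3 = b ^+ 2 + 1.
Hypothesis b_nonreal : complex.Im b != 0.
Hypothesis F_compact : compact F.
Hypothesis F_nonempty : F !=set0.
Hypothesis F_eq : forall z, F z <->
  (exists2 x, F x & z = b ^+ 3 * x) \/ (exists2 x, F x & z = b * (1 - x)).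
Hypothesis mu1 : 1 < mu.
Hypothesis mu10 : mu ^+ 10 = mu ^+ 7 + mu ^+ 3 + 2 * mu + 1.
Hypothesis mu_beta : mu < beta.
Let nb : R := normc b.
Let nb0 : 0 < nb := nb_gt0 beta3 b3 b_nonreal.
Let nb1 : nb < 1 := nb_lt1 beta3 b3 b_nonreal.
Let mu0 : 0 < mu := lt_trans ltr01 mu1.
Let s : R := 2 * ln mu / ln beta.
Notation sem := (sem b F).
Let t0 : tile := ((0, 0, 0)%BZ, true, 0%N).
(** The tile b - F, a neighbour of F: its position relative to F is the first node of
    [boundary_graph]. Its overlap with F carries the mass for the lower bound. *)
Let t1 : tile := ((0, 1, 0)%BZ, false, 0%N).

Lemma sem_origin z : sem t0 z <-> F z.
Proof using.
rewrite /= !zr0 zr1; split=> [[x Fx ->]|Fz]; last by exists z => //; ring.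
by rewrite (_ : _ + _ = x) //; ring.
Qed.

Lemma exponent_gt0 : 0 < s.
Proof using beta3 mu1.
by rewrite /s divr_gt0 ?mulr_gt0 ?ln_gt0// (beta_gt1 beta3).
Qed.

(** The exponent s is defined by this relation: |b| = beta^(-1/2), so |b|^s = exp(- ln mu). *)
Lemma normc_b_powR : nb `^ s = mu^-1.
Proof using beta3 b3 b_nonreal mu1.
have b1 := beta_gt1 beta3; have be0 : 0 < beta := lt_trans ltr01 b1.
have lb : 0 < ln beta by rewrite ln_gt0.
have lnb : ln nb *+ 2 = - ln beta.
  have nb2 := normc_b2 beta3 b3 b_nonreal; rewrite -/nb in nb2.
  rewrite -lnXn// -lnV ?posrE//; congr ln.
  by rewrite -[LHS](mulfK (lt0r_neq0 be0)) nb2 mul1r.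
rewrite /powR gt_eqF//.
have -> : s * ln nb = - ln mu.
  have -> : ln nb = - ln beta / 2 by move: lnb; rewrite mulr2n; lra.
  by rewrite /s; field; exact: lt0r_neq0.
by rewrite -lnV ?posrE// lnK// posrE invr_gt0.
Qed.

Lemma boundaryP z : boundary F z <->
  F z /\ forall r : R, 0 < r -> exists2 w, normc (w - z) < r & ~ F w.
Proof using F_compact.
have cF := compact_closedc F_compact.
rewrite /boundary -((closure_id F).1 cF); split=> -[Fz nz]; split=> //.
  move=> r r0; apply: contrapT => nw; apply: nz; apply/nbhs_normcP.
  by exists r => // w wz; apply: contrapT => Fw; apply: nw; exists w.
by move=> /nbhs_normcP[r r0 rF]; have [w wz] := nz r r0; apply; exact: rF.
Qed.

Lemma hausdorff_boundary0 s' : s < s' ->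
  hausdorff_measure (@complex_dist R) s' (boundary F) = 0%E.
Proof using beta3 b3 b_nonreal F_compact F_nonempty F_eq mu1 mu10 mu_beta.
move=> ss; have s'0 : 0 < s' := lt_trans exponent_gt0 ss.
apply: hausdorff_measure0 => // e delta e0 d0.
have wt0 : window 0 t0 by [].
have [nbs [nbsS nbsP]] := neighbours_finite beta3 b3 b_nonreal F_compact F_eq wt0.
have [C C0 CP] := overlap_cover beta3 b3 b_nonreal F_compact F_eq mu0 mu10.
(* An overlap is covered by C mu^n discs of diameter 6 |b|^n, contributing C 6^s' q^n; q < 1 because
   s' > s. *)
pose q := mu * nb `^ s'.
have q0 : 0 <= q by rewrite mulr_ge0 ?powR_ge0// ltW.
have q1 : q < 1.
  rewrite /q -ltr_pdivlMl// mulr1 -normc_b_powR /powR gt_eqF// ltr_expR.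
  by rewrite ltr_nM2r// ln_lt0// nb0 nb1.
pose L : R := (size nbs).+1%:R.
have L0 : 0 < L by rewrite ltr0n.
pose D := L * C * 6 `^ s'.
have D0 : 0 < D by rewrite !mulr_gt0// powR_gt0.
have [n1] := exprn_small q0 q1 (divr_gt0 e0 D0); rewrite ltr_pdivlMr// => n1e.
have [n2] := exprn_small (ltW nb0) nb1 (divr_gt0 d0 (ltr0n R 6)).
rewrite ltr_pdivlMr// => n2d.
(* [n1] makes the sum at most e and [n2] the diameters at most delta. *)
pose n := (n1 + n2)%N.
have [l lsize lP] : exists2 l : seq R[i],
    (size l)%:R <= (size nbs)%:R * (C * mu ^+ n) &
    forall u, u \in nbs -> forall z, sem t0 z -> sem u z ->
      exists2 c, c \in l & normc (z - c) <= 3 * nb ^+ n.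
  elim: nbs nbsS {nbsP L L0 D D0 n1e} => [_|u l ih lS].
    by exists [::] => //=; rewrite mul0r.
  have [|l1 s1 l1P] := ih; first by move=> v vl; apply: lS; rewrite inE vl orbT.
  have [l2 s2 l2P] := CP n (t0, u) (lS u (mem_head _ _)).
  exists (l2 ++ l1).
    by rewrite size_cat natrD /= -[(size l).+1]add1n natrD mulrDl mul1r lerD.
  move=> v; rewrite inE => /predU1P[->|vl] z z0 zv.
    by have [c cl cz] := l2P z z0 zv; exists c => //; rewrite mem_cat cl.
  by have [c cl cz] := l1P v vl z z0 zv; exists c => //; rewrite mem_cat cl orbT.
have nbn0 : 0 <= nb ^+ n by rewrite exprn_ge0// ltW.
exists l, (3 * nb ^+ n); split.
- by rewrite mulr_ge0.
- apply: ltW; apply: le_lt_trans n2d.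
  have : nb ^+ n <= nb ^+ n2.
    by rewrite /n exprD ler_piMl ?exprn_ge0 ?exprn_ile1 ?(ltW nb0) ?(ltW nb1).
  by move: (nb ^+ n) (nb ^+ n2) => x y; lra.
- apply: (@le_trans _ _ (q ^+ n * D)); last first.
    apply: le_trans (ltW n1e); rewrite ler_pM2r//.
    by rewrite /n exprD ler_piMr ?exprn_ge0 ?exprn_ile1// ltW.
  have -> : (2 * (3 * nb ^+ n)) `^ s' = 6 `^ s' * (nb `^ s') ^+ n.
    have -> : 2 * (3 * nb ^+ n) = 6 * nb ^+ n by ring.
    rewrite powRM//; congr (_ * _).
    by rewrite -(powR_mulrn _ (ltW nb0)) -(powR_mulrn _ (powR_ge0 nb s')) -!powRrM mulrC.
  rewrite (_ : q ^+ n * D = L * (C * mu ^+ n) * (6 `^ s' * (nb `^ s') ^+ n)); last first.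
    by rewrite /q /D exprMn; ring.
  apply: ler_wpM2r; first by rewrite mulr_ge0 ?powR_ge0// exprn_ge0// powR_ge0.
  apply: (le_trans lsize); apply: ler_wpM2r; first by rewrite mulr_ge0 ?exprn_ge0 ?ltW.
  by rewrite /L ler_nat.
- move=> z /boundaryP[/sem_origin tz zr].
  have [u [ut0 wu uz]] : exists u, [/\ u != t0, window 0 u & sem u z].
    apply: (@boundary_overlap R beta b F) => //.
    by move=> r /zr[w wz Fw]; exists w => // /sem_origin.
  by apply: (lP u) => //; apply: nbsP => //; exists z.
Qed.

Lemma scale_index (x : R) : 0 < x < 1 -> exists k, nb ^+ k.+1 < x <= nb ^+ k.
Proof using beta3 b3 b_nonreal.
move=> /andP[x0 x1]; have ex := exprn_small (ltW nb0) nb1 x0.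
case: (ex_minnP ex) => -[|k] kx kmin.
  by move: kx; rewrite expr0 ltNge ltW.
exists k; rewrite kx /= leNgt; apply/negP => /kmin.
by rewrite ltnn.
Qed.

Lemma hausdorff_boundary_pos : exists2 c : R, 0 < c &
  (c%:E <= hausdorff_premeasure (@complex_dist R) s 1 (boundary F))%E.
Proof using beta3 b3 b_nonreal F_compact F_nonempty F_eq mu1 mu10 mu_beta.
have pS : rel_pos (t0, t1) \in boundary_nodes by [].
have wt0 : window 0 t0 by []. have wt1 : window 0 t1 by [].
have h0 : `|emb beta t0.1.1| <= 4 by rewrite /= !zr0 !mul0r !addr0 normr0.
have h1 : `|emb beta t1.1.1| <= 4.
  rewrite /= !zr0 zr1 mul1r mul0r addr0 add0r.
  by have /andP[? ?] := beta_approx beta3; rewrite ger0_norm; lra.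
have [c c0 cP] := mass_bound beta3 b3 b_nonreal F_compact F_nonempty F_eq
  mu0 mu10 pS wt0 wt1 h0 h1.
(* The factor 1 / mu is lost when t i is compared with the next smaller power of |b| in
   [scale_index]. *)
exists (Num.min (c / mu) 1 / 2).
  by rewrite divr_gt0// lt_min divr_gt0// ltr01.
apply: (@premeasure_open_cover _ s (sem t0 `&` sem t1)).
- exact: exponent_gt0.
- by rewrite divr_gt0.
- move=> z [z0 z1]; apply/boundaryP; split; first exact/sem_origin.
  move=> r r0.
  have [w wz nw] := @overlap_not_interior R beta b F beta3 b3 b_nonreal F_compact
    F_nonempty F_eq mu mu0 mu10 mu_beta t0 t1 z r wt0 wt1 isT z0 z1 r0.
  by exists w => // Fw; apply: nw; exact/sem_origin.
- apply: compact_closedI.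
    exact: (@sem_compact R beta b F beta3 b3 b_nonreal F_compact).
  apply: compact_closedc.
  exact: (@sem_compact R beta b F beta3 b3 b_nonreal F_compact).
move=> n V t tP hV KV; have [k kP] := choice (fun i => scale_index (tP i)).
rewrite ler_pdivrMr//.
have := cP n V k; move=> /(_ _ KV) h; apply: le_trans (h _) _.
  by move=> i x y Vx Vy; apply: le_trans (hV i x y Vx Vy) _; have /andP[] := kP i.
rewrite mulr_suml; apply: ler_sum => i _.
have /andP[lt _] := kP i; have /andP[ti0 _] := tP i.
have : (nb ^+ (k i).+1) `^ s <= t i `^ s.
  apply: ge0_ler_powR; rewrite ?nnegrE ?(ltW exponent_gt0)// ltW//.
  by rewrite exprn_gt0.
have -> : (nb ^+ (k i).+1) `^ s = mu^-1 ^+ (k i).+1.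
  rewrite -normc_b_powR -!powR_mulrn ?powR_ge0 ?(ltW nb0)//.
  by rewrite -!powRrM mulrC.
rewrite exprSr => h'; rewrite -[leLHS](mulfVK (lt0r_neq0 mu0)).
by rewrite ler_pM2r.
Qed.

Theorem dim_boundary : hausdorff_dim (@complex_dist R) (boundary F) = s%:E.
Proof using beta3 b3 b_nonreal F_compact F_nonempty F_eq mu1 mu10 mu_beta.
apply: hausdorff_dim_eq; first exact: exponent_gt0.
  exact: hausdorff_boundary0.
exact: hausdorff_boundary_pos.
Qed.
End dimension.

(** * The dominant root mu and the numerical values *)

Section rounded_powers.
Variables (den x : Z).

(** Fixed-point arithmetic in which [den] stands for 1. Dividing after each product keeps the
    integers short for large exponents; the + 1 turns the rounding down into rounding up. *)
Fixpoint pow_up (n : nat) : Z :=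
  if n is n'.+1 then ((pow_up n' * x) / den + 1)%BZ else den.

Fixpoint pow_down (n : nat) : Z :=
  if n is n'.+1 then ((pow_down n' * x) / den)%BZ else den.

Context {R : realFieldType}.
Hypotheses (den0 : (0 < den)%BZ) (x0 : (0 <= x)%BZ).

Let den0' : 0 < zr den :> R.
Proof. by rewrite -zr0 ltr_zr; lia. Qed.

Lemma pow_upP n (y : R) : 0 <= y -> zr den * y <= zr x ->
  zr den * y ^+ n <= zr (pow_up n).
Proof using den0 x0.
move=> y0 yx; elim: n => [|n ih]; first by rewrite expr0 mulr1.
rewrite exprSr -(ler_pM2r den0').
have -> : zr den * (y ^+ n * y) * zr den = zr den * y ^+ n * (zr den * y) by ring.
apply: (@le_trans _ _ (zr (pow_up n) * zr x)).
  by apply: ler_pM => //; rewrite mulr_ge0 ?exprn_ge0 ?(ltW den0').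
rewrite -!zrM ler_zr /=; apply/Z.leb_le.
by have := Z.mul_succ_div_gt (pow_up n * x) den den0; lia.
Qed.

Lemma pow_downP n (y : R) : 0 <= y -> zr x <= zr den * y ->
  zr (pow_down n) <= zr den * y ^+ n.
Proof using den0 x0.
move=> y0 yx; elim: n => [|n ih]; first by rewrite expr0 mulr1.
have p0 : (0 <= pow_down n)%BZ.
  elim: n {ih} => [|n ih] /=; first by lia.
  by apply: Z.div_pos => //; apply: Z.mul_nonneg_nonneg.
rewrite exprSr -(ler_pM2r den0').
have -> : zr den * (y ^+ n * y) * zr den = zr den * y ^+ n * (zr den * y) by ring.
apply: (@le_trans _ _ (zr (pow_down n) * zr x)).
  rewrite -!zrM ler_zr /=; apply/Z.leb_le.
  by have := Z.mul_div_le (pow_down n * x) den den0; lia.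
by apply: ler_pM => //; rewrite -zr0 ler_zr; lia.
Qed.
End rounded_powers.

Lemma zrX {K : pzRingType} (x : Z) n : zr (x ^ Z.of_nat n)%BZ = zr x ^+ n :> K.
Proof.
elim: n => [|n ih]; first by rewrite expr0.
by rewrite Nat2Z.inj_succ Z.pow_succ_r ?zrM ?ih ?exprS//; lia.
Qed.

Section mu.
Context {R : realType}.

Lemma mu_poly_eval {K : comNzRingType} (x : K) :
  (mu_poly K).[x] = x ^+ 10 - x ^+ 7 - x ^+ 3 - x *+ 2 - 1.
Proof. by rewrite /mu_poly !hornerE. Qed.

Lemma mu_poly_root {K : comNzRingType} (x : K) : root (mu_poly K) x <->
  x ^+ 10 = x ^+ 7 + x ^+ 3 + 2 * x + 1.
Proof.
rewrite /root mu_poly_eval mulr_natl; split=> [/eqP e|->].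
  by apply/eqP; rewrite -subr_eq0 -e; apply/eqP; ring.
by apply/eqP; ring.
Qed.

(** The homogenised polynomial: D^10 times the value of [mu_poly] at A / D. *)
Definition mu_poly_num (A D : Z) : Z :=
  (A ^ Z.of_nat 10 - A ^ Z.of_nat 7 * D ^ Z.of_nat 3
    - A ^ Z.of_nat 3 * D ^ Z.of_nat 7
    - 2 * A * D ^ Z.of_nat 9 - D ^ Z.of_nat 10)%BZ.

Lemma mu_poly_scaled (A D : Z) : 0 < zr D :> R ->
  zr D ^+ 10 * (mu_poly R).[zr A / zr D] =
  zr (mu_poly_num A D).
Proof.
move=> d0; rewrite /mu_poly_num !zrB (zrM (A ^ Z.of_nat 7)%BZ) (zrM (A ^ Z.of_nat 3)%BZ).
rewrite (zrM (2 * A)%BZ) (zrM 2 A) !zrX (zr_nat 2) mu_poly_eval.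
move: d0; move: (zr D) (zr A) => d a d0.
have d0' : d != 0 by rewrite gt_eqF.
have e (k l : nat) : d ^+ (k + l) * (a / d) ^+ k = a ^+ k * d ^+ l.
  by rewrite expr_div_n exprD mulrC mulrA divfK ?expf_neq0.
rewrite !mulrBr (e 10 0)%N (e 7 3)%N (e 3 7)%N expr0 !mulr1 mulrnAr.
by have := e 1%N 9%N; rewrite !expr1 => ->; ring.
Qed.

Lemma mu_between (lo hi den : Z) : (0 < den)%BZ -> (lo <= hi)%BZ ->
  (mu_poly_num lo den <= 0)%BZ -> (0 <= mu_poly_num hi den)%BZ ->
  exists mu : R, [/\ zr lo <= zr den * mu, zr den * mu <= zr hi &
    mu ^+ 10 = mu ^+ 7 + mu ^+ 3 + 2 * mu + 1].
Proof.
move=> den0 lohi plo phi.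
have d0 : 0 < zr den :> R by rewrite -zr0 ltr_zr; lia.
have le : zr lo / zr den <= zr hi / zr den :> R.
  by rewrite ler_pM2r ?invr_gt0// ler_zr; lia.
have [|mu] := poly_ivt (p := mu_poly R) le.
  have p10 : 0 < zr den ^+ 10 :> R by rewrite exprn_gt0.
  rewrite -(pmulr_rle0 _ p10) -(pmulr_rge0 _ p10) !mu_poly_scaled//.
  by rewrite -!(@zr0 R) !ler_zr; apply/andP; split; lia.
move=> /andP[]; rewrite ler_pdivrMr// ler_pdivlMr// mulrC.
by move=> h1 h2 /mu_poly_root h3; exists mu.
Qed.

Definition mu_lo : Z := 127003624.
Definition mu_hi : Z := 127003625.
Definition mu_den : Z := 100000000.

Lemma mu_exists : exists mu : R, [/\ zr mu_lo <= zr mu_den * mu,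
  zr mu_den * mu <= zr mu_hi & mu ^+ 10 = mu ^+ 7 + mu ^+ 3 + 2 * mu + 1].
Proof. by apply: mu_between; apply/Z.leb_le || apply/Z.ltb_lt; vm_compute. Qed.

Section dominance.
Variable mu : R.
Hypothesis mu0 : 0 < mu.
Hypothesis mu10 : mu ^+ 10 = mu ^+ 7 + mu ^+ 3 + 2 * mu + 1.

(** If r = q mu with q > 1, the left side is multiplied by q^10 in passing from mu to r, while each
    term on the right, being of lower degree, grows by less. *)
Lemma mu_max (r : R) : 0 <= r -> r ^+ 10 <= r ^+ 7 + r ^+ 3 + 2 * r + 1 -> r <= mu.
Proof using mu0 mu10.
move=> r0 hr; rewrite leNgt; apply/negP => lt.
pose q := r / mu; have q1 : 1 < q by rewrite /q ltr_pdivlMr// mul1r.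
have rq : r = q * mu by rewrite /q divfK// gt_eqF.
have q0 : 0 <= q by rewrite ltW// (lt_trans ltr01).
have qX k : (k < 10)%N -> r ^+ k < q ^+ 10 * mu ^+ k.
  move=> k10; rewrite rq exprMn ltr_pM2r ?exprn_gt0//.
  by rewrite ltr_eXn2l.
have := qX 0%N isT; have := qX 1%N isT; have := qX 3%N isT; have := qX 7%N isT.
rewrite !expr0 !expr1 => h7 h3 h1 h0.
have : q ^+ 10 * mu ^+ 10 = r ^+ 10 by rewrite -exprMn -rq.
rewrite mu10; move: hr h7 h3 h1 h0.
by move: (q ^+ 10) (r ^+ 10) (r ^+ 7) (r ^+ 3) (mu ^+ 7) (mu ^+ 3) => *; lra.
Qed.

(** By the triangle inequality the modulus of a root satisfies the hypothesis of [mu_max], as all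
    lower coefficients have the same sign once moved to the other side. *)
Lemma mu_dominant : dominant_root (mu_poly R[i]) (Complex mu 0).
Proof using mu0 mu10.
have muC : Complex mu 0 = mu%:C%C by [].
split.
  apply/mu_poly_root; rewrite muC -!rmorphXn mu10.
  have e2 : 2 = 2%:C%C :> R[i] by rewrite -(@zr_nat R[i] 2) zr_complex (@zr_nat R 2).
  by rewrite e2 -(rmorph1 (@real_complex R)) -rmorphM -!rmorphD.
move=> w /mu_poly_root ew wmu.
rewrite [`|w|]/(normc w)%:C%C [`|Complex mu 0|]/(normc (Complex mu 0))%:C%C ltcR.
have -> : normc (Complex mu 0) = mu.
  by rewrite /= expr0n addr0 sqrtr_sqr gtr0_norm.
set r := normc w; have r0 : 0 <= r := normc_ge0 w.
have r10 : r ^+ 10 <= r ^+ 7 + r ^+ 3 + normc (2 * w + 1).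
  rewrite -normcX ew -addrA; apply: le_trans (ler_normcD _ _) _.
  by rewrite lerD2r; apply: le_trans (ler_normcD _ _) _; rewrite !normcX.
have n2 : normc (2 : R[i]) = 2.
  by rewrite -[2 in LHS](zr_nat 2) zr_complex /= expr0n addr0 sqrtr_sqr (zr_nat 2) normr_nat.
have n21 : normc (2 * w + 1) <= 2 * r + 1.
  by apply: le_trans (ler_normcD _ _) _; rewrite normcM n2 normc1.
have rmu : r <= mu by apply: mu_max => //; apply: le_trans r10 _; lra.
rewrite lt_neqAle rmu andbT; apply: contra wmu => /eqP rE.
(* If |w| = mu, the triangle inequalities are equalities; the one for 2 w + 1 forces w to be real
   and non-negative, hence w = mu. *)
have le : 2 * r + 1 <= normc (2 * w + 1).
  have e : r ^+ 10 = r ^+ 7 + r ^+ 3 + 2 * r + 1 by rewrite rE mu10.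
  by move: r10 e; move: (r ^+ 10) (r ^+ 7) (r ^+ 3) => *; lra.
have : (2 * r + 1) ^+ 2 <= normc (2 * w + 1) ^+ 2.
  by rewrite lerXn2r ?nnegrE ?normc_ge0//; lra.
have rw := normc_sq w; rewrite -/r in rw.
move: rw rE; case: (w) => x y rw rE; rewrite [complex.Re _]/= [complex.Im _]/= in rw.
have -> : 2 * Complex x y + 1 = Complex (2 * x + 1) (2 * y).
  by rewrite -[LHS]/(_ + _) -(zr_nat 2) !zr_complex -(@zr1 R[i]) zr_complex complex_mulE complex_addE;
    congr Complex; rewrite ?zr1; ring.
rewrite normc_sq [complex.Re _]/= [complex.Im _]/= => h.
have ry : 0 <= y ^+ 2 by exact: sqr_ge0.
have xr : x = r by nra.
have y0 : y = 0.
  by apply/eqP; rewrite -sqrf_eq0; apply/eqP; move: rw; rewrite xr; lra.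
by rewrite xr y0 rE.
Qed.
End dominance.
End mu.

(** * Certified bounds for powers of mu^8 / beta^5 *)

Section ratio.
Context {K : realFieldType}.
Variables (m x : K) (ml mh md xl xh xd D X : Z).
Hypotheses (md0 : (0 < md)%BZ) (xd0 : (0 < xd)%BZ) (D0 : (0 < D)%BZ) (X0 : (0 < X)%BZ).
Hypotheses (ml0 : (0 < ml)%BZ) (xl0 : (0 < xl)%BZ).
Hypotheses (m1 : zr ml <= zr md * m) (m2 : zr md * m <= zr mh).
Hypotheses (x1 : zr xl <= zr xd * x) (x2 : zr xd * x <= zr xh).

Let pos (z : Z) : (0 < z)%BZ -> 0 < zr z :> K.
Proof. by move=> z0; rewrite -zr0 ltr_zr; lia. Qed.

Let m0 : 0 < m.
Proof. by rewrite -(pmulr_rgt0 _ (pos md0)); apply: lt_le_trans (pos ml0) m1. Qed.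

Let x0 : 0 < x.
Proof. by rewrite -(pmulr_rgt0 _ (pos xd0)); apply: lt_le_trans (pos xl0) x1. Qed.

Lemma ratio_up : (D * mh ^ Z.of_nat 8 * xd ^ Z.of_nat 5 <=?
    X * xl ^ Z.of_nat 5 * md ^ Z.of_nat 8)%BZ ->
  zr D * (m ^+ 8 / x ^+ 5) <= zr X.
Proof using All.
rewrite -(@ler_zr K) !(zrM (_ * _)%BZ) (zrM D) (zrM X) !zrX => h.
rewrite mulrA ler_pdivrMr ?exprn_gt0//.
have k0 : 0 < zr md ^+ 8 * zr xd ^+ 5 :> K by rewrite mulr_gt0 ?exprn_gt0 ?pos.
rewrite -(ler_pM2r k0).
have -> : zr D * m ^+ 8 * (zr md ^+ 8 * zr xd ^+ 5) =
  zr D * (zr md * m) ^+ 8 * zr xd ^+ 5 by rewrite exprMn; ring.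
have -> : zr X * x ^+ 5 * (zr md ^+ 8 * zr xd ^+ 5) =
  zr X * (zr xd * x) ^+ 5 * zr md ^+ 8 by rewrite exprMn; ring.
apply: (@le_trans _ _ (zr D * zr mh ^+ 8 * zr xd ^+ 5)).
  rewrite ler_pM2r ?exprn_gt0 ?pos// ler_pM2l ?pos//.
  apply: lerXn2r m2; rewrite nnegrE.
    by rewrite mulr_ge0 ?ltW ?pos.
  by apply: le_trans m2; rewrite mulr_ge0 ?ltW ?pos.
apply: (le_trans h).
rewrite ler_pM2r ?exprn_gt0 ?pos// ler_pM2l ?pos//.
by apply: lerXn2r x1; rewrite nnegrE ?mulr_ge0 ?ltW ?pos.
Qed.

Lemma ratio_down : (X * xh ^ Z.of_nat 5 * md ^ Z.of_nat 8 <=?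
    D * ml ^ Z.of_nat 8 * xd ^ Z.of_nat 5)%BZ ->
  zr X <= zr D * (m ^+ 8 / x ^+ 5).
Proof using All.
rewrite -(@ler_zr K) !(zrM (_ * _)%BZ) (zrM D) (zrM X) !zrX => h.
rewrite mulrA ler_pdivlMr ?exprn_gt0//.
have k0 : 0 < zr md ^+ 8 * zr xd ^+ 5 :> K by rewrite mulr_gt0 ?exprn_gt0 ?pos.
rewrite -(ler_pM2r k0).
have -> : zr D * m ^+ 8 * (zr md ^+ 8 * zr xd ^+ 5) =
  zr D * (zr md * m) ^+ 8 * zr xd ^+ 5 by rewrite exprMn; ring.
have -> : zr X * x ^+ 5 * (zr md ^+ 8 * zr xd ^+ 5) =
  zr X * (zr xd * x) ^+ 5 * zr md ^+ 8 by rewrite exprMn; ring.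
apply: (@le_trans _ _ (zr X * zr xh ^+ 5 * zr md ^+ 8)).
  rewrite ler_pM2r ?exprn_gt0 ?pos// ler_pM2l ?pos//.
  apply: lerXn2r x2; rewrite nnegrE.
    by rewrite mulr_ge0 ?ltW ?pos.
  by apply: le_trans x2; rewrite mulr_ge0 ?ltW ?pos.
apply: (le_trans h).
rewrite ler_pM2r ?exprn_gt0 ?pos// ler_pM2l ?pos//.
by apply: lerXn2r m1; rewrite nnegrE ?mulr_ge0 ?ltW ?pos.
Qed.

Lemma ratio_pow_up (k l : nat) : zr D * (m ^+ 8 / x ^+ 5) <= zr X ->
  (pow_up D X k * xd ^ Z.of_nat l <=? D * xl ^ Z.of_nat l)%BZ ->
  (m ^+ 8 / x ^+ 5) ^+ k <= x ^+ l.
Proof using All.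
move=> yX hZ.
have h : zr (pow_up D X k) * zr xd ^+ l <= zr D * zr xl ^+ l :> K.
  by rewrite -!zrX -!zrM ler_zr.
have y0 : 0 <= m ^+ 8 / x ^+ 5 by rewrite divr_ge0 ?exprn_ge0 ?ltW.
have X0' : (0 <= X)%BZ by lia.
have := pow_upP D0 X0' k y0 yX; move: (_ ^+ k) => y h'.
have k0 : 0 < zr D * zr xd ^+ l :> K by rewrite mulr_gt0 ?exprn_gt0 ?pos.
rewrite -(ler_pM2r k0).
apply: (@le_trans _ _ (zr (pow_up D X k) * zr xd ^+ l)).
  rewrite mulrA [y * _]mulrC ler_pM2r ?exprn_gt0 ?pos//.
apply: le_trans h _; rewrite mulrCA -exprMn ler_pM2l ?pos//.
by rewrite [x * _]mulrC; apply: lerXn2r x1; rewrite nnegrE ?mulr_ge0 ?ltW ?pos.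
Qed.

Lemma ratio_pow_down (k l : nat) : zr X <= zr D * (m ^+ 8 / x ^+ 5) ->
  (D * xh ^ Z.of_nat l <=? pow_down D X k * xd ^ Z.of_nat l)%BZ ->
  x ^+ l <= (m ^+ 8 / x ^+ 5) ^+ k.
Proof using All.
move=> yX hZ.
have h : zr D * zr xh ^+ l <= zr (pow_down D X k) * zr xd ^+ l :> K.
  by rewrite -!zrX -!zrM ler_zr.
have y0 : 0 <= m ^+ 8 / x ^+ 5 by rewrite divr_ge0 ?exprn_ge0 ?ltW.
have X0' : (0 <= X)%BZ by lia.
have := pow_downP D0 X0' k y0 yX; move: (_ ^+ k) => y h'.
have k0 : 0 < zr D * zr xd ^+ l :> K by rewrite mulr_gt0 ?exprn_gt0 ?pos.
rewrite -(ler_pM2r k0).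
apply: (@le_trans _ _ (zr (pow_down D X k) * zr xd ^+ l)); last first.
  rewrite mulrA [y * _]mulrC ler_pM2r ?exprn_gt0 ?pos//.
apply: le_trans h; rewrite mulrCA -exprMn ler_pM2l ?pos//.
rewrite [x * _]mulrC; apply: lerXn2r x2; rewrite nnegrE.
  by rewrite mulr_ge0 ?ltW ?pos.
by apply: le_trans x2; rewrite mulr_ge0 ?ltW ?pos.
Qed.
End ratio.

Definition pow_den : Z := 1000000000000.
(** With [ratio_lo], an enclosure of mu^8 / beta^5 scaled by [pow_den]. *)
Definition ratio_hi : Z := 1001138874540.
Definition ratio_lo : Z := 1001138469924.

(* 2 ln mu / ln beta = 5 / 4 + ln (mu^8 / beta^5) / (4 ln beta), and
   mu^8 / beta^5 is close to 1. *)
Lemma ratio_powers {K : realFieldType} (m x : K) :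
  zr mu_lo <= zr mu_den * m -> zr mu_den * m <= zr mu_hi ->
  zr beta_lo <= zr beta_den * x -> zr beta_den * x <= zr beta_hi ->
  (m ^+ 8 / x ^+ 5) ^+ 1007 <= x ^+ 3 /\ x ^+ 1 <= (m ^+ 8 / x ^+ 5) ^+ 340.
Proof.
move=> m1 m2 x1 x2.
have p1 : (0 < mu_den)%BZ by apply/Z.ltb_lt. have p2 : (0 < beta_den)%BZ by apply/Z.ltb_lt.
have p3 : (0 < pow_den)%BZ by apply/Z.ltb_lt. have p4 : (0 < mu_lo)%BZ by apply/Z.ltb_lt.
have p5 : (0 < beta_lo)%BZ by apply/Z.ltb_lt.
have p6 : (0 < ratio_hi)%BZ by apply/Z.ltb_lt. have p7 : (0 < ratio_lo)%BZ by apply/Z.ltb_lt.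
split.
  apply: (ratio_pow_up p1 p2 p3 p6 p4 p5 m1 m2 x1 x2).
    by apply: (ratio_up p1 p2 p3 p6 p4 p5 m1 m2 x1 x2); vm_cast_no_check (erefl true).
  by vm_cast_no_check (erefl true).
apply: (ratio_pow_down p1 p2 p3 p7 p4 p5 m1 m2 x1 x2).
  by apply: (ratio_down p1 p2 p3 p7 p4 p5 m1 m2 x1 x2); vm_cast_no_check (erefl true).
by vm_cast_no_check (erefl true).
Qed.

Lemma zr_decimal {K : pzRingType} (a k c : nat) :
  zr (Z.of_nat a * 10 ^ Z.of_nat k + Z.of_nat c)%BZ = a%:R * 10 ^+ k + c%:R :> K.
Proof. by rewrite zrD (zrM (Z.of_nat a)) zrX !zr_nat (zr_nat 10). Qed.

Lemma mu_decimals {R : realType} (mu : R) :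
  zr mu_lo <= zr mu_den * mu -> zr mu_den * mu <= zr mu_hi ->
  127 * 10 ^+ 6 + 3624 <= 10 ^+ 8 * mu <= 127 * 10 ^+ 6 + 3625.
Proof.
have -> : mu_lo = (Z.of_nat 127 * 10 ^ Z.of_nat 6 + Z.of_nat 3624)%BZ by vm_compute.
have -> : mu_hi = (Z.of_nat 127 * 10 ^ Z.of_nat 6 + Z.of_nat 3625)%BZ by vm_compute.
have -> : mu_den = (10 ^ Z.of_nat 8)%BZ by vm_compute.
by rewrite !zr_decimal zrX (zr_nat 10) => -> ->.
Qed.

Lemma beta_decimals {R : realType} (beta : R) : beta ^+ 3 = beta ^+ 2 + 1 ->
  (1465 + 57 / 100) / 1000 < beta < (1465 + 58 / 100) / 1000.
Proof.
move=> beta3; have b1 := beta_gt1 beta3.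
have e : beta ^+ 2 * (beta - 1) = 1 by ring: beta3.
have mono (x y : R) : 1 <= x -> x <= y -> x ^+ 2 * (x - 1) <= y ^+ 2 * (y - 1).
  move=> x1 xy; apply: ler_pM; rewrite ?sqr_ge0 ?subr_ge0 ?lerD2r//.
  by rewrite lerXn2r ?nnegrE ?(le_trans ler01 x1) ?(le_trans ler01 (le_trans x1 xy)).
apply/andP; split; rewrite ltNge; apply/negP => h.
  by have := mono _ _ (ltW b1) h; rewrite e; lra.
have := mono _ beta _ h; rewrite e => h'.
by have := h' (ltac:(lra)); lra.
Qed.

(** With L = ln (mu^8 / beta^5) / ln beta, the exponents of [ratio_powers] say 1/340 <= L <= 3/1007.
    Then 5/4 + L/4 lies between 1.25 + 1/1360 and 1.25 + 3/4028, inside the interval from 1.250735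
    to 1.250745. *)
Lemma ratio_approx {R : realType} (mu beta : R) : beta ^+ 3 = beta ^+ 2 + 1 ->
  zr mu_lo <= zr mu_den * mu -> zr mu_den * mu <= zr mu_hi ->
  0 < mu ->
  `|2 * ln mu / ln beta - (125 / 10 ^+ 2 + 74 / 10 ^+ 5)| <= 5 / 10 ^+ 6.
Proof.
move=> beta3 m1 m2 mu0.
have b1 := beta_gt1 beta3; have be0 : 0 < beta := lt_trans ltr01 b1.
have lb0 : 0 < ln beta by rewrite ln_gt0.
have /andP[x1 x2] := beta_bounds beta3.
have [] := ratio_powers m1 m2 (ltW x1) (ltW x2).
move=> {x1 x2 m1 m2}.
have y0 : 0 < mu ^+ 8 / beta ^+ 5 by rewrite divr_gt0 ?exprn_gt0.
have lnX (x : R) n : 0 < x -> ln (x ^+ n) = n%:R * ln x.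
  by move=> x0; rewrite lnXn// mulr_natl.
have lnq : ln (mu ^+ 8 / beta ^+ 5) = 8 * ln mu - 5 * ln beta.
  by rewrite ln_div ?posrE ?exprn_gt0// !lnX.
have toln (x y : R) : 0 < x -> 0 < y -> x <= y -> ln x <= ln y.
  by move=> x0 y0' xy; rewrite ler_ln ?posrE.
move=> /toln; rewrite !exprn_gt0// => /(_ isT isT).
rewrite (lnX _ 1007%N)// lnX// lnq => up.
move=> /toln; rewrite !exprn_gt0// => /(_ isT isT).
rewrite (lnX _ 340%N)// lnX// lnq => lo.
rewrite ler_norml; apply/andP; split.
  rewrite lerBrDl ler_pdivlMr//; lra.
rewrite lerBlDl ler_pdivrMr//; lra.
Qed.

(** * The tiling and its boundary *)

(** The equation of a is equivalent to (a - 1)^3 = a^2, whence (a / (a - 1))^3 = a. Stated over a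
    field, it serves for the real number alpha and for its conjugate. *)
Lemma beta_relations {L : fieldType} (a : L) :
  a ^+ 3 - 4 * a ^+ 2 + 3 * a - 1 = 0 ->
  let x := a / (a - 1) in x ^+ 3 = x ^+ 2 + 1 /\ a = x ^+ 3.
Proof.
move=> h; have a1 : a - 1 != 0.
  apply/eqP => e; have ea : a = 1 by rewrite -[LHS](subrK 1) e add0r.
  move/eqP: h; rewrite ea !expr1n !mulr1 (_ : 1 - 4 + 3 - 1 = - 1); last by ring.
  by rewrite oppr_eq0 oner_eq0.
have a0 : a != 0.
  apply/eqP => e; move/eqP: h; rewrite e !expr0n /= !mulr0 subr0 !add0r.
  by rewrite oppr_eq0 oner_eq0.
have c0 : (a - 1) ^+ 3 != 0 by rewrite expf_neq0.
have e3 : (a - 1) ^+ 3 = a ^+ 2.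
  by apply/eqP; rewrite -subr_eq0 -[X in _ == X]h; apply/eqP; ring.
have x3 : (a / (a - 1)) ^+ 3 = a.
  by rewrite expr_div_n e3 exprS mulfK ?expf_neq0.
split=> //=; rewrite x3.
apply: (mulIf (expf_neq0 2 a1)); rewrite mulrDl expr_div_n divfK ?expf_neq0// mul1r.
by apply/eqP; rewrite -subr_eq0 -[X in _ == X]h; apply/eqP; ring.
Qed.

Section tiling.
Context {R : realType} (beta : R) (b : R[i]) (F : set R[i]) (mu : R).
Hypothesis beta3 : beta ^+ 3 = beta ^+ 2 + 1.
Hypothesis b3 : b ^+ 3 = b ^+ 2 + 1.
Hypothesis b_nonreal : complex.Im b != 0.
Hypothesis F_compact : compact F.
Hypothesis F_nonempty : F !=set0.
Hypothesis F_eq : forall z, F z <->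
  (exists2 x, F x & z = b ^+ 3 * x) \/ (exists2 x, F x & z = b * (1 - x)).
Hypothesis mu0 : 0 < mu.
Hypothesis mu10 : mu ^+ 10 = mu ^+ 7 + mu ^+ 3 + 2 * mu + 1.
Hypothesis mu_beta : mu < beta.
Variables (K : fieldType) (psi : {rmorphism K -> R[i]}) (a : K).
Hypothesis psi_beta : psi (beta_of a) = b.
Notation sem := (sem b F).

(** The shift by -1 comes from y - F = (y - 1) + (1 - F). *)
Definition tile_index (t : tile) : R[i] + R[i] :=
  let: (y, e, j) := t in if e then inl (emb b y) else inr (emb b y - 1).

Lemma tile_index_family t : window 0 t -> tent_family psi F (tile_index t) = sem t.
Proof using All.
move=> /window0[y1 [y2 [e ->]]] /=; apply/seteqP; case: e => /=; split=> z /=.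
- by move=> [x Fx <-]; exists x => //; rewrite zr1 expr0; ring.
- by move=> [x Fx ->]; exists x => //; rewrite zr1 expr0; ring.
- move=> [_ [x Fx <-] <-]; exists x => //.
  by rewrite (zrN 1) zr1 expr0 rmorph1; ring.
- move=> [x Fx ->]; exists (psi 1 - x); first by exists x.
  by rewrite (zrN 1) zr1 expr0 rmorph1; ring.
Qed.

(** The point u1 (1 - b) + u2 (1 - b^2) has coordinates (u1 + u2, -u1, -u2), so the lattice is the
    part of Z[b] whose height at level 0 is zero. *)
Lemma tent_latticeP x : tent_lattice psi a x <->
  exists y1 y2 : Z, x = emb b (- y1 - y2, y1, y2)%BZ.
Proof using All.
rewrite /tent_lattice /= !rmorphB rmorphXn rmorph1 psi_beta; split.
  move=> [u1 [u2 ->]]; exists (- Z_of_int u1)%BZ, (- Z_of_int u2)%BZ.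
  by rewrite !zrE !zr_intK; ring.
move=> [y1 [y2 ->]]; exists (- int_of_Z y1), (- int_of_Z y2).
by rewrite !zrE /zr !rmorphN /=; ring.
Qed.

Lemma window0_mem y1 y2 (e : bool) :
  window 0 ((if e then 0 else 1) - y1 - y2, y1, y2, e, 0%N)%BZ.
Proof using All. by rewrite /window height0 (_ : wd _ = 1%BZ)//; case: e; lia. Qed.

Lemma emb_shift y1 y2 :
  emb b (1 - y1 - y2, y1, y2)%BZ = emb b (- y1 - y2, y1, y2)%BZ + 1 :> R[i].
Proof using All. by rewrite /= !zrE; ring. Qed.

Lemma tent_indexP i : tent_index psi a i <-> exists2 t, window 0 t & i = tile_index t.
Proof using All.
split=> [[[x /tent_latticeP[y1 [y2 ->]] <-]|[x /tent_latticeP[y1 [y2 ->]] <-]]|].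
- exists ((if true then 0 else 1) - y1 - y2, y1, y2, true, 0%N)%BZ.
    exact: (window0_mem y1 y2 true).
  by [].
- exists ((if false then 0 else 1) - y1 - y2, y1, y2, false, 0%N)%BZ.
    exact: (window0_mem y1 y2 false).
  by rewrite /tile_index emb_shift addrK.
move=> [_ /window0[y1 [y2 [e ->]]] ->]; case: e; [left|right].
  by exists (emb b (- y1 - y2, y1, y2)%BZ) => //; apply/tent_latticeP; exists y1, y2.
exists (emb b (- y1 - y2, y1, y2)%BZ); first by apply/tent_latticeP; exists y1, y2.
by rewrite /tile_index emb_shift addrK.
Qed.

Theorem tent_tiling : proper_tiling (tent_index psi a) (tent_family psi F).
Proof using All.
split.
- move=> i /tent_indexP[t wt ->]; rewrite tile_index_family//.
  exact: (@sem_compact R beta b F beta3 b3 b_nonreal F_compact).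
- apply/seteqP; split=> // z _.
  have [t wt tz] := tiles_cover beta3 b3 b_nonreal F_compact F_nonempty F_eq z.
  exists (tile_index t); first by apply/tent_indexP; exists t.
  by rewrite tile_index_family.
- move=> A cA; have [M M0 AM] := compact_normc_bounded cA.
  have [k kP] := initial_tiles_near beta3 b3 b_nonreal F_compact F_eq M.
  apply: (@sub_finite_set _ _ (tile_index @` [set` initial_tiles k])).
    move=> i [/tent_indexP[t wt ->]]; rewrite tile_index_family// => -[z [Az tz]].
    by exists t => //; exact: kP wt tz (AM z Az).
  by apply: finite_image; exact: finite_seq.
(* Pairs of tiles are numbered by their codes, so the points lying in several tiles form a countable
   union of null sets. *)
rewrite /ae_complex; pose N (k : nat) : set (R * R) :=
  if unpickle k is Some tu then
    if [&& window 0 tu.1, window 0 tu.2 & tu.1 != tu.2] then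
      [set v | sem tu.1 (Complex v.1 v.2) /\ sem tu.2 (Complex v.1 v.2)]
    else set0
  else set0.
have subN : ~` [set v : R * R | exists! i, tent_index psi a i /\
    tent_family psi F i (Complex v.1 v.2)] `<=` \bigcup_k N k.
  move=> [x y] /= nu; apply: contrapT => nN; apply: nu.
  have [t wt tz] := tiles_cover beta3 b3 b_nonreal F_compact F_nonempty F_eq (Complex x y).
  exists (tile_index t); split.
    by split; [apply/tent_indexP; exists t|rewrite tile_index_family].
  move=> _ [/tent_indexP[u wu ->]]; rewrite tile_index_family// => uz.
  congr tile_index; apply/eqP; apply: contrapT => /negP tu; apply: nN.
  exists (pickle (t, u)); first exact: I.
  have := pickleK (t, u); rewrite /N; case: (unpickle _) => [_ [->]|//].
  by rewrite [(t, u).1]/= [(t, u).2]/= wt wu tu; split.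
have nN : (@lebesgue_measure R \x @lebesgue_measure R)%E.-negligible (\bigcup_k N k).
  apply: negligible_bigcup => k; rewrite /N; case: (unpickle k) => [[t u] /=|].
    case: ifP => [/and3P[wt wu tu]|_]; last exact: negligible_set0.
    exact: (overlap_negligible beta3 b3 b_nonreal F_compact F_eq mu0 mu10 mu_beta).
  exact: negligible_set0.
have [B [mB B0 NB]] := nN; exists B; split => //.
exact: subset_trans subN NB.
Qed.
End tiling.

Lemma mu_approx {R : realType} (beta mu : R) : beta ^+ 3 = beta ^+ 2 + 1 ->
  127 * 10 ^+ 6 + 3624 <= 10 ^+ 8 * mu <= 127 * 10 ^+ 6 + 3625 ->
  [/\ 1 < mu, mu < beta & `|mu - (127 / 10 ^+ 2 + 4 / 10 ^+ 5)| <= 5 / 10 ^+ 6].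
Proof.
move=> /beta_decimals/andP[b1 b2] /andP[h1 h2]; split; [lra|lra|].
by rewrite ler_norml; apply/andP; split; lra.
Qed.

Lemma beta_sqr_decimals {R : realType} (beta : R) : beta ^+ 3 = beta ^+ 2 + 1 ->
  (214 * 10 ^+ 3 + 785) * 10 ^+ 9 <= 10 ^+ 14 * beta ^+ 2
    <= (214 * 10 ^+ 3 + 795) * 10 ^+ 9.
Proof.
move=> beta3; have /andP[b1 b2] := beta_bounds beta3.
have den0 : 0 < zr beta_den :> R by rewrite -zr0 ltr_zr.
have lo0 : 0 < zr beta_lo :> R by rewrite -zr0 ltr_zr.
have sq (x y : R) : 0 < x -> x < y -> x ^+ 2 <= y ^+ 2.
  move=> x0 xy; apply: lerXn2r; rewrite ?nnegrE; [exact: ltW| |exact: ltW].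
  exact: ltW (lt_trans x0 xy).
have h1 := sq _ _ lo0 b1; have h2 := sq _ _ (lt_trans lo0 b1) b2.
have dE : zr beta_den ^+ 2 = 10 ^+ 14 :> R.
  have -> : beta_den = (10 ^ Z.of_nat 7)%BZ by vm_compute.
  by rewrite zrX (zr_nat 10) -exprM.
rewrite -dE -exprMn.
have dec (c : nat) : (214 * 10 ^+ 3 + c%:R) * 10 ^+ 9 =
    zr ((Z.of_nat 214 * 10 ^ Z.of_nat 3 + Z.of_nat c) * 10 ^ Z.of_nat 9)%BZ :> R.
  by rewrite (zrM (_ + _)%BZ) zr_decimal zrX (zr_nat 10).
rewrite (dec 785)%N (dec 795)%N; apply/andP; split.
  apply: le_trans h1; rewrite -[_ ^+ 2](zrX beta_lo 2) ler_zr.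
  by vm_cast_no_check (erefl true).
apply: (le_trans h2); rewrite -[_ ^+ 2](zrX beta_hi 2) ler_zr.
by vm_cast_no_check (erefl true).
Qed.

Lemma alpha_approx {R : realType} (beta : R) : beta ^+ 3 = beta ^+ 2 + 1 ->
  `|beta ^+ 2 + 1 - (314 / 10 ^+ 2 + 79 / 10 ^+ 4)| <= 5 / 10 ^+ 5.
Proof.
move=> /beta_sqr_decimals/andP[b1 b2].
by rewrite ler_norml; apply/andP; split; lra.
Qed.

Theorem theorem5p6 (R : realType) (alpha : R)
    (alpha_root : root (alpha_poly R) alpha)
    (alpha' : R[i]) (alpha'_conj : galois_conjugate alpha alpha')
    (alpha'_nonreal : alpha' \isn't Num.real)
    (psi : {rmorphism Qalpha alpha -> R[i]})
    (psi_alpha : psi (Qalpha_gen alpha) = alpha')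
    (F : set R[i]) (F_tile : is_tent_tile psi (Qalpha_gen alpha) F) :
  let beta : R := Qalpha_inj (beta_of (Qalpha_gen alpha)) in
  [/\ `|alpha - (314 / 10 ^+ 2 + 79 / 10 ^+ 4)| <= 5 / 10 ^+ 5,
      exists mu : R,
        [/\ dominant_root (mu_poly R[i]) (Complex mu 0),
            `|mu - (127 / 10 ^+ 2 + 4 / 10 ^+ 5)| <= 5 / 10 ^+ 6,
            hausdorff_dim complex_dist (boundary F) = (2 * ln mu / ln beta)%:E
          & `|2 * ln mu / ln beta - (125 / 10 ^+ 2 + 74 / 10 ^+ 5)|
              <= 5 / 10 ^+ 6]
    & proper_tiling (tent_index psi (Qalpha_gen alpha)) (tent_family psi F)].
Proof.
move=> beta.
have alpha_eq (L : comNzRingType) (x : L) :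
    (alpha_poly L).[x] = x ^+ 3 - 4 * x ^+ 2 + 3 * x - 1.
  by rewrite /alpha_poly !(hornerD, hornerN, hornerMn, hornerXn, hornerX, hornerC); ring.
have p0 : alpha_poly rat != 0.
  apply/eqP => /(congr1 (fun p => p.[0])); rewrite alpha_eq horner0.
  by rewrite !expr0n /= !mulr0 !subr0 !add0r => /eqP; rewrite oppr_eq0 oner_eq0.
have map_alpha (L : fieldType) (f : {rmorphism rat -> L}) :
    map_poly f (alpha_poly rat) = alpha_poly L.
  by rewrite /alpha_poly !(rmorphB, rmorphD, rmorphMn, rmorphXn) /= map_polyX rmorph1.
have pr : root (map_poly (@ratr R) (alpha_poly rat)) alpha by rewrite map_alpha.
have morph_alpha (L L' : comNzRingType) (h : {rmorphism L -> L'}) x :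
    h (x ^+ 3 - 4 * x ^+ 2 + 3 * x - 1) =
    h x ^+ 3 - 4 * h x ^+ 2 + 3 * h x - 1.
  rewrite rmorphB rmorphD rmorphB (rmorphM h 4) (rmorphM h 3) !rmorph_nat.
  by rewrite !rmorphXn rmorph1.
set g := Qalpha_gen alpha.
pose f : {rmorphism Qalpha alpha -> R} :=
  @subfx_inj _ _ (@ratr R) alpha (alpha_poly rat).
have fg : f g = alpha by rewrite /f /= /g /Qalpha_gen subfx_inj_root.
have eR : alpha ^+ 3 - 4 * alpha ^+ 2 + 3 * alpha - 1 = 0.
  by rewrite -alpha_eq; exact/eqP.
have eg : g ^+ 3 - 4 * g ^+ 2 + 3 * g - 1 = 0.
  apply: (fmorph_inj f); rewrite rmorph0 -[RHS]eR.
  by rewrite morph_alpha fg.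
have eC : alpha' ^+ 3 - 4 * alpha' ^+ 2 + 3 * alpha' - 1 = 0.
  move: (congr1 psi eg); rewrite rmorph0 => <-.
  by rewrite morph_alpha psi_alpha.
have [beta3 alphaE] := beta_relations eR.
have betaE : beta = alpha / (alpha - 1).
  rewrite -[beta]/(f (beta_of g)) /beta_of fmorph_div rmorphB rmorph1.
  by rewrite fg.
rewrite -betaE in beta3 alphaE.
pose b := psi (beta_of g).
have bE : b = alpha' / (alpha' - 1).
  by rewrite /b /beta_of fmorph_div rmorphB rmorph1 psi_alpha.
have [b3 alpha'E] := beta_relations eC; rewrite -bE in b3 alpha'E.
have b_nonreal : complex.Im b != 0.
  apply: contra alpha'_nonreal => /eqP ib.
  have -> : alpha' = (complex.Re b ^+ 3)%:C%C.
    by rewrite alpha'E rmorphXn; congr (_ ^+ 3); case: (b) ib => x y /= ->.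
  by rewrite realE !lecE /= eqxx /= le_total.
have [F0 cF FE] := F_tile.
(* As psi(alpha) = alpha' = b^3, both defining maps are expressed through b alone. *)
have F_eq z : F z <->
    (exists2 x, F x & z = b ^+ 3 * x) \/ (exists2 x, F x & z = b * (1 - x)).
  rewrite [in X in X <-> _]FE; split=> [[[x Fx <-]|[x Fx <-]]|[[x Fx ->]|[x Fx ->]]].
  - by left; exists x => //; rewrite /tent_left psi_alpha alpha'E.
  - by right; exists x => //; rewrite /tent_right rmorph1.
  - by left; exists x => //; rewrite /tent_left psi_alpha alpha'E.
  - by right; exists x => //; rewrite /tent_right rmorph1.
have [mu [m1 m2 mu10]] := @mu_exists R.
have [mu1 mu_beta mu_approx] := mu_approx beta3 (mu_decimals m1 m2).
have mu0 : 0 < mu := lt_trans ltr01 mu1.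
have ratio := ratio_approx beta3 m1 m2 mu0.
move=> {m1 m2}.
split.
- have -> : alpha = beta ^+ 2 + 1 by rewrite alphaE.
  exact: alpha_approx.
- exists mu; split.
  + exact: mu_dominant.
  + exact: mu_approx.
  + exact: (dim_boundary beta3 b3 b_nonreal cF F0 F_eq mu1 mu10 mu_beta).
  + exact: ratio.
exact: (@tent_tiling R beta b F mu beta3 b3 b_nonreal cF F0 F_eq mu0 mu10 mu_beta).
Qed.
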